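(* (i) Every irreducible quasifinite module over $\mathcal{W}(\mathbb{Z},1)^{(1)}$ or over $\mathcal{W}_\infty=\widehat{\mathcal{W}}(\mathbb{Z},1)^{(1)}$ is a highest weight module, a lowest weight module, or a module of the intermediate series. (ii) Let $\Gamma$ be a nondegenerate additive subgroup of $\mathbb{F}^n$ that is not isomorphic to $\mathbb{Z}$. Every irreducible quasifinite $\mathcal{W}(\Gamma,n)^{(1)}$-module is a module of the intermediate series. Likewise, for $n=1$, every irreducible quasifinite $\widehat{\mathcal{W}}(\Gamma,1)^{(1)}$-module is a module of the intermediate series.
   Context: Let $\mathbb{F}$ be an algebraically closed field of characteristic zero, and let $\Gamma$ be a nondegenerate additive subgroup of $\mathbb{F}^n$, meaning that $\Gamma$ contains an $\mathbb{F}$-basis of $\mathbb{F}^n$. Elements of $\mathbb{F}^n$ are written $\alpha=(\alpha_1,\dots,\alpha_n)$. Let $\mathbb{F}[\Gamma]=\mathrm{span}\{t^\alpha\mid\alpha\in\Gamma\}$ be the group algebra, with $t^\alpha t^\beta=t^{\alpha+\beta}$. The degree derivations $D_i$ of $\mathbb{F}[\Gamma]$ are given by $D_i(t^\alpha)=\alpha_i t^\alpha$. Set $\mathcal{W}(\Gamma,n)=\mathbb{F}[\Gamma]\otimes\mathbb{F}[D_1,\dots,D_n]$, which has basis $t^\alpha D^\mu$ with $\alpha\in\Gamma$, $\mu\in\mathbb{Z}_+^n$ and $D^\mu=\prod_i D_i^{\mu_i}$. Its associative product is $$(t^\alpha D^\mu)(t^\beta D^\nu)=\sum_{\lambda\in\mathbb{Z}_+^n}\binom{\mu}{\lambda}\beta^\lambda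 t^{\alpha+\beta}D^{\mu+\nu-\lambda},$$ where $\beta^\lambda=\prod_i\beta_i^{\lambda_i}$ and $\binom{\mu}{\lambda}=\prod_i\binom{\mu_i}{\lambda_i}$. The Lie bracket is the commutator. The subalgebra $\mathcal{W}(\Gamma,n)^{(1)}$ is spanned by all $t^\alpha D^\mu$ with $|\mu|=\sum_i\mu_i\ge1$. It is $\Gamma$-graded, with degree-$\alpha$ component spanned by $t^\alpha D^\mu$, $\mu\neq0$. For $n=1$, write $D=D_1$ and $[D]_\mu=D(D-1)\cdots(D-\mu+1)$. The central extension $\widehat{\mathcal{W}}(\Gamma,1)=\mathcal{W}(\Gamma,1)\oplus\mathbb{F}C$ has bracket $$[t^\alpha[D]_\mu,t^\beta[D]_\nu]=(t^\alpha[D]_\mu)(t^\beta[D]_\nu)-(t^\beta[D]_\nu)(t^\alpha[D]_\mu)+\delta_{\alpha,-\beta}(-1)^\mu\mu!\nu!\binom{\alpha+\mu}{\mu+\nu+1}C,$$ with $C$ central. The subalgebra $\widehat{\mathcal{W}}(\Gamma,1)^{(1)}$ is spanned by $C$ and the $t^\alpha[D]_\mu$ with $\mu\ge1$; $C$ has degree $0$. Then $\mathcal{W}_\infty=\widehat{\mathcal{W}}(\mathbb{Z},1)^{(1)}$. A module $V$ over one of these $\Gamma$-graded algebras $L$ is quasifinite if $V=\bigoplus_{\beta\in\Gamma}V_\beta$, $L_\alpha V_\beta\subset V_{\alpha+\beta}$, and $\dim V_\beta<\infty$ for all $\alpha,\beta\in\Gamma$. For $\alpha\in\mathbb{F}^n$,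 the modules $A_\alpha$ and $B_\alpha$ have basis $\{y_\gamma\mid\gamma\in\Gamma\}$, $C$ acts as $0$, and for $\mu\neq0$: - in $A_\alpha$, $t^\beta D^\mu y_\gamma=(\alpha+\gamma)^\mu y_{\beta+\gamma}$; - in $B_\alpha$, $t^\beta D^\mu y_\gamma=(-1)^{|\mu|+1}(\alpha+\beta+\gamma)^\mu y_{\beta+\gamma}$. A module of the intermediate series is a module isomorphic to a subquotient of some $A_\alpha$ or $B_\alpha$. For a $\mathbb{Z}$-graded algebra $L$, let $L_+$ (resp. $L_-$, $L_0$) be the span of the components of positive (resp. negative, zero) degree. A highest (resp. lowest) weight module is a module generated by a nonzero homogeneous vector $v$ that is a common eigenvector of $L_0$ and satisfies $L_+v=0$ (resp. $L_-v=0$). *)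

(* Defs.v *)
From HB Require Import structures.
From mathcomp Require Import all_boot all_order all_algebra.
From mathcomp Require Import monalg.
From mathcomp Require finmap.

Set Implicit Arguments.
Unset Strict Implicit.
Unset Printing Implicit Defensive.

Import Order.TTheory GRing.Theory Num.Theory.
Local Open Scope ring_scope.

(* Generic notions for a module V over a Lie algebra L that is given   *)
(* through a spanning family of elements indexed by I: [adm i] says    *)
(* that the index i denotes an element of L, [act i] is the action of  *)
(* that element on V, and [deg i] its degree in the grading group G.   *)
Section Generic.
Context (F : fieldType) (G : zmodType) (I : Type)
        (adm : I -> Prop) (deg : I -> G).

Section OnV.
Context (V : lmodType F) (act : I -> V -> V).

Definition submodule (S : V -> Prop) : Prop :=
  [/\ S 0, (forall u v, S u -> S v -> S (u + v)),
      (forall (a : F) v, S v -> S (a *: v))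
    & (forall i v, adm i -> S v -> S (act i v))].

Definition irreducible : Prop :=
  (exists v : V, v != 0) /\
  forall S, submodule S -> (exists v, S v /\ v != 0) -> forall v, S v.

Definition quasifinite (Gamma : G -> Prop) (Vg : G -> V -> Prop) : Prop :=
      (forall beta, Vg beta 0 /\
         (forall u v, Vg beta u -> Vg beta v -> Vg beta (u + v)) /\
         (forall (a : F) v, Vg beta v -> Vg beta (a *: v))) /\
      (forall beta v, Vg beta v -> v != 0 -> Gamma beta) /\
      (forall v, exists s : seq (G * V),
          (forall x, x \in s -> Vg x.1 x.2) /\ v = \sum_(x <- s) x.2) /\
      (forall s : seq (G * V), uniq (map fst s) ->
          (forall x, x \in s -> Vg x.1 x.2) ->
          \sum_(x <- s) x.2 = 0 -> forall x, x \in s -> x.2 = 0) /\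
      (forall beta, exists b : seq V, forall v, Vg beta v ->
          exists c : 'I_(size b) -> F, v = \sum_(k < size b) c k *: b`_k) /\
      (forall i beta v, adm i -> Vg beta v -> Vg (deg i + beta) (act i v)).

Definition generated_by (v : V) : Prop :=
  forall S, submodule S -> S v -> forall w, S w.

Definition weight_module_wrt (Vg : G -> V -> Prop) (pos : G -> Prop) : Prop :=
  exists (beta : G) (v : V),
    [/\ Vg beta v, v != 0,
        (forall i, adm i -> deg i = 0 -> exists c : F, act i v = c *: v),
        (forall i, adm i -> pos (deg i) -> act i v = 0)
      & generated_by v].

End OnV.

(* V is isomorphic to a subquotient W/U of a module Y (action actY),
   where U, W are submodules of Y contained in the subspace P of Y
   (P is the module we take subquotients of, a submodule of Y). *)
Definition subquotient_iso (V : lmodType F) (act : I -> V -> V) (Y : lmodType F) (actY : I -> Y -> Y)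
    (P : Y -> Prop) : Prop :=
  exists (U W : Y -> Prop) (f : Y -> V),
    [/\ submodule actY U, submodule actY W,
        (forall y, U y -> W y) & (forall y, W y -> P y)] /\
    (forall (a : F) y z, W y -> W z -> f (a *: y + z) = a *: f y + f z) /\
    (forall v, exists y, W y /\ f y = v) /\
    (forall y, W y -> (f y = 0 <-> U y)) /\
    (forall i y, adm i -> W y -> f (actY i y) = act i (f y)).

Definition add_subgroup (Gamma : G -> Prop) : Prop :=
  Gamma 0 /\ forall x y, Gamma x -> Gamma y -> Gamma (x - y).

Definition iso_to_Z (Gamma : G -> Prop) : Prop :=
  exists f : int -> G,
    [/\ forall a b, f (a + b) = f a + f b, injective f
      & forall x, Gamma x <-> exists k, x = f k].
End Generic.

(* Index (alpha, mu) denotes t^alpha D^mu.                            *)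
Section Wn.
Context (F : fieldType) (n : nat).

Definition Wind := ('rV[F]_n * {ffun 'I_n -> nat})%type.
Definition Wadm (Gamma : 'rV[F]_n -> Prop) (i : Wind) : Prop :=
  Gamma i.1 /\ i.2 != [ffun => 0%N].
Definition Wdeg (i : Wind) : 'rV[F]_n := i.1.

Definition mbinom (mu la : {ffun 'I_n -> nat}) : F :=
  (\prod_(i < n) 'C(mu i, la i))%:R.
Definition mpow (beta : 'rV[F]_n) (la : {ffun 'I_n -> nat}) : F :=
  \prod_(i < n) beta 0 i ^+ la i.
Definition mabs (mu : {ffun 'I_n -> nat}) : nat := \sum_(i < n) mu i.

Definition W_module (Gamma : 'rV[F]_n -> Prop) (V : lmodType F)
    (act : Wind -> V -> V) : Prop :=
  (forall i (a : F) u v, act i (a *: u + v) = a *: act i u + act i v) /\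
  forall (alpha beta : 'rV[F]_n) (mu nu : {ffun 'I_n -> nat}) (v : V),
    Wadm Gamma (alpha, mu) -> Wadm Gamma (beta, nu) ->
    let N := (mabs mu + mabs nu).+1 in
    let lf (la : {ffun 'I_n -> 'I_N}) := [ffun i => nat_of_ord (la i)] in
    let ex (la : {ffun 'I_n -> 'I_N}) :=
        [ffun i => (mu i + nu i - lf la i)%N] in
    act (alpha, mu) (act (beta, nu) v) - act (beta, nu) (act (alpha, mu) v)
    = \sum_(la : {ffun 'I_n -> 'I_N})
          (mbinom mu (lf la) * mpow beta (lf la)) *: act (alpha + beta, ex la) v
    - \sum_(la : {ffun 'I_n -> 'I_N})
          (mbinom nu (lf la) * mpow alpha (lf la)) *: act (alpha + beta, ex la) v.

(* The modules A_alpha, B_alpha, realized inside the free module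
   {malg F['rV_n]} with basis y_gamma = << gamma >>; the actual module
   A_alpha / B_alpha is the submodule of elements supported in Gamma. *)
Definition W_actA (alpha : 'rV[F]_n) (i : Wind)
    (y : {malg F['rV[F]_n]}) : {malg F['rV[F]_n]} :=
  \sum_(gamma <- finmap.enum_fset (msupp y))
     (y@_gamma * mpow (alpha + gamma) i.2) *: << i.1 + gamma >>.
Definition W_actB (alpha : 'rV[F]_n) (i : Wind)
    (y : {malg F['rV[F]_n]}) : {malg F['rV[F]_n]} :=
  \sum_(gamma <- finmap.enum_fset (msupp y))
     (y@_gamma * ((-1) ^+ (mabs i.2).+1 * mpow (alpha + i.1 + gamma) i.2))
        *: << i.1 + gamma >>.

Definition supported_in (Gamma : 'rV[F]_n -> Prop) (y : {malg F['rV[F]_n]}) :=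
  forall gamma, y@_gamma != 0 -> Gamma gamma.

Definition W_intermediate (Gamma : 'rV[F]_n -> Prop) (V : lmodType F)
    (act : Wind -> V -> V) : Prop :=
  exists alpha : 'rV[F]_n,
    subquotient_iso (Wadm Gamma) act (W_actA alpha) (supported_in Gamma) \/
    subquotient_iso (Wadm Gamma) act (W_actB alpha) (supported_in Gamma).

Definition nondegenerate_subgroup (Gamma : 'rV[F]_n -> Prop) : Prop :=
  exists M : 'M[F]_n, (forall i, Gamma (row i M)) /\ M \in unitmx.
End Wn.

(* Index Some (alpha, p) denotes t^alpha p(D) (p in D F[D], i.e. in the *)
(* span of the [D]_mu, mu >= 1); index None denotes C.                 *)
Section Hat.
Context (F : fieldType).

Definition Hind := option (F * {poly F}).
Definition Hadm (Gamma : F -> Prop) (i : Hind) : Prop :=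
  match i with Some (a, p) => Gamma a /\ p.[0] = 0 | None => True end.
Definition Hdeg (i : Hind) : F := if i is Some (a, _) then a else 0.

Definition ffact (mu : nat) : {poly F} := \prod_(i < mu) ('X - (i%:R)%:P).
Definition gbinom (a : F) (k : nat) : F :=
  (\prod_(i < k) (a - i%:R)) / (k`!)%:R.

Definition H_module (Gamma : F -> Prop) (V : lmodType F)
    (act : Hind -> V -> V) : Prop :=
  [/\ (forall i (a : F) u v, act i (a *: u + v) = a *: act i u + act i v),
      (forall alpha (c : F) p q v, Gamma alpha -> p.[0] = 0 -> q.[0] = 0 ->
         act (Some (alpha, c *: p + q)) v
         = c *: act (Some (alpha, p)) v + act (Some (alpha, q)) v),
      (forall i v, Hadm Gamma i -> act None (act i v) = act i (act None v))
    &
      (forall alpha beta (mu nu : nat) v, Gamma alpha -> Gamma beta ->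
         (0 < mu)%N -> (0 < nu)%N ->
         act (Some (alpha, ffact mu)) (act (Some (beta, ffact nu)) v)
         - act (Some (beta, ffact nu)) (act (Some (alpha, ffact mu)) v)
         = act (Some (alpha + beta,
                  (ffact mu \Po ('X + beta%:P)) * ffact nu
                  - (ffact nu \Po ('X + alpha%:P)) * ffact mu)) v
           + (if alpha == - beta then
                (-1) ^+ mu * (mu`!)%:R * (nu`!)%:R
                  * gbinom (alpha + mu%:R) (mu + nu).+1
              else 0) *: act None v)].

Definition H_actA (alpha : F) (i : Hind) (y : {malg F[F]}) : {malg F[F]} :=
  match i with
  | Some (b, p) => \sum_(gamma <- finmap.enum_fset (msupp y)) (y@_gamma * p.[alpha + gamma]) *: << b + gamma >>
  | None => 0
  end.
Definition H_actB (alpha : F) (i : Hind) (y : {malg F[F]}) : {malg F[F]} :=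
  match i with
  | Some (b, p) => \sum_(gamma <- finmap.enum_fset (msupp y))
                     (y@_gamma * - p.[- (alpha + b + gamma)]) *: << b + gamma >>
  | None => 0
  end.

Definition Fsupported_in (Gamma : F -> Prop) (y : {malg F[F]}) :=
  forall gamma, y@_gamma != 0 -> Gamma gamma.

Definition H_intermediate (Gamma : F -> Prop) (V : lmodType F)
    (act : Hind -> V -> V) : Prop :=
  exists alpha : F,
    subquotient_iso (Hadm Gamma) act (H_actA alpha) (Fsupported_in Gamma) \/
    subquotient_iso (Hadm Gamma) act (H_actB alpha) (Fsupported_in Gamma).
End Hat.

Definition Zrow (F : fieldType) (x : 'rV[F]_1) : Prop :=
  exists k : int, x = const_mx (k%:~R).
Definition Zrow_pos (F : fieldType) (x : 'rV[F]_1) : Prop :=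
  exists k : int, (0 < k)%R /\ x = const_mx (k%:~R).
Definition Zrow_neg (F : fieldType) (x : 'rV[F]_1) : Prop :=
  exists k : int, (k < 0)%R /\ x = const_mx (k%:~R).
Definition ZF (F : fieldType) (x : F) : Prop := exists k : int, x = k%:~R.
Definition ZF_pos (F : fieldType) (x : F) : Prop :=
  exists k : int, (0 < k)%R /\ x = k%:~R.
Definition ZF_neg (F : fieldType) (x : F) : Prop :=
  exists k : int, (k < 0)%R /\ x = k%:~R.

(* Main.v *)
(* Think of t^b p(D) as moving a particle from each site [a] to [a + b] with amplitude
   p(a).  In a quasifinite module the [p] for which t^b p(D), b <> 0, kills a given graded
   piece form an ideal of finite codimension (take commutators with degree 0), so idempotents
   separate the sites and t^b p(D) becomes a locally finite sum of hops E(a, a + b) obeying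
   the commutation rules of matrix units.  Fix x <> 0 in Gamma.  The vectors on which no
   hop onto (resp. off) the far sites of any ray with direction x acts form a submodule,
   hence are all vectors or none.
   - If both kinds of far hops act, compositions of two of them give infinitely many
     independent vectors in one graded piece; if neither acts, all hops vanish.  Otherwise
     exactly one kind acts for x, and exactly one for -x.
   - If hops onto far sites act along x, and no hop off far sites acts along -x, then a
     vector produced by a hop onto a far site is a single particle: the other hops kill it,
     and it generates a module of type A.  The anti-involution D -> - D - b of t^b p(D)
     exchanges the two kinds of hops and gives type B.
   - The only other possibility is that all particles arrive from one end of the x-lines and
     leave towards the other end.  After a sideways hop onto a line avoiding a given finite
     set they could leave towards both ends; such lines exist unless Gamma is infinite
     cyclic, in which case the local nilpotency of the hops yields a vector killed by all
     positive (or all negative) degrees.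
   In the central extension C acts by a scalar; the scalar vanishes in the first two cases
   because the brackets of t^a D and t^-a D have a central term cubic in a. *)
Require Import Defs.
From HB Require Import structures.
From mathcomp Require Import all_boot all_order all_algebra zify ring.
From mathcomp Require Import finmap monalg.
From Stdlib Require Import Classical ClassicalEpsilon.

Set Implicit Arguments.
Unset Strict Implicit.
Unset Printing Implicit Defensive.

Import GRing.Theory.
Local Open Scope ring_scope.

(** * Linear algebra without bases *)

Section LinearMaps.
Context (F : fieldType) (V : lmodType F).

(** Two obstacles shape the constructions. The first is the site 0: only symbols [p] vanishing at 0
    occur, so a hop off 0 carries a germ vanishing there. Duality moves this condition to the hops
    onto 0. The flag [sg] records which version holds, one argument serves both, and every detour
    must avoid 0. The second is degree 0. The ideal argument needs [tau b p - p] to be arbitrary,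
    which fails for [b = 0]; hence there are no diagonal matrix units, and brackets of opposite
    degrees may carry a central scalar. So the hop relations leave out a hop paired with its own
    reverse, a particle returns to its site through a third one, and degree-0 operators are
    recovered as sums of brackets. This is what allows the plain and the extended algebra to be
    treated together. Germs are needed because the killers of a graded piece may contain only powers
    of the maximal ideal at a site. That a hop depends on the value [f(a)] alone is a theorem of the
    one-particle case, where nilpotency is played against irreducibility. *)

Definition lin (f : V -> V) := forall (a : F) u v, f (a *: u + v) = a *: f u + f v.

Definition subspace (S : V -> Prop) :=
  S 0 /\ forall (a : F) u v, S u -> S v -> S (a *: u + v).

Section OneMap.
Context (f : V -> V) (fL : lin f).

Lemma lin0 : f 0 = 0.
Proof. by have /= := fL (-1) 0 0; rewrite scaler0 addr0 scaleN1r addNr. Qed.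

Lemma linD u v : f (u + v) = f u + f v.
Proof. by rewrite -[u in LHS]scale1r fL scale1r. Qed.

Lemma linZ a u : f (a *: u) = a *: f u.
Proof. by rewrite -[a *: u]addr0 fL lin0 addr0. Qed.

Lemma linN u : f (- u) = - f u.
Proof. by rewrite -scaleN1r linZ scaleN1r. Qed.

Lemma linB u v : f (u - v) = f u - f v.
Proof. by rewrite linD linN. Qed.

Lemma lin_sum I (r : seq I) (P : pred I) (x : I -> V) :
  f (\sum_(i <- r | P i) x i) = \sum_(i <- r | P i) f (x i).
Proof.
elim: r => [|i r IHr]; first by rewrite !big_nil lin0.
by rewrite !big_cons; case: ifP; rewrite // linD IHr.
Qed.

Lemma lin_iter k : lin (iter k f).
Proof. by elim: k => [|k IHk] a u v //=; rewrite IHk fL. Qed.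

Lemma lin_preim (S : V -> Prop) : subspace S -> subspace (fun v => S (f v)).
Proof. by move=> [S0 SL]; split=> [|a u v Su Sv]; rewrite ?lin0 // fL; apply: SL. Qed.

End OneMap.

Lemma lin_comp f g : lin f -> lin g -> lin (fun v => f (g v)).
Proof. by move=> fL gL a u v; rewrite gL fL. Qed.

Lemma lin_opp f : lin f -> lin (fun v => - f v).
Proof. by move=> fL a u v; rewrite fL opprD scalerN. Qed.

Lemma subspaceD (S : V -> Prop) u v : subspace S -> S u -> S v -> S (u + v).
Proof. by move=> [_ SL] Su Sv; rewrite -[u]scale1r; apply: SL. Qed.

Lemma subspaceZ (S : V -> Prop) a u : subspace S -> S u -> S (a *: u).
Proof. by move=> [S0 SL] Su; rewrite -[_ *: _]addr0; apply: SL. Qed.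

Lemma subspaceN (S : V -> Prop) u : subspace S -> S u -> S (- u).
Proof. by move=> SS Su; rewrite -scaleN1r; apply: subspaceZ. Qed.

Lemma subspaceB (S : V -> Prop) u v : subspace S -> S u -> S v -> S (u - v).
Proof. by move=> SS Su Sv; apply: subspaceD => //; apply: subspaceN. Qed.

Lemma subspace_sum (S : V -> Prop) I (r : seq I) (P : pred I) (x : I -> V) :
  subspace S -> (forall i, P i -> S (x i)) -> S (\sum_(i <- r | P i) x i).
Proof.
move=> SS Sx; elim: r => [|i r IHr]; first by rewrite big_nil; case: SS.
by rewrite big_cons; case: ifP => // Pi; apply: subspaceD => //; apply: Sx.
Qed.

Lemma subspace_iter (S : V -> Prop) f k v : (forall u, S u -> S (f u)) -> S v -> S (iter k f v).
Proof. by move=> Sf Sv; elim: k => //= k; apply: Sf. Qed.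

(* Any [d + 1] vectors of [A] are linearly dependent. *)
Definition dim_le (d : nat) (A : V -> Prop) :=
  forall x : nat -> V, (forall i, (i <= d)%N -> A (x i)) ->
  exists c : nat -> F, (exists2 i, (i <= d)%N & c i != 0) /\
    \sum_(i < d.+1) c i *: x i = 0.

Lemma dim_le_sub d (A B : V -> Prop) :
  (forall v, A v -> B v) -> dim_le d B -> dim_le d A.
Proof. by move=> AB dB x Ax; apply: dB => i id; apply/AB/Ax. Qed.

Lemma dim_le_span (A : V -> Prop) n (b : nat -> V) :
  (forall v, A v -> exists c : nat -> F, v = \sum_(k < n) c k *: b k) -> dim_le n A.
Proof.
move=> Ab x Ax.
have /fin_all_exists[c cP] (i : 'I_n.+1) :
    exists c : nat -> F, x i = \sum_(k < n) c k *: b k.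
  by apply: Ab; apply: Ax; rewrite -ltnS.
pose M := \matrix_(i < n.+1, k < n) c i k.
have : kermx M != 0.
  rewrite -mxrank_eq0 mxrank_ker -lt0n subn_gt0 ltnS; exact: rank_leq_col.
case/rowV0Pn => u /sub_kermxP uM u0.
pose e i : F := if insub i is Some j then u 0 j else 0.
have eE (j : 'I_n.+1) : e j = u 0 j by rewrite /e valK.
exists e; split.
  have [j uj] : exists j, u 0 j != 0.
    by apply/existsP; apply: contraNT u0 => /existsPn u0; apply/eqP/rowP => j;
      rewrite mxE; apply/eqP; have := u0 j; rewrite negbK.
  by exists (val j); [rewrite -ltnS ltn_ord|rewrite eE].
under eq_bigr do rewrite eE cP scaler_sumr.
rewrite exchange_big /=; apply: big1 => k _.
under eq_bigr do rewrite scalerA.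
rewrite -scaler_suml; have /rowP/(_ k) := uM; rewrite !mxE => uk.
suff -> : \sum_(i < n.+1) u 0 i * c i k = 0 by rewrite scale0r.
by rewrite -[RHS]uk; apply: eq_bigr => i _; rewrite mxE.
Qed.

(** An independent family that does not span can be prolonged, and length [d.+1] is impossible. *)
Lemma dim_le_spanning d (A : V -> Prop) : dim_le d A ->
  exists n (x : nat -> V), (forall i, (i < n)%N -> A (x i)) /\
    forall v, A v -> exists c : nat -> F, v = \sum_(i < n) c i *: x i.
Proof.
move=> dA; apply: NNPP => noSpan.
have : forall n, exists x : nat -> V, (forall i, (i < n)%N -> A (x i)) /\
    forall c : nat -> F, \sum_(i < n) c i *: x i = 0 -> forall i, (i < n)%N -> c i = 0.
  elim=> [|n [x [Ax xF]]]; first by exists (fun=> 0).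
  have [v [Av vc]] : exists v, A v /\ ~ exists c : nat -> F, v = \sum_(i < n) c i *: x i.
    apply: NNPP => noV; apply: noSpan; exists n, x; split=> // v Av.
    by apply: NNPP => nv; apply: noV; exists v.
  exists (fun i => if i == n then v else x i); split=> [i|e].
    by rewrite ltnS leq_eqVlt; case: eqP => //= _; apply: Ax.
  rewrite big_ord_recr /= eqxx.
  under eq_bigr => i _ do rewrite (ltn_eqF (ltn_ord i)).
  move=> e0; have en : e n = 0.
    apply/eqP; apply: contra_notT vc => en.
    exists (fun i => - ((e n)^-1 * e i)).
    have env : e n *: v = - \sum_(i < n) e i *: x i.
      by apply/eqP; rewrite -addr_eq0 addrC e0.
    rewrite -[LHS](scalerK en) env scalerN scaler_sumr -sumrN; apply: eq_bigr => i _.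
    by rewrite scalerA scaleNr.
  move: e0; rewrite en scale0r addr0 => /xF ex i.
  by rewrite ltnS leq_eqVlt => /orP[/eqP-> //|/ex].
move=> /(_ d.+1)[x [Ax xF]].
have [|c [[i id ci] c0]] := dA x; first by move=> i; rewrite -ltnS; apply: Ax.
by move: ci; rewrite (xF c) ?eqxx.
Qed.

(** A triangular test of independence: in a linear relation between the [x j], the operator of the
    largest index with nonzero coefficient annihilates all other terms. *)
Lemma dim_le_bound (A : V -> Prop) d (x : nat -> V) (O : nat -> V -> V) :
  dim_le d A -> (forall i, A (x i)) -> (forall i, lin (O i)) ->
  (forall i j, (j < i)%N -> O i (x j) = 0) -> (forall i, O i (x i) != 0) -> False.
Proof.
move=> dA Ax OL Ox0 Ox.
have [//|c [[i0 i0d ci0] c0]] := dA x.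
have [i /andP[id ci] imax] :
    exists2 i, (i <= d)%N && (c i != 0) & forall j, (j <= d)%N && (c j != 0) -> (j <= i)%N.
  have ex : exists i, (i <= d)%N && (c i != 0) by exists i0; rewrite i0d.
  have bd : forall i, (i <= d)%N && (c i != 0) -> (i <= d)%N by move=> i /andP[].
  by case: (ex_maxnP ex bd) => i; exists i.
have := congr1 (O i) c0; rewrite (lin_sum (OL i)) (lin0 (OL i)).
rewrite (bigD1 (Ordinal (id : (i < d.+1)%N))) //= big1 => [|j ji].
  by rewrite addr0 (linZ (OL i)) => /eqP; rewrite scaler_eq0 (negPf ci) (negPf (Ox i)).
rewrite (linZ (OL i)); have [ji'|ij|eji] := ltngtP j i.
- by rewrite Ox0 ?scaler0.
- suff -> : c j = 0 by rewrite scale0r.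
  apply/eqP; apply: contraLR ij => cj; rewrite -leqNgt; apply: imax.
  by rewrite cj -ltnS ltn_ord.
- by case/eqP: ji; apply: val_inj.
Qed.

Definition unbounded (B : nat -> Prop) := forall N, exists2 k, (N <= k)%N & B k.

(** Far hops that act are only known to occur for unboundedly many indices; an increasing sequence
    of such indices reduces this to [dim_le_bound]. *)
Lemma dim_le_bound_sub (A : V -> Prop) d (B : nat -> Prop) (x : nat -> V) (O : nat -> V -> V) :
  dim_le d A -> unbounded B -> (forall i, B i -> A (x i)) -> (forall i, B i -> lin (O i)) ->
  (forall i j, B i -> B j -> (j < i)%N -> O i (x j) = 0) ->
  (forall i, B i -> O i (x i) != 0) -> False.
Proof.
move=> dA uB Ax OL Ox0 Ox.
have nB N : exists k, (N <= k)%N /\ B k by have [k] := uB N; exists k.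
pose f N := sval (constructive_indefinite_description _ (nB N)).
have fN N : (N <= f N)%N by rewrite /f; case: constructive_indefinite_description => k [].
have fB N : B (f N) by rewrite /f; case: constructive_indefinite_description => k [].
pose s := fix s n := if n is m.+1 then f (s m).+1 else f 0%N.
have sB n : B (s n) by case: n => /=.
have sS n : (s n < s n.+1)%N by rewrite /=; apply: fN.
have sI m n : (m < n)%N -> (s m < s n)%N.
  elim: n => // n IHn; rewrite ltnS leq_eqVlt => /orP[/eqP->|/IHn mn]; first exact: sS.
  exact: ltn_trans mn (sS n).
apply: (@dim_le_bound A d (fun i => x (s i)) (fun i => O (s i))) => // [i|i|i j ij|i].
- exact: Ax.
- exact: OL.
- by apply: Ox0 => //; apply: sI.
- exact: Ox.
Qed.

End LinearMaps.

(** * Common eigenvectors of commuting operators *)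

Section Eigenvectors.
Context (F : closedFieldType) (V : lmodType F).

Definition poly_act (f : V -> V) (p : {poly F}) v := \sum_(i < size p) p`_i *: iter i f v.

Lemma poly_actE f (p : {poly F}) v n : (size p <= n)%N ->
  poly_act f p v = \sum_(i < n) p`_i *: iter i f v.
Proof.
move=> pn; rewrite /poly_act (big_ord_widen n (fun i => p`_i *: iter i f v)) // big_mkcond /=.
by apply: eq_bigr => i _; case: ltnP => // ip; rewrite nth_default // scale0r.
Qed.

Lemma poly_actM f z (q : {poly F}) v : lin f ->
  poly_act f (('X - z%:P) * q) v = f (poly_act f q v) - z *: poly_act f q v.
Proof.
move=> fL; pose n := (size q).+1.
have -> : poly_act f q v = \sum_(i < n) q`_i *: iter i f v by apply: poly_actE.
have sn : (size (('X - z%:P) * q)%R <= n.+1)%N.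
  by apply: leq_trans (size_polyMleq _ _) _; rewrite size_XsubC.
rewrite (poly_actE _ _ sn) mulrBl.
under eq_bigr do rewrite coefB coefXM coefCM scalerBl.
rewrite sumrB; congr (_ - _).
  rewrite big_ord_recl /= scale0r add0r (lin_sum fL); apply: eq_bigr => i _.
  by rewrite (linZ fL).
rewrite big_ord_recr /= nth_default ?leqW // mulr0 scale0r addr0 scaler_sumr.
by apply: eq_bigr => i _; rewrite scalerA.
Qed.

Lemma poly_actZ f c (p : {poly F}) v : poly_act f (c *: p) v = c *: poly_act f p v.
Proof.
rewrite (poly_actE _ _ (size_scale_leq c p)) /poly_act scaler_sumr.
by apply: eq_bigr => i _; rewrite coefZ scalerA.
Qed.

(** When the linear factors of a polynomial killing [v] are removed one at a time, the first factor
    whose removal leaves a nonzero vector supplies the eigenvalue. *)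
Lemma eigenvector_exists (f : V -> V) (S : V -> Prop) d v : lin f -> subspace S ->
  (forall u, S u -> S (f u)) -> dim_le d S -> S v -> v != 0 ->
  exists l w, [/\ S w, w != 0 & f w = l *: w].
Proof.
move=> fL SS Sf dS Sv v0.
have [i id|c [[i id ci] c0]] := dS (fun i => iter i f v).
  exact: subspace_iter.
pose p := \poly_(i < d.+1) c i.
have pn0 : p != 0.
  by apply: contraNneq ci => /polyP/(_ i); rewrite coef_poly ltnS id coef0 => ->.
have pv : poly_act f p v = 0.
  rewrite (poly_actE _ _ (size_poly _ _)) -[RHS]c0; apply: eq_bigr => j _.
  by rewrite coef_poly ltn_ord.
have [rs pE] := closed_field_poly_normal p.
have Spa q u : S u -> S (poly_act f q u).
  by move=> Su; apply: subspace_sum => // j _; apply: subspaceZ => //; apply: subspace_iter.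
have rv : poly_act f (\prod_(z <- rs) ('X - z%:P)) v = 0.
  move/eqP: pv; rewrite pE poly_actZ scaler_eq0 lead_coef_eq0 (negPf pn0).
  by move/eqP.
elim: rs {pE} rv => [|z rs IHrs].
  rewrite big_nil /poly_act size_poly1 big_ord_recl big_ord0 /= coef1 scale1r addr0 => v00.
  by rewrite v00 eqxx in v0.
rewrite big_cons poly_actM // => /eqP; rewrite subr_eq0 => /eqP E.
have [/IHrs //|w0] := eqVneq (poly_act f (\prod_(j <- rs) ('X - j%:P)) v) 0.
by exists z, (poly_act f (\prod_(j <- rs) ('X - j%:P)) v); split=> //; apply: Spa.
Qed.

(** Induction on the dimension: an operator that is not scalar on [S] has a proper eigenspace in
    [S], which the other operators preserve. *)
Lemma common_eigenvector I (f : I -> V -> V) d (S : V -> Prop) v :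
  (forall i, lin (f i)) -> subspace S -> (forall i u, S u -> S (f i u)) ->
  (forall i j u, S u -> f i (f j u) = f j (f i u)) -> dim_le d S -> S v -> v != 0 ->
  exists w, [/\ S w, w != 0 & forall i, exists l, f i w = l *: w].
Proof.
move=> fL; elim: d S v => [|d IHd] S v SS Sf fC dS Sv v0.
  have [//|c [[[|i] // _ c0]]] := dS (fun=> v).
  by rewrite big_ord_recl big_ord0 addr0 => /eqP; rewrite scaler_eq0 (negPf c0) (negPf v0).
have [sc|] := classic (forall i, exists l, forall w, S w -> f i w = l *: w).
  by exists v; split=> // i; have [l lP] := sc i; exists l; apply: lP.
move=> /not_all_ex_not[i] nsc.
have [l [w [Sw w0 fw]]] := eigenvector_exists (fL i) SS (Sf i) dS Sv v0.
have [x Sx fx] : exists2 x, S x & f i x != l *: x.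
  apply: NNPP => nx; apply: nsc; exists l => u Su.
  by apply/eqP; apply: contra_notT nx => fu; exists u.
have [|j u [Su fu]|j k u [Su _]|y yS|||u [[Su _] u0 uP]] :=
    IHd (fun u => S u /\ f i u = l *: u) w; last by exists u.
- split; first by split; [case: SS|rewrite scaler0 lin0].
  move=> a u1 u2 [S1 E1] [S2 E2]; split; first by apply: (proj2 SS).
  by rewrite fL E1 E2 scalerDr !scalerA mulrC.
- by split; [apply: Sf|rewrite fC // fu (linZ (fL j))].
- exact: fC.
(* [x] is appended to the [d.+1] given eigenvectors; [f i - l] applied to the dependency isolates
   [x], so its coefficient is 0. *)
- have [k kd|c [[k kd ck] c0]] := dS (fun k => if k == d.+1 then x else y k).
    have [//|/eqP kd1] := altP eqP.
    by case: (yS k) => //; move: kd; rewrite leq_eqVlt (negPf (introN eqP kd1)).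
  move: c0; rewrite big_ord_recr /= eqxx.
  under eq_bigr => j _ do rewrite (ltn_eqF (ltn_ord j)).
  move=> c0; have cd : c d.+1 = 0.
    have := congr1 (fun u => f i u - l *: u) c0.
    rewrite (lin0 (fL i)) scaler0 subr0 (linD (fL i)) (linZ (fL i)) (lin_sum (fL i)).
    have -> : \sum_(j < d.+1) f i (c j *: y j) = l *: \sum_(j < d.+1) c j *: y j.
      rewrite scaler_sumr; apply: eq_bigr => j _.
      have [|_] := yS j; first by rewrite -ltnS.
      by rewrite (linZ (fL i)) => ->; rewrite !scalerA (mulrC l).
    rewrite scalerDr opprD addrACA subrr add0r => /eqP; rewrite scalerA mulrC -scalerA -scalerBr scaler_eq0.
    by rewrite subr_eq0 (negPf fx) orbF => /eqP.
  exists c; split; last by move: c0; rewrite cd scale0r addr0.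
  exists k => //; move: kd; rewrite leq_eqVlt => /orP[/eqP kd|//].
  by rewrite kd cd eqxx in ck.
- by [].
- by [].
Qed.

End Eigenvectors.

(** * Rings of polynomial functions *)

Section Subgroups.
Context (X : zmodType) (Gam : X -> Prop) (GG : add_subgroup Gam).

Lemma subg0 : Gam 0. Proof. by case: GG. Qed.

Lemma subgB x y : Gam x -> Gam y -> Gam (x - y). Proof. by case: GG => _; apply. Qed.

Lemma subgN x : Gam x -> Gam (- x).
Proof. by move=> Gx; rewrite -sub0r; apply: subgB => //; apply: subg0. Qed.

Lemma subgD x y : Gam x -> Gam y -> Gam (x + y).
Proof. by move=> Gx Gy; rewrite -[y]opprK; apply: subgB => //; apply: subgN. Qed.

Lemma subgMn x k : Gam x -> Gam (x *+ k).
Proof.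
move=> Gx; elim: k => [|k IHk]; first by rewrite mulr0n; apply: subg0.
by rewrite mulrS; apply: subgD.
Qed.

Definition torsion_free := forall (x : X) k, x *+ k.+1 = 0 -> x = 0.

Lemma mulrn_inj (x : X) i j : torsion_free -> x != 0 -> x *+ i = x *+ j -> i = j.
Proof.
move=> tf x0 E0; wlog ij : i j E0 / (i < j)%N.
  by have [ij|ji|//] := ltngtP i j => W; [apply: W|apply/esym/W].
case/eqP: x0; apply: (tf x (j - i.+1)%N).
by rewrite -subSn // subSS mulrnBr ?E0 ?subrr // ltnW.
Qed.

Lemma ray_avoid (x c : X) (s : seq X) : torsion_free -> x != 0 ->
  exists N, forall k, (N <= k)%N -> c + x *+ k \notin s.
Proof.
move=> tf x0; elim: s => [|y s [N sN]]; first by exists 0%N.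
have [[k yk]|ny] := classic (exists k, y = c + x *+ k); last first.
  exists N => k /sN; rewrite inE negb_or => ->; rewrite andbT.
  by apply: contra_notN ny => /eqP <-; exists k.
exists (maxn N k.+1) => j; rewrite geq_max inE negb_or => /andP[/sN-> kj]; rewrite andbT yk.
by apply: contraTneq kj => /addrI/(mulrn_inj tf x0) ->; rewrite ltnn.
Qed.

End Subgroups.

Section Ideals.
Context (F : closedFieldType) (P : comAlgType F).

Definition ideal (K : P -> Prop) :=
  [/\ K 0, forall p q, K p -> K q -> K (p + q) & forall r p, K p -> K (r * p)].

Definition root_prod (r : P) (ls : seq F) := \prod_(l <- ls) (r - l%:A).

(* Every element of [P] is algebraic modulo [K]; over an algebraically closed
   field its annihilating polynomial may be taken to be a product of linear factors. *)
Definition algebraic (K : P -> Prop) :=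
  forall r, exists ls, K (root_prod r ls).

Lemma idealN K p : ideal K -> K p -> K (- p).
Proof. by move=> [_ _ KM] Kp; rewrite -mulN1r; apply: KM. Qed.

Lemma idealB K p q : ideal K -> K p -> K q -> K (p - q).
Proof. by move=> IK Kp Kq; case: (IK) => _ KD _; apply: KD => //; apply: idealN. Qed.

Lemma idealMr K p r : ideal K -> K p -> K (p * r).
Proof. by move=> [_ _ KM] Kp; rewrite mulrC; apply: KM. Qed.

Lemma ideal_sum K I (s : seq I) (Q : pred I) (p : I -> P) :
  ideal K -> (forall i, Q i -> K (p i)) -> K (\sum_(i <- s | Q i) p i).
Proof.
move=> [K0 KD _] Kp; elim: s => [|i s IHs]; first by rewrite big_nil.
by rewrite big_cons; case: ifP => // Qi; apply: KD => //; apply: Kp.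
Qed.

Lemma ideal_and K K' : ideal K -> ideal K' -> ideal (fun r => K r /\ K' r).
Proof.
move=> [K0 KD KM] [K0' KD' KM']; split=> // [p q [? ?] [? ?]|r p [? ?]].
  by split; [apply: KD|apply: KD'].
by split; [apply: KM|apply: KM'].
Qed.

Lemma algebraic_and K K' : ideal K -> ideal K' -> algebraic K -> algebraic K' ->
  algebraic (fun r => K r /\ K' r).
Proof.
move=> [_ _ KM] IK' Ka Ka' r; have [ls Kls] := Ka r; have [ls' Kls'] := Ka' r.
by exists (ls' ++ ls); rewrite /root_prod big_cat /=; split; [apply: KM|apply: idealMr].
Qed.

Lemma algebraic_sub (K K' : P -> Prop) : (forall r, K r -> K' r) -> algebraic K -> algebraic K'.
Proof. by move=> KK' Ka r; have [ls Kls] := Ka r; exists ls; apply: KK'. Qed.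

End Ideals.

(* Polynomial functions on the additive group [X], with evaluations [ev] at the
   points of [X], translations [tau] and the reflection [rho]. *)
Record polyfun (F : closedFieldType) (X : zmodType) := Polyfun {
  pf_alg :> comAlgType F;
  ev : X -> {rmorphism pf_alg -> F};
  tau : X -> {rmorphism pf_alg -> pf_alg};
  rho : {rmorphism pf_alg -> pf_alg};
  evZ : forall a c p, ev a (c *: p) = c * ev a p;
  tauZ : forall a c p, tau a (c *: p) = c *: tau a p;
  rhoZ : forall c p, rho (c *: p) = c *: rho p;
  ev_tau : forall a b p, ev a (tau b p) = ev (a + b) p;
  tau0 : forall p, tau 0 p = p;
  tauD : forall a b p, tau a (tau b p) = tau (a + b) p;
  ev_rho : forall a p, ev a (rho p) = ev (- a) p;
  rho_tau : forall a p, rho (tau a p) = tau (- a) (rho p);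
  rhoK : forall p, rho (rho p) = p;
  ev_sep : forall a b, a <> b -> exists r, ev a r <> ev b r;
  ideal_zeros : forall K, ideal K -> algebraic K ->
    exists s : seq X, forall a, (forall r, K r -> ev a r = 0) -> a \in s;
  nullstellensatz : forall K, ideal K -> algebraic K ->
    (forall a, exists2 r, K r & ev a r != 0) -> K 1;
  tau_surj : forall b, b != 0 -> forall q, exists p, tau b p - p = q
}.

(** * Localization at a site and approximate idempotents *)

Section Local.
Context (F : closedFieldType) (X : zmodType) (A : polyfun F X).
Implicit Types (K : A -> Prop) (a b s d : X) (r p q e u : A).

Lemma evC a (c : F) : ev A a c%:A = c.
Proof. by rewrite evZ rmorph1 mulr1. Qed.

Lemma tauC a (c : F) : tau A a c%:A = c%:A.
Proof. by rewrite tauZ rmorph1. Qed.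

Lemma algebraic_witness (K : A -> Prop) r (n : nat) (c : nat -> F) i :
  ideal K -> (i < n)%N -> c i != 0 -> K (\sum_(j < n) c j *: r ^+ j) ->
  exists ls, K (root_prod r ls).
Proof.
move=> [_ _ KM] id ci Kr.
pose g := \poly_(j < n) c j.
have gn0 : g != 0.
  by apply: contraNneq ci => /polyP/(_ i); rewrite coef_poly id coef0 => ->.
have [ls gE] := closed_field_poly_normal g.
exists ls.
have -> : root_prod r ls = (lead_coef g)^-1%:A * \sum_(j < n) c j *: r ^+ j.
  have -> : \sum_(j < n) c j *: r ^+ j = horner_alg r g.
    rewrite /g poly_def linear_sum; apply: eq_bigr => j _.
    by rewrite linearZ /= rmorphXn /= horner_algX mulr_algl.
  rewrite [in horner_alg _ g]gE linearZ /= !mulr_algl scalerK ?lead_coef_eq0 //.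
  rewrite /root_prod rmorph_prod; apply: eq_bigr => l _.
  by rewrite rmorphB /= horner_algX horner_algC.
exact: KM.
Qed.

(** For an ideal [K], this is the kernel of the map from [A] to the localization of [A / K] at the
    point [a]. *)
Definition loc K a r := exists2 u, ev A a u != 0 & K (u * r).

Lemma loc_ideal K a : ideal K -> ideal (loc K a).
Proof.
move=> [K0 KD KM]; split=> [|p q [u u0 Ku] [w w0 Kw]|r p [u u0 Ku]].
- by exists 1; rewrite ?mulr0 // rmorph1 oner_eq0.
- exists (u * w); first by rewrite rmorphM mulf_neq0.
  by rewrite mulrDr -mulrA [u * (w * p)]mulrCA -mulrA; apply: KD; apply: KM.
- by exists u => //; rewrite mulrCA; apply: KM.
Qed.

Lemma loc_mono (K K' : A -> Prop) a r : (forall p, K p -> K' p) -> loc K a r -> loc K' a r.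
Proof. by move=> KK' [u u0 Ku]; exists u => //; apply: KK'. Qed.

Lemma loc_full K a u r : ideal K -> K u -> ev A a u != 0 -> loc K a r.
Proof. by move=> IK Ku u0; exists u => //; apply: idealMr. Qed.

(** The factors [r - l] with [l] nonzero are invertible near [a], so an annihilating product reduces
    there to a power of [r]. *)
Lemma loc_pow K a r : ideal K -> algebraic K -> ev A a r = 0 -> exists m, loc K a (r ^+ m).
Proof.
move=> IK Ka r0; have [ls] := Ka r.
have [m [u [u0 ->]]] : exists m u, ev A a u != 0 /\ root_prod r ls = u * r ^+ m.
  elim: ls => [|l ls [m [u [u0]]]].
    by exists 0%N, 1; rewrite /root_prod big_nil mulr1 rmorph1 oner_eq0.
  rewrite /root_prod big_cons => ->; have [->|l0] := eqVneq l 0.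
    by exists m.+1, u; rewrite scale0r subr0 exprS mulrCA.
  exists m, ((r - l%:A) * u); rewrite mulrA; split=> //.
  by rewrite rmorphM mulf_neq0 // rmorphB r0 /= evC sub0r oppr_eq0.
by exists m, u.
Qed.

(** The multipliers [u] with [u * r] in [K] form an ideal without common zeros. *)
Lemma local_global K r : ideal K -> algebraic K -> (forall s, loc K s r) -> K r.
Proof.
move=> IK Ka Kr; case: (IK) => K0 KD KM.
rewrite -[r]mul1r; apply: (@nullstellensatz F X A (fun u => K (u * r))).
- split=> [|p q Kp Kq|u p Kp]; rewrite ?mul0r //; first by rewrite mulrDl; apply: KD.
  by rewrite -mulrA; apply: KM.
- by apply: algebraic_sub Ka => u Ku; apply: idealMr.
- by move=> a; have [u] := Kr a; exists u.
Qed.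

(* [e] is congruent to the indicator function of [a] modulo [K]. *)
Definition bump K a e := loc K a (1 - e) /\ forall s, s != a -> loc K s e.

(** Take [h] equal to 1 at [a] and locally zero at the other sites. Then [1 - (1 - h) ^+ m] is still
    divisible by [h], and its complement [(1 - h) ^+ m] dies near [a] for large [m]. *)
Lemma bump_exists K a : ideal K -> algebraic K -> exists e, bump K a e.
Proof.
move=> IK Ka; have [zs zsP] := ideal_zeros IK Ka.
have [g g0 gP] : exists2 g, ev A a g != 0 & forall s, s \in zs -> s != a -> loc K s g.
  elim: zs {zsP} => [|c zs [g g0 gP]]; first by exists 1; rewrite // rmorph1 oner_eq0.
  have [->|ca] := eqVneq c a.
    by exists g => // s; rewrite inE => /orP[/eqP->|/gP//]; rewrite eqxx.
  have [r /eqP rP] := ev_sep A (nesym (elimN eqP ca)).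
  have rc0 : ev A c (r - (ev A c r)%:A) = 0 by rewrite rmorphB /= evC subrr.
  have [m [u u0 Ku]] := loc_pow IK Ka rc0.
  (* Vanishing at [c] is not enough; the exponent makes the factor zero in the local ring at [c]. *)
  exists (g * (r - (ev A c r)%:A) ^+ m).
    by rewrite rmorphM rmorphXn mulf_neq0 // expf_neq0 // rmorphB /= evC subr_eq0.
  move=> s; rewrite inE => /orP[/eqP-> _|szs sa].
    by case: (loc_ideal c IK) => _ _; apply; exists u.
  exact: idealMr (loc_ideal s IK) (gP s szs sa).
have {}gP s : s != a -> loc K s g.
  move=> sa; have [/gP/(_ sa)//|nszs] := boolP (s \in zs).
  have [u Ku u0] : exists2 u, K u & ev A s u != 0.
    apply: NNPP => nu; case/negP: nszs; apply: zsP => r Kr.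
    by apply/eqP; apply: contra_notT nu => r0; exists r.
  exact: loc_full Ku u0.
pose h := (ev A a g)^-1%:A * g.
have h1 : ev A a (1 - h) = 0.
  by rewrite rmorphB rmorphM /= evC rmorph1 mulVf // subrr.
have [m hm] := loc_pow IK Ka h1.
exists (1 - (1 - h) ^+ m); split=> [|s sa]; first by rewrite opprB addrC subrK.
have [y ->] : exists y, 1 - (1 - h) ^+ m = y * g.
  exists ((\sum_(i < m) (1 - h) ^+ i) * (ev A a g)^-1%:A).
  rewrite -mulrA -/h; have := subrXX 1 (1 - h) m; rewrite expr1n => ->.
  rewrite opprB addrC subrK mulrC; congr (_ * _).
  by apply: eq_bigr => i _; rewrite expr1n mul1r.
by case: (loc_ideal s IK) => _ _; apply; apply: gP.
Qed.

Lemma bump_mono (K K' : A -> Prop) a e : (forall p, K p -> K' p) -> bump K a e -> bump K' a e.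
Proof.
move=> KK' [e1 e0]; split; first exact: loc_mono e1.
by move=> s sa; apply: loc_mono KK' (e0 s sa).
Qed.

Lemma bump_mul K a e e' : ideal K -> bump K a e -> bump K a e' -> bump K a (e * e').
Proof.
move=> IK [e1 e0] [e1' e0']; split=> [|s sa]; last exact: idealMr (loc_ideal s IK) (e0 s sa).
have -> : 1 - e * e' = (1 - e) + e * (1 - e') by rewrite mulrBr mulr1 addrA subrK.
by case: (loc_ideal a IK) => _ KD KM; apply: KD => //; apply: KM.
Qed.

Lemma bump_diff K a e e' : ideal K -> algebraic K -> bump K a e -> bump K a e' -> K (e - e').
Proof.
move=> IK Ka [e1 e0] [e1' e0']; apply: local_global => // s.
have [->|sa] := eqVneq s a; last by apply: idealB (loc_ideal s IK) (e0 s sa) (e0' s sa).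
have -> : e - e' = (1 - e') - (1 - e) by rewrite opprB [RHS]addrC addrA subrK.
exact: idealB (loc_ideal a IK) e1' e1.
Qed.

Lemma bump_orth K a b e e' : ideal K -> algebraic K -> a != b ->
  bump K a e -> bump K b e' -> K (e * e').
Proof.
move=> IK Ka ab [_ e0] [_ e0']; apply: local_global => // s.
have [->|sa] := eqVneq s a; first by case: (loc_ideal a IK) => _ _; apply; apply: e0'.
exact: idealMr (loc_ideal s IK) (e0 s sa).
Qed.

Definition shift_ideal d K := fun r => K (tau A d r).

Lemma shift_idealP d K : ideal K -> ideal (shift_ideal d K).
Proof.
move=> [K0 KD KM]; split=> [|p q Kp Kq|r p Kp]; rewrite /shift_ideal ?rmorph0 //.
  by rewrite rmorphD; apply: KD.
by rewrite rmorphM; apply: KM.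
Qed.

Lemma shift_ideal_alg d K : algebraic K -> algebraic (shift_ideal d K).
Proof.
move=> Ka r; have [ls Kls] := Ka (tau A d r); exists ls.
rewrite /shift_ideal /root_prod rmorph_prod.
by under eq_bigr do rewrite rmorphB /= tauC.
Qed.

(** A bracket translates one of its two symbols, so bumps are taken modulo a shifted ideal as well
    and stay bumps after the translation. *)
Lemma bump_tau d K a e : bump (shift_ideal d K) a e -> bump K (a - d) (tau A d e).
Proof.
have locP s r : loc (shift_ideal d K) (s + d) r -> loc K s (tau A d r).
  by move=> [u u0 Ku]; exists (tau A d u); rewrite ?ev_tau // -rmorphM.
move=> [e1 e0]; split=> [|s sa]; first by rewrite -(rmorph1 (tau A d)) -rmorphB; apply: locP; rewrite subrK.
by apply/locP/e0; apply: contraNneq sa => <-; rewrite addrK.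
Qed.

(** A partition of unity modulo [K]. Outside [zs] the ideal [K] contains a local unit, so there is
    nothing to check. *)
Lemma bump_sum K (zs : seq X) (e : X -> A) : ideal K -> algebraic K -> uniq zs ->
  (forall a, (forall r, K r -> ev A a r = 0) -> a \in zs) ->
  (forall a, bump K a (e a)) -> K (1 - \sum_(a <- zs) e a).
Proof.
move=> IK Ka zsU zsP eP; apply: local_global => // s.
have [szs|nszs] := boolP (s \in zs).
  rewrite (bigD1_seq s) //= opprD addrA.
  apply: idealB (loc_ideal s IK) (proj1 (eP s)) _.
  by apply: ideal_sum (loc_ideal s IK) _ => a sa; apply: (proj2 (eP a)); rewrite eq_sym.
have [u Ku u0] : exists2 u, K u & ev A s u != 0.
  apply: NNPP => nu; case/negP: nszs; apply: zsP => r Kr.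
  by apply/eqP; apply: contra_notT nu => r0; exists r.
exact: loc_full Ku u0.
Qed.

End Local.

(** * Modules as systems of hopping operators *)

Section Systems.
Context (F : closedFieldType) (X : zmodType) (A : polyfun F X) (V : lmodType F).

(* The degree-[b] operators [T b p] stand for t^b p(D).  They are only required to make
   sense when [p] vanishes at 0 ([sg = false]) or at [-b] ([sg = true]); the second
   case arises from the first by the duality [dual_op] below. *)
Definition allowed (sg : bool) (b : X) (p : A) := ev A (if sg then - b else 0) p = 0.

(** The unspecified scalar [l] in [T_br0] absorbs the central element; it makes the plain and the
    extended algebra instances of one structure. *)
Record weyl_module (sg : bool) (Gam : X -> Prop) (Vg : X -> V -> Prop)
    (T : X -> A -> V -> V) : Prop := WeylModule {
  tors_free : torsion_free X;
  Gam_grp : add_subgroup Gam;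
  T_lin : forall b p, lin (T b p);
  T_linp : forall b (c : F) p q v, Gam b -> allowed sg b p -> allowed sg b q ->
    T b (c *: p + q) v = c *: T b p v + T b q v;
  T_br : forall a b p q v, Gam a -> Gam b -> allowed sg a p -> allowed sg b q -> a + b != 0 ->
    T a p (T b q v) - T b q (T a p v) = T (a + b) (tau A b p * q - tau A a q * p) v;
  T_br0 : forall a p q, Gam a -> a != 0 -> allowed sg a p -> allowed sg (- a) q ->
    exists l : F, forall v, T a p (T (- a) q v) - T (- a) q (T a p v)
      = T 0 (tau A (- a) p * q - tau A a q * p) v + l *: v;
  Vg_sub : forall g, subspace (Vg g);
  Vg_dim : forall g, exists d, dim_le d (Vg g);
  Vg_span : forall v, exists s : seq (X * V),
    (forall x, x \in s -> Vg x.1 x.2) /\ v = \sum_(x <- s) x.2;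
  T_deg : forall b p g v, Gam b -> allowed sg b p -> Vg g v -> Vg (b + g) (T b p v);
  T_irr : forall S : V -> Prop, subspace S ->
    (forall b p v, Gam b -> allowed sg b p -> S v -> S (T b p v)) ->
    (exists v, S v /\ v != 0) -> forall v, S v;
  V_nonzero : exists v : V, v != 0
}.

End Systems.

(* A hop system: the operator [E a b f] stands for f(a) times the matrix unit moving a
   particle from the site [a] to the site [b], [f] being taken as a germ at [a]. *)
Definition hop (F : closedFieldType) (X : zmodType) (A : polyfun F X) (sg : bool)
    (Gam : X -> Prop) (a b : X) (f : A) :=
  [/\ a != b, Gam (b - a) & (if sg then b == 0 else a == 0) -> ev A a f = 0].

Section Sites.
Context (F : closedFieldType) (X : zmodType) (A : polyfun F X) (sg : bool) (Gam : X -> Prop).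
Context (GG : add_subgroup Gam).
Implicit Types (a b c d t : X) (f h : A).

Notation hop := (@hop F X A sg Gam).

Lemma hop_neq0 a b f : hop a b f -> b - a != 0.
Proof. by case=> ab _ _; rewrite subr_eq0 eq_sym. Qed.

Lemma hop_Gam a b f : hop a b f -> Gam (b - a). Proof. by case. Qed.

Lemma hop_site a b f : a != b -> Gam (b - a) -> a != 0 -> b != 0 -> hop a b f.
Proof. by move=> ab Gab /negPf a0 /negPf b0; split=> //; rewrite a0 b0; case: (sg). Qed.

Lemma hop_linp a b (c : F) f h : hop a b f -> hop a b h -> hop a b (c *: f + h).
Proof.
move=> [ab Gab fa] [_ _ ha]; split=> // s0.
by rewrite rmorphD /= evZ fa // ha // mulr0 addr0.
Qed.

Lemma hop_comp c d b f h : hop c d h -> hop d b f -> c != b -> hop c b (tau A (d - c) f * h).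
Proof.
move=> [cd Gcd hc] [db Gdb fd] cb; split=> //.
  have -> : b - c = (b - d) + (d - c) by rewrite addrA subrK.
  exact: subgD.
rewrite rmorphM /= ev_tau addrC subrK.
by move: hc fd; case: (sg) => hc fd s0; [rewrite fd // mul0r|rewrite hc // mulr0].
Qed.

(** The vanishing condition concerns only the target or only the source, according to [sg]. The
    whole germ goes into the half touching that end, and the other half is 1. *)
Lemma hop_split a b f t : hop a b f -> t != 0 -> t != a -> t != b -> Gam (t - a) ->
  exists f1 f2, [/\ hop t b f1, hop a t f2 & tau A (t - a) f1 * f2 = f].
Proof.
move=> [ab Gab fa] t0 ta tb Gta.
have Gbt : Gam (b - t).
  have -> : b - t = (b - a) - (t - a) by rewrite opprB addrA subrK.
  exact: subgB.
case: sg fa => fa.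
  exists (tau A (a - t) f), 1; rewrite mulr1 tauD addrA subrK subrr tau0; split=> //.
    by split=> // b0; rewrite ev_tau [t + _]addrC subrK fa.
  by split; rewrite 1?eq_sym // => /eqP t00; rewrite t00 eqxx in t0.
exists 1, f; rewrite rmorph1 mul1r; split=> //.
  by split=> // /eqP t00; rewrite t00 eqxx in t0.
by split=> //; rewrite eq_sym.
Qed.

End Sites.

(** In [E_comm] the case [(c, d) = (b, a)] is excluded: it would yield diagonal matrix units of
    degree 0, for which there are no bumps. [E_nilp] limits how far a hop depends on more than the
    value of its germ. *)
Record hop_system (F : closedFieldType) (X : zmodType) (A : polyfun F X) (V : lmodType F)
    (sg : bool) (Gam : X -> Prop) (Vg : X -> V -> Prop) (E : X -> X -> A -> V -> V) : Prop :=
    HopSystem {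
  hs_tors_free : torsion_free X;
  hs_grp : add_subgroup Gam;
  hs_dim : forall g, exists d, dim_le d (Vg g);
  hs_span : forall v, exists s : seq (X * V),
    (forall x, x \in s -> Vg x.1 x.2) /\ v = \sum_(x <- s) x.2;
  hs_nonzero : exists v : V, v != 0;
  E_lin : forall a b f, hop sg Gam a b f -> lin (E a b f);
  E_linp : forall a b (c : F) f g v, hop sg Gam a b f -> hop sg Gam a b g ->
    E a b (c *: f + g) v = c *: E a b f v + E a b g v;
  E_deg : forall a b f g v, hop sg Gam a b f -> Vg g v -> Vg (b - a + g) (E a b f v);
  E_comm : forall a b c d f g v, hop sg Gam a b f -> hop sg Gam c d g -> (c, d) != (b, a) ->
    E a b f (E c d g v) - E c d g (E a b f v)
    = (if d == a then E c b (tau A (d - c) f * g) v else 0)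
      - (if b == c then E a d (tau A (b - a) g * f) v else 0);
  E_fin : forall b g, Gam b -> b != 0 -> exists s : seq X,
    forall a f v, hop sg Gam a (a + b) f -> Vg g v -> a \notin s -> E a (a + b) f v = 0;
  E_nilp : forall a b f g, a != b -> Gam (b - a) -> ev A a f = 0 ->
    exists2 m, (0 < m)%N & forall v, Vg g v -> E a b (f ^+ m) v = 0;
  E_irr : forall S : V -> Prop, subspace S ->
    (forall a b f v, hop sg Gam a b f -> S v -> S (E a b f v)) ->
    (exists v, S v /\ v != 0) -> forall v, S v
}.

(** * Construction of the hop operators *)

Section Hops.
Context (F : closedFieldType) (X : zmodType) (A : polyfun F X) (V : lmodType F).
Context (sg : bool) (Gam : X -> Prop) (Vg : X -> V -> Prop) (T : X -> A -> V -> V).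
Context (WM : weyl_module sg Gam Vg T).
Implicit Types (a b c d s t g : X) (p q r e f h : A) (u v w : V).

Notation ok := (allowed (A := A) sg).
Notation evA := (ev A).
Notation tauA := (tau A).

Let T_L := T_lin WM.

Let GG := Gam_grp WM.

Lemma ok_lin b (c : F) p q : ok b p -> ok b q -> ok b (c *: p + q).
Proof. by rewrite /allowed rmorphD /= evZ => -> ->; rewrite mulr0 addr0. Qed.

Lemma ok0 b : ok b 0. Proof. by rewrite /allowed rmorph0. Qed.

Lemma okM b r p : ok b p -> ok b (r * p).
Proof. by rewrite /allowed rmorphM => ->; rewrite mulr0. Qed.

Lemma okMr b r p : ok b p -> ok b (p * r).
Proof. by rewrite mulrC; apply: okM. Qed.

Lemma okD b p q : ok b p -> ok b q -> ok b (p + q).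
Proof. by move=> okp okq; rewrite -[p]scale1r; apply: ok_lin. Qed.

Lemma okN b p : ok b p -> ok b (- p).
Proof. by move=> okp; rewrite -mulN1r; apply: okM. Qed.

Lemma okB b p q : ok b p -> ok b q -> ok b (p - q).
Proof. by move=> okp okq; apply: okD => //; apply: okN. Qed.

Section LinearP.
Context (b : X) (Gb : Gam b).

Lemma T_addp p q v : ok b p -> ok b q -> T b (p + q) v = T b p v + T b q v.
Proof. by move=> okp okq; rewrite -[p in LHS]scale1r (T_linp WM) // scale1r. Qed.

Lemma T_p0 v : T b 0 v = 0.
Proof.
have := T_addp v (ok0 b) (ok0 b); rewrite addr0 => /eqP.
by rewrite -subr_eq0 opprD addrA subrr sub0r oppr_eq0 => /eqP.
Qed.

Lemma T_scalep (c : F) p v : ok b p -> T b (c *: p) v = c *: T b p v.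
Proof.
by move=> okp; rewrite -[c *: p]addr0 (T_linp WM) //; [rewrite T_p0 addr0|apply: ok0].
Qed.

Lemma T_oppp p v : ok b p -> T b (- p) v = - T b p v.
Proof. by move=> okp; have -> : - p = (-1 : F) *: p by [rewrite scaleN1r]; rewrite T_scalep // scaleN1r. Qed.

Lemma T_subp p q v : ok b p -> ok b q -> T b (p - q) v = T b p v - T b q v.
Proof. by move=> okp okq; rewrite T_addp ?T_oppp //; apply: okN. Qed.

Lemma T_sump I (rs : seq I) (p : I -> A) v : (forall i, ok b (p i)) ->
  T b (\sum_(i <- rs) p i) v = \sum_(i <- rs) T b (p i) v.
Proof.
move=> okp; elim: rs => [|i rs IHrs]; first by rewrite !big_nil T_p0.
rewrite !big_cons T_addp ?IHrs //.
by elim: rs {IHrs} => [|j rs IHrs]; rewrite ?big_nil ?big_cons; [apply: ok0|apply: okD].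
Qed.

End LinearP.

Definition killer b (L : seq X) q := ok b q /\ forall g, g \in L -> forall v, Vg g v -> T b q v = 0.

Lemma T_adjoint b p q v : Gam b -> b != 0 -> ok b q -> ok 0 p ->
  T 0 p (T b q v) - T b q (T 0 p v) = T b ((tauA b p - p) * q) v.
Proof.
move=> Gb b0 okq okp; rewrite (T_br WM) ?add0r //; last exact: (subg0 GG).
by rewrite tau0 mulrBl [q * p]mulrC.
Qed.

Lemma ok0_shift p : ok 0 (p - (evA 0 p)%:A).
Proof. by rewrite /allowed oppr0 if_same rmorphB /= evC subrr. Qed.

(* [T 0 p] preserves each [Vg g], so the commutator with [T 0 p] shows that the
   killers of degree [b] are stable under multiplication by [tau b p - p], which is
   an arbitrary polynomial. *)
Lemma killer_ideal b L : Gam b -> b != 0 -> ideal (killer b L).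
Proof.
move=> Gb b0; split=> [|p q [okp Kp] [okq Kq]|r q [okq Kq]].
- by split=> [|g _ v _]; [apply: ok0|rewrite T_p0].
- split=> [|g gL v vg]; first exact: okD.
  by rewrite T_addp // (Kp g) // (Kq g) // addr0.
split=> [|g gL v vg]; first exact: okM.
have [p0 pr] := tau_surj b0 r.
pose p := p0 - (evA 0 p0)%:A.
have {}pr : tauA b p - p = r by rewrite /p rmorphB /= tauC opprB addrA subrK.
have okp := ok0_shift p0; rewrite -/p in okp.
rewrite -pr -T_adjoint // (Kq g) // (lin0 (T_L 0 p)) (Kq g) ?subrr //.
by rewrite -[g]add0r; apply: (T_deg WM) => //; apply: (subg0 GG).
Qed.

(** For a single degree, [T b] gives linear maps between two fixed finite-dimensional pieces, so
    sufficiently many powers of [r] act dependently. *)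
Lemma killer_algebraic b L : Gam b -> b != 0 -> algebraic (killer b L).
Proof.
move=> Gb b0; elim: L => [|g L IHL].
  move=> r; exists [:: evA (if sg then - b else 0) r]; split=> [|g]; last by rewrite in_nil.
  by rewrite /allowed /root_prod big_seq1 rmorphB /= evC subrr.
suff Kg : algebraic (killer b [:: g]).
  apply: algebraic_sub (algebraic_and (killer_ideal L Gb b0) (killer_ideal [:: g] Gb b0) IHL Kg).
  move=> q [[okq KL] [_ Kg']]; split=> // h; rewrite inE => /orP[/eqP->|/KL//].
  by apply: Kg'; rewrite mem_head.
move=> r.
have [d dg] := Vg_dim WM g; have [n [x [xg xspan]]] := dim_le_spanning dg.
have [d' dg'] := Vg_dim WM (b + g); have [n' [x' [_ x'span]]] := dim_le_spanning dg'.
(* [q] vanishes where [allowed] demands it, so every [r ^+ i * q] is a legitimate symbol; this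
   factor becomes the extra root in the final list. *)
pose q := r - (evA (if sg then - b else 0) r)%:A.
have okq i : ok b (r ^+ i * q) by apply: okM; rewrite /allowed rmorphB /= evC subrr.
have /fin_all_exists[M MP] (ik : 'I_(n * n').+1 * 'I_n) :
    exists c : nat -> F, T b (r ^+ ik.1 * q) (x ik.2) = \sum_(k < n') c k *: x' k.
  by apply: x'span; apply: (T_deg WM) => //; apply: xg.
pose N := n * n'.
pose W := \matrix_(i < N.+1) mxvec (\matrix_(k < n, k' < n') M (i, k) k').
have : kermx W != 0.
  by rewrite -mxrank_eq0 mxrank_ker -lt0n subn_gt0 ltnS; exact: rank_leq_col.
case/rowV0Pn => y /sub_kermxP yW y0.
have [j yj] : exists j, y 0 j != 0.
  by apply/existsP; apply: contraNT y0 => /existsPn y0; apply/eqP/rowP => j;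
    rewrite mxE; apply/eqP; have := y0 j; rewrite negbK.
pose c i : F := if insub i is Some j then y 0 j else 0.
have cE (i : 'I_N.+1) : c i = y 0 i by rewrite /c valK.
have [ls Kls] : exists ls, killer b [:: g] (root_prod r ls * q).
  have KI := killer_ideal [:: g] Gb b0.
  apply: (@algebraic_witness F X A (fun h => killer b [:: g] (h * q)) r N.+1 c j) => //.
  - case: KI => K0 KD KM; split=> [|h h' Kh Kh'|h h' Kh]; rewrite ?mul0r //.
      by rewrite mulrDl; apply: KD.
    by rewrite -mulrA; apply: KM.
  - by rewrite cE.
  rewrite mulr_suml; split=> [|g']; first by apply: big_ind => [|p p'|i _]; [apply: ok0|apply: okD|
    rewrite -mulr_algl -mulrA; apply: okM].
  rewrite inE => /eqP-> v /xspan[cv ->].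
  rewrite (lin_sum (T_L b _)); apply: big1 => k _; rewrite (linZ (T_L b _)).
  rewrite T_sump // => [|i]; last by rewrite -scalerAl -mulr_algl; apply: okM.
  suff -> : \sum_(i < N.+1) T b (c i *: r ^+ i * q) (x k) = 0 by rewrite scaler0.
  under eq_bigr => i _ do rewrite -scalerAl T_scalep // cE (MP (i, k)) scaler_sumr.
  rewrite exchange_big /=; apply: big1 => k' _.
  under eq_bigr do rewrite scalerA.
  rewrite -scaler_suml; have /rowP/(_ (mxvec_index k k')) := yW; rewrite !mxE => yk.
  suff -> : \sum_(i < N.+1) y 0 i * M (i, k) k' = 0 by rewrite scale0r.
  by rewrite -[RHS]yk; apply: eq_bigr => i _; rewrite mxE mxvecE mxE.
exists (evA (if sg then - b else 0) r :: ls).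
by rewrite /root_prod big_cons mulrC.
Qed.


Definition hsum (L : seq X) v := exists s : seq (X * V),
  (forall x, x \in s -> x.1 \in L /\ Vg x.1 x.2) /\ v = \sum_(x <- s) x.2.

Lemma hsum_exists v : exists L, hsum L v.
Proof.
have [s [sV ->]] := Vg_span WM v; exists (map fst s), s; split=> // x xs.
by split; [apply: map_f|apply: sV].
Qed.

Lemma hsum_sub L L' v : {subset L <= L'} -> hsum L v -> hsum L' v.
Proof.
by move=> LL' [s [sP ->]]; exists s; split=> // x /sP[xL Vx]; split=> //; apply: LL'.
Qed.

Lemma hsum_Vg g v : Vg g v -> hsum [:: g] v.
Proof.
move=> vg; exists [:: (g, v)]; rewrite big_seq1; split=> // x.
by rewrite inE => /eqP->; rewrite mem_head.
Qed.

Lemma killer_hsum b L q v : killer b L q -> hsum L v -> T b q v = 0.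
Proof.
move=> [_ Kq] [s [sP ->]]; rewrite (lin_sum (T_L b q)) big_seq big1 // => x /sP[xL Vx].
exact: Kq xL _ Vx.
Qed.

Definition good_bump b a v e := exists2 L, hsum L v & bump (killer b L) a e.

(** A bump serves only finitely many degrees, so it is chosen for each [v]; by [T_bump_indep] the
    value does not depend on the choice. *)
Definition hop_op a b f v := T (b - a) (f * epsilon (inhabits 0) (good_bump (b - a) a v)) v.

Notation E := hop_op.

Notation hop := (@hop F X A sg Gam).

(** At the point tested by [allowed], [f] vanishes if that point is [a]; otherwise the bump does,
    because all killers vanish there. *)
Lemma hop_bump_ok a b f L e : hop a b f -> bump (killer (b - a) L) a e -> ok (b - a) (f * e).
Proof.
move=> [ab Gab fa] [_ e0].
set z := if sg then - (b - a) else 0.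
have [za|za] := eqVneq z a.
  rewrite /allowed rmorphM /= -/z za fa ?mul0r //.
  move: za; rewrite /z; case: (sg) => [/eqP|/esym/eqP//].
  by rewrite opprB subr_eq addrC -subr_eq subrr eq_sym.
have [u u0 [Ku _]] := e0 _ za.
move: Ku; rewrite /allowed rmorphM -/z => /eqP; rewrite mulf_eq0 (negPf u0) /= => /eqP ez.
by rewrite rmorphM /= ez mulr0.
Qed.

Lemma bump_refine b a (J : A -> Prop) L : Gam b -> b != 0 -> ideal J -> algebraic J ->
  exists e, bump J a e /\ bump (killer b L) a e.
Proof.
move=> Gb b0 IJ Ja; have KI := killer_ideal L Gb b0; have Ka := killer_algebraic L Gb b0.
have [e eP] := bump_exists a (ideal_and IJ KI) (algebraic_and IJ KI Ja Ka).
by exists e; split; apply: bump_mono eP => p [].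
Qed.

(** Two bumps for different degree lists are compared through a third one that is a bump for
    both. *)
Lemma T_bump_indep a b f v e e' : hop a b f ->
  good_bump (b - a) a v e -> good_bump (b - a) a v e' ->
  T (b - a) (f * e) v = T (b - a) (f * e') v.
Proof.
move=> hf [L vL eL] [L' vL' eL'].
have [Gb b0] := (hop_Gam hf, hop_neq0 hf).
have KI K := killer_ideal K Gb b0; have Ka K := killer_algebraic K Gb b0.
have [e2 [e2L e2L']] := bump_refine a L' Gb b0 (KI L) (Ka L).
suff main K e0 : hsum K v -> bump (killer (b - a) K) a e0 -> bump (killer (b - a) K) a e2 ->
    T (b - a) (f * e0) v = T (b - a) (f * e2) v by rewrite (main L) // (main L').
move=> vK e0P e2P; apply/eqP; rewrite -subr_eq0 -T_subp //;
  try by apply: hop_bump_ok hf _; eassumption.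
rewrite -mulrBr; apply/eqP; apply: killer_hsum vK.
by case: (KI K) => _ _; apply; apply: bump_diff (KI K) (Ka K) e0P e2P.
Qed.

Lemma E_bump a b f v e : hop a b f -> good_bump (b - a) a v e -> E a b f v = T (b - a) (f * e) v.
Proof.
move=> hf eP; apply: T_bump_indep => //.
by apply: (epsilon_spec (inhabits 0) (good_bump (b - a) a v)); exists e.
Qed.

(** A single symbol computes the hop on all vectors with degrees in [L], and is moreover a bump
    modulo a further ideal [J]. *)
Lemma bump_for a b f (J : A -> Prop) L : hop a b f -> ideal J -> algebraic J ->
  exists2 e, bump J a e & forall v, hsum L v ->
    E a b f v = T (b - a) (f * e) v /\ ok (b - a) (f * e).
Proof.
move=> hf IJ Ja; have [e [eJ eK]] := bump_refine a L (hop_Gam hf) (hop_neq0 hf) IJ Ja.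
exists e => // v vL; split; last exact: hop_bump_ok hf eK.
by apply: E_bump => //; exists L.
Qed.

Lemma ideal_true : ideal (fun _ : A => True). Proof. by []. Qed.
Lemma algebraic_true : algebraic (fun _ : A => True). Proof. by move=> r; exists [::]. Qed.

Lemma hopE_lin a b f : hop a b f -> lin (E a b f).
Proof.
move=> hf c u v.
have [L1 uL] := hsum_exists u; have [L2 vL] := hsum_exists v.
have [L3 wL] := hsum_exists (c *: u + v).
have [e _ eP] := bump_for (L1 ++ L2 ++ L3) hf ideal_true algebraic_true.
have sub L L' : {subset L <= L'} -> forall w, hsum L w -> E a b f w = T (b - a) (f * e) w
   -> E a b f w = T (b - a) (f * e) w by [].
have Eu : E a b f u = T (b - a) (f * e) u.
  by apply: (proj1 (eP _ _)); apply: hsum_sub uL => x xL; rewrite !mem_cat xL.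
have Ev : E a b f v = T (b - a) (f * e) v.
  by apply: (proj1 (eP _ _)); apply: hsum_sub vL => x xL; rewrite !mem_cat xL orbT.
have Ew : E a b f (c *: u + v) = T (b - a) (f * e) (c *: u + v).
  by apply: (proj1 (eP _ _)); apply: hsum_sub wL => x xL; rewrite !mem_cat xL !orbT.
by rewrite Eu Ev Ew (T_L _ _).
Qed.

Lemma hopE_linp a b (c : F) f h v : hop a b f -> hop a b h ->
  E a b (c *: f + h) v = c *: E a b f v + E a b h v.
Proof.
move=> hf hh; have [L vL] := hsum_exists v.
have [e [_ eL]] := bump_refine a L (hop_Gam hf) (hop_neq0 hf) ideal_true algebraic_true.
have ge : good_bump (b - a) a v e by exists L.
rewrite !(E_bump _ ge) //; last exact: hop_linp.
have Gb := hop_Gam hf.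
by rewrite mulrDl -scalerAl (T_linp WM) //; apply: hop_bump_ok eL.
Qed.

Lemma hopE_deg a b f g v : hop a b f -> Vg g v -> Vg (b - a + g) (E a b f v).
Proof.
move=> hf vg.
have [e _ /(_ v (hsum_Vg vg))[-> okfe]] := bump_for [:: g] hf ideal_true algebraic_true.
exact: (T_deg WM) (hop_Gam hf) okfe vg.
Qed.

(* The displacements are not opposite, so the commutator formula for [T] has no scalar term. *)
Lemma hopE_comm_gen a b c d f h v : hop a b f -> hop c d h -> (b - a) + (d - c) != 0 ->
  E a b f (E c d h v) - E c d h (E a b f v)
  = (if d == a then E c b (tauA (d - c) f * h) v else 0)
    - (if b == c then E a d (tauA (b - a) h * f) v else 0).
Proof.
move=> hf hh nopp.
set x := b - a in nopp *; set y := d - c in nopp *.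
have [Gx Gy] : Gam x /\ Gam y by split; [exact: hop_Gam hf|exact: hop_Gam hh].
have Gxy : Gam (x + y) by apply: (subgD GG).
have [L0 vL0] := hsum_exists v; have [L1 L1P] := hsum_exists (E c d h v).
have [L2 L2P] := hsum_exists (E a b f v).
pose L := L0 ++ L1 ++ L2; pose K := killer (x + y) L.
have vL : hsum L v by apply: hsum_sub vL0 => z zL; rewrite !mem_cat zL.
have hvL : hsum L (E c d h v) by apply: hsum_sub L1P => z zL; rewrite !mem_cat zL orbT.
have fvL : hsum L (E a b f v) by apply: hsum_sub L2P => z zL; rewrite !mem_cat zL !orbT.
have KI := killer_ideal L Gxy nopp; have Ka := killer_algebraic L Gxy nopp.
rewrite -/K in KI Ka.
have JI z := ideal_and KI (shift_idealP z KI).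
have Ja z := algebraic_and KI (shift_idealP z KI) Ka (shift_ideal_alg z Ka).
have [e eJ eE] := bump_for L hf (JI y) (Ja y).
have [e' eJ' eE'] := bump_for L hh (JI x) (Ja x).
have [[-> okfe] [-> okhe]] := (eE _ hvL, eE' _ fvL).
have [[-> _] [-> _]] := (eE' _ vL, eE _ vL).
rewrite (T_br WM) //.
(* The translated bump sits at [a - y]. Its product with the bump at [c] is a bump if [a - y = c],
   that is [d = a], and lies in [K] otherwise; the other term is symmetric. *)
have e1 : bump K (a - y) (tauA y e) by apply: bump_tau; apply: bump_mono eJ => p [].
have e1' : bump K (c - x) (tauA x e') by apply: bump_tau; apply: bump_mono eJ' => p [].
have e0 : bump K a e by apply: bump_mono eJ => p [].
have e0' : bump K c e' by apply: bump_mono eJ' => p [].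
have okx p : ok y p -> ok (x + y) (tauA y (f * e) * p).
  move: okfe okhe; rewrite /allowed -/x -/y; case: (sg) => okfe okhe okp.
    by rewrite rmorphM /= ev_tau opprD addrNK okfe mul0r.
  by rewrite rmorphM /= okp mulr0.
have okx1 : ok (x + y) (tauA y (f * e) * (h * e')) by apply: okx.
have okx2 : ok (x + y) (tauA x (h * e') * (f * e)).
  move: okfe okhe; rewrite /allowed -/x -/y; case: (sg) => okfe okhe.
    by rewrite rmorphM /= ev_tau opprD addrAC addNr sub0r okhe mul0r.
  by rewrite rmorphM /= okfe mulr0.
rewrite T_subp //; congr (_ - _).
- have -> : tauA y (f * e) * (h * e') = (tauA y f * h) * (tauA y e * e').
    by rewrite rmorphM mulrACA.
  case: eqVneq => [da|da].
    have ay : a - y = c by rewrite -da /y opprB addrC subrK.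
    rewrite ay in e1.
    have hc : hop c b (tauA (d - c) f * h).
      apply: (hop_comp GG hh); first by rewrite da.
      apply: contraNneq nopp => cb; rewrite /x /y da cb addrA subrK subrr //.
    have bc : b - c = x + y by rewrite /x /y da addrA subrK.
    rewrite -[x + y]bc; apply/esym/E_bump => //; exists L => //; rewrite bc.
    exact: bump_mul KI e1 e0'.
  apply: killer_hsum vL; case: (KI) => _ _; apply.
  apply: bump_orth KI Ka _ e1 e0'.
  by apply: contraNneq da => /eqP; rewrite subr_eq /y addrC subrK eq_sym.
- have -> : tauA x (h * e') * (f * e) = (tauA x h * f) * (tauA x e' * e).
    by rewrite rmorphM mulrACA.
  case: eqVneq => [bc|bc].
    have cx : c - x = a by rewrite -bc /x opprB addrC subrK.
    rewrite cx in e1'.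
    have ha : hop a d (tauA (b - a) h * f).
      apply: (hop_comp GG hf); first by rewrite bc.
      apply: contraNneq nopp => ad; rewrite /x /y bc ad addrA subrK subrr //.
    have da : d - a = x + y by rewrite /x /y bc [RHS]addrC addrA subrK.
    rewrite -[x + y]da; apply/esym/E_bump => //; exists L => //; rewrite da.
    exact: bump_mul KI e1' e0.
  apply: killer_hsum vL; case: (KI) => _ _; apply.
  apply: bump_orth KI Ka _ e1' e0.
  by apply: contraNneq bc => /eqP; rewrite subr_eq /x addrC subrK eq_sym.
Qed.

(** For opposite displacements the bracket falls into degree 0, where bumps are missing and a scalar
    may appear. Writing [E c d] as a commutator through a far site [t] leaves two hops whose
    displacements are not opposite to [b - a]. *)
Lemma hopE_comm a b c d f h v : hop a b f -> hop c d h -> (c, d) != (b, a) ->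
  E a b f (E c d h v) - E c d h (E a b f v)
  = (if d == a then E c b (tauA (d - c) f * h) v else 0)
    - (if b == c then E a d (tauA (b - a) h * f) v else 0).
Proof.
move=> hf hh nopp; have [opp|] := eqVneq (b - a + (d - c)) 0; last exact: hopE_comm_gen.
have dc : d - c = a - b by apply/eqP; rewrite -[a - b]opprB -addr_eq0 addrC opp.
have dE : d = a - b + c by rewrite -dc subrK.
have da : d != a.
  apply: contraNneq nopp => da; rewrite xpair_eqE da eqxx andbT.
  by have /eqP := dE; rewrite da -addrA -subr_eq0 opprD addrA subrr sub0r oppr_eq0 addrC subr_eq0.
have bc : b != c by apply: contraNneq da => bc; rewrite dE bc subrK.
rewrite (negPf da) (negPf bc) subr0.
have [N tN] := ray_avoid c [:: 0; a; b; c; d] (tors_free WM) (hop_neq0 hh).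
set t := c + (d - c) *+ N; have {tN} := tN _ (leqnn N); rewrite -/t.
rewrite !inE !negb_or => /and5P[t0 ta tb tc td].
have Gtc : Gam (t - c) by rewrite /t addrC addKr; apply: (subgMn GG); apply: hop_Gam hh.
have [h1 [h2 [hh1 hh2 hE]]] := hop_split GG hh t0 tc td Gtc.
have EC w : E c d h w = E t d h1 (E c t h2 w) - E c t h2 (E t d h1 w).
  rewrite (hopE_comm_gen _ hh1 hh2); last first.
    by rewrite addrA subrK; apply: hop_neq0 hh.
  by rewrite eqxx hE; case: eqP => [dc0|_]; [case: hh; rewrite dc0 eqxx|rewrite subr0].
have C1 w : E a b f (E t d h1 w) = E t d h1 (E a b f w).
  apply/eqP; rewrite -subr_eq0 (hopE_comm_gen _ hf hh1) ?(negPf da) ?[b == t]eq_sym ?(negPf tb) ?subr0 //.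
  have -> : b - a + (d - t) = b - a + (d - c) + (c - t) by rewrite -[RHS]addrA; congr (_ + _); rewrite addrA subrK.
  by rewrite opp add0r subr_eq0 eq_sym.
have C2 w : E a b f (E c t h2 w) = E c t h2 (E a b f w).
  apply/eqP; rewrite -subr_eq0 (hopE_comm_gen _ hf hh2) ?(negPf ta) ?(negPf bc) ?subr0 //.
  have -> : b - a + (t - c) = b - a + (d - c) + (t - d).
    by rewrite -[RHS]addrA; congr (_ + _); rewrite [RHS]addrC addrA subrK.
  by rewrite opp add0r subr_eq0.
by rewrite !EC (linB (hopE_lin hf)) !(C1, C2) subrr.
Qed.

Lemma killer_zeros b g : Gam b -> b != 0 -> exists s : seq X,
  forall a, (forall r, killer b [:: g] r -> evA a r = 0) -> a \in s.
Proof. by move=> Gb b0; apply: ideal_zeros (killer_ideal _ Gb b0) (killer_algebraic _ Gb b0). Qed.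

(** Away from its finitely many zeros, the ideal of killers is locally everything. *)
Lemma hopE_fin b g : Gam b -> b != 0 -> exists s : seq X,
  forall a f v, hop a (a + b) f -> Vg g v -> a \notin s -> E a (a + b) f v = 0.
Proof.
move=> Gb b0; have [s sP] := killer_zeros g Gb b0; exists s => a f v hf vg nas.
have bE : a + b - a = b by rewrite addrC addKr.
have KI := killer_ideal [:: g] Gb b0; have Ka := killer_algebraic [:: g] Gb b0.
have [e [_ e0] /(_ v (hsum_Vg vg))[-> _]] := bump_for [:: g] hf KI Ka.
rewrite bE; apply: killer_hsum (hsum_Vg vg); case: (KI) => _ _; apply.
apply: local_global => // z; have [->|/e0//] := eqVneq z a.
have [u Ku u0] : exists2 u, killer b [:: g] u & evA a u != 0.
  apply: NNPP => nu; case/negP: nas; apply: sP => r Kr.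
  by apply/eqP; apply: contra_notT nu => r0; exists r.
exact: loc_full KI Ku u0.
Qed.

Lemma hopE_nilp a b f g : a != b -> Gam (b - a) -> evA a f = 0 ->
  exists2 m, (0 < m)%N & forall v, Vg g v -> E a b (f ^+ m) v = 0.
Proof.
move=> ab Gab fa; have b0 : b - a != 0 by rewrite subr_eq0 eq_sym.
have KI := killer_ideal [:: g] Gab b0; have Ka := killer_algebraic [:: g] Gab b0.
(* With the positive exponent [m.+1] the power still vanishes at [a], so it is a valid germ even for
   a constrained hop. *)
have [m fm] := loc_pow KI Ka fa; exists m.+1 => // v vg.
have hf : hop a b (f ^+ m.+1) by split=> // _; rewrite rmorphXn /= fa expr0n.
have [e [_ e0] /(_ v (hsum_Vg vg))[-> _]] := bump_for [:: g] hf KI Ka.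
apply: killer_hsum (hsum_Vg vg); apply: local_global => // z.
have [->|za] := eqVneq z a; last by case: (loc_ideal z KI) => _ _; apply; apply: e0.
by rewrite exprS -mulrA mulrCA; apply: idealMr (loc_ideal a KI) fm.
Qed.

Lemma hop_allowed a b q : Gam b -> b != 0 -> ok b q -> hop a (a + b) q.
Proof.
move=> Gb b0 okq; split; last first.
- move: okq; rewrite /allowed; case: (sg) => okq /eqP a0.
    by rewrite (_ : a = - b) //; apply/eqP; rewrite -addr_eq0 a0.
  by rewrite a0.
- by rewrite addrC addKr.
- by rewrite -subr_eq0 opprD addrA subrr sub0r oppr_eq0.
Qed.

(** The bumps at the zeros of the killer ideal form a partition of unity, which cuts [T b q] into
    hops. *)
Lemma T_sumE b q v : Gam b -> b != 0 -> ok b q ->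
  exists s : seq X, [/\ uniq s, forall a, a \notin s -> E a (a + b) q v = 0 &
    T b q v = \sum_(a <- s) E a (a + b) q v].
Proof.
move=> Gb b0 okq; have [L vL] := hsum_exists v.
have KI := killer_ideal L Gb b0; have Ka := killer_algebraic L Gb b0.
have [s sP] := ideal_zeros KI Ka; exists (undup s).
have bE a : a + b - a = b by rewrite addrC addKr.
have qh a := hop_allowed a Gb b0 okq.
have eX a : exists e, bump (killer b L) a e by apply: bump_exists.
pose e a := sval (constructive_indefinite_description _ (eX a)).
have eP a : bump (killer b L) a (e a) by rewrite /e; case: constructive_indefinite_description.
have EE a : E a (a + b) q v = T b (q * e a) v.
  by rewrite (@E_bump a (a + b) q v (e a)) // ?bE //; exists L; rewrite ?bE.
have oke a : ok b (q * e a) by apply: okMr.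
split; first exact: undup_uniq.
- move=> a; rewrite mem_undup => nas; rewrite EE; apply: killer_hsum vL.
  case: (KI) => _ _; apply; apply: local_global => // z.
  have [->|za] := eqVneq z a; last exact: (proj2 (eP a)).
  have [u Ku u0] : exists2 u, killer b L u & evA a u != 0.
    apply: NNPP => nu; case/negP: nas; apply: sP => r Kr.
    by apply/eqP; apply: contra_notT nu => r0; exists r.
  exact: loc_full KI Ku u0.
under eq_bigr do rewrite EE.
rewrite -T_sump // -mulr_sumr; apply/eqP; rewrite -subr_eq0 -T_subp //; last exact: okMr.
rewrite -{1}[q]mulr1 -mulrBr; apply/eqP; apply: killer_hsum vL; case: (KI) => _ _; apply.
by apply: bump_sum => //; rewrite ?undup_uniq // => a /sP; rewrite mem_undup.
Qed.

(* Degree 0 is generated by the other degrees: [p = u - tau x u] with [u] vanishing at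
   both [0] and [x], so that [u] lies in the product of the ideals of these points. *)
Lemma T0_brackets x p : Gam x -> x != 0 -> ok 0 p -> exists p1 q1 p2 q2 (l : F),
  [/\ [/\ ok x p1, ok (- x) q1, ok x p2 & ok (- x) q2],
    p = (tauA (- x) p1 * q1 - tauA x q1 * p1) + (tauA (- x) p2 * q2 - tauA x q2 * p2)
  & forall v, T 0 p v = (T x p1 (T (- x) q1 v) - T (- x) q1 (T x p1 v))
      + (T x p2 (T (- x) q2 v) - T (- x) q2 (T x p2 v)) + l *: v].
Proof.
move=> Gx x0 p0; have [u0 u0E] := tau_surj x0 (- p).
pose u := u0 - (evA 0 u0)%:A.
have uE : u - tauA x u = p.
  by rewrite /u rmorphB /= tauC opprB addrA subrK -[RHS]opprK -u0E opprB.
have u00 : evA 0 u = 0 by rewrite /u rmorphB /= evC subrr.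
have ux : evA x u = 0.
  have := congr1 (evA 0) uE; rewrite rmorphB /= ev_tau add0r u00 sub0r => /eqP.
  by move: p0; rewrite /allowed oppr0 if_same => ->; rewrite oppr_eq0 => /eqP.
(* [y] is 0 at 0 and 1 at [x]. In [u = u * y + u * (1 - y)] each product then has one factor
   vanishing at 0 and one vanishing at [x], in the order that [sg] requires. *)
have [r] := ev_sep A (elimN eqP x0).
pose y := (evA x r - evA 0 r)^-1%:A * (r - (evA 0 r)%:A) => /eqP rx.
have y0 : evA 0 y = 0 by rewrite rmorphM /= rmorphB /= !evC subrr mulr0.
have yx : evA x y = 1 by rewrite rmorphM /= rmorphB /= !evC mulVf // subr_eq0.
have [U1 [U2 [W1 [W2 [UE [okU1 okU2 okW1 okW2]]]]]] : exists U1 U2 W1 W2,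
    u = U1 * U2 + W1 * W2 /\
    [/\ ok x (tauA x U1), ok (- x) U2, ok x (tauA x W1) & ok (- x) W2].
  have uy : u = u * y + u * (1 - y) by rewrite mulrBr mulr1 addrC subrK.
  have y1 : evA x (1 - y) = 0 by rewrite rmorphB /= rmorph1 yx subrr.
  case: sg; [exists y, u, u, (1 - y)|exists u, y, (1 - y), u];
    rewrite /allowed ?ev_tau ?opprK ?addNr ?add0r ?u00 ?ux ?y0 ?y1 ?rmorphB ?rmorph1 /=;
    by rewrite ?[y * u]mulrC ?[(1 - y) * u]mulrC.
have GN := subgN GG Gx.
have bE U1' U2' : tauA (- x) (tauA x U1') * U2' - tauA x U2' * tauA x U1'
    = U1' * U2' - tauA x (U1' * U2').
  by rewrite tauD addNr tau0 rmorphM [tauA x U2' * _]mulrC.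
have [l1 l1P] := T_br0 WM Gx x0 okU1 okU2; have [l2 l2P] := T_br0 WM Gx x0 okW1 okW2.
exists (tauA x U1), U2, (tauA x W1), W2, (- (l1 + l2)); split=> //.
  by rewrite !bE -uE UE rmorphD opprD addrACA.
have ok0h U1' U2' : ok x (tauA x U1') -> ok (- x) U2' ->
    ok 0 (tauA (- x) (tauA x U1') * U2' - tauA x U2' * tauA x U1').
  rewrite bE /allowed oppr0 if_same rmorphB /= !rmorphM /= !ev_tau.
  by case: sg; rewrite ?opprK ?addNr ?add0r => -> ->; rewrite ?mul0r ?mulr0 subrr.
move=> v; rewrite l1P l2P addrACA -scalerDl scaleNr addrK -(T_addp (subg0 GG)) //;
  try exact: ok0h.
by rewrite !bE -uE UE rmorphD opprD addrACA.
Qed.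

Lemma T_closed (S : V -> Prop) x : Gam x -> x != 0 -> subspace S ->
  (forall a b f v, hop a b f -> S v -> S (E a b f v)) ->
  forall b p v, Gam b -> ok b p -> S v -> S (T b p v).
Proof.
move=> Gx x0 SS SE.
have S1 b p v : Gam b -> b != 0 -> ok b p -> S v -> S (T b p v).
  move=> Gb b0 okp Sv; have [s [_ _ ->]] := T_sumE v Gb b0 okp.
  by apply: subspace_sum => // a _; apply: SE => //; apply: hop_allowed.
move=> b p v Gb okp Sv; have [b0|b0] := eqVneq b 0; last exact: S1.
move: okp; rewrite b0 => okp; have GN := subgN GG Gx; have N0 : - x != 0 by rewrite oppr_eq0.
have [p1 [q1 [p2 [q2 [l [[ok1 ok2 ok3 ok4] _ ->]]]]]] := T0_brackets Gx x0 okp.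
apply: subspaceD => //; last exact: subspaceZ.
by apply: subspaceD => //; apply: subspaceB => //; do 2 apply/S1 => //.
Qed.

Lemma weyl_hop_system x : Gam x -> x != 0 -> hop_system sg Gam Vg E.
Proof.
move=> Gx x0; split; [exact: (tors_free WM)|exact: GG|
  exact: (Vg_dim WM)|exact: (Vg_span WM)|exact: (V_nonzero WM)|
  exact: hopE_lin|exact: hopE_linp|exact: hopE_deg|exact: hopE_comm|exact: hopE_fin|
  exact: hopE_nilp|].
by move=> S SS SE; apply: (T_irr WM) => //; exact: T_closed Gx x0 SS SE.
Qed.

End Hops.

(** * Particles moving along a ray *)

Section HopTheory.
Context (F : closedFieldType) (X : zmodType) (A : polyfun F X) (V : lmodType F).
Context (sg : bool) (Gam : X -> Prop) (Vg : X -> V -> Prop) (E : X -> X -> A -> V -> V).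
Context (HS : hop_system sg Gam Vg E).
Implicit Types (a b c d s t q x y g : X) (f h e : A) (u v w : V).

Notation hop := (@hop F X A sg Gam).
Notation tauA := (tau A).

Let GG := hs_grp HS.
Let tf := hs_tors_free HS.
Let EL a b f (hf : hop a b f) := E_lin HS hf.

Lemma E_comm0 a b c d f h v : hop a b f -> hop c d h -> d != a -> b != c ->
  E a b f (E c d h v) = E c d h (E a b f v).
Proof.
move=> hf hh da bc; apply/eqP; rewrite -subr_eq0 (E_comm HS) //.
  by rewrite (negPf da) (negPf bc) subr0.
by apply: contraNneq da => -[_ ->].
Qed.

Lemma E_comp c d b f h v : hop c d h -> hop d b f -> c != b ->
  E d b f (E c d h v) = E c d h (E d b f v) + E c b (tauA (d - c) f * h) v.
Proof.
move=> hh hf cb; apply/eqP; rewrite addrC -subr_eq (E_comm HS) //.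
  by rewrite eqxx [b == c]eq_sym (negPf cb) subr0.
by apply: contraNneq cb => -[->].
Qed.

Lemma E_split a b f t : hop a b f -> t != 0 -> t != a -> t != b -> Gam (t - a) ->
  exists f1 f2, [/\ hop t b f1, hop a t f2, tauA (t - a) f1 * f2 = f &
    forall v, E a b f v = E t b f1 (E a t f2 v) - E a t f2 (E t b f1 v)].
Proof.
move=> hf t0 ta tb Gta; have [f1 [f2 [h1 h2 fE]]] := hop_split GG hf t0 ta tb Gta.
exists f1, f2; split=> // v; have ab : a != b by case: hf.
by rewrite E_comp // fE addrC addKr.
Qed.

Lemma hop_site1 a b : a != b -> Gam (b - a) -> a != 0 -> b != 0 -> hop a b 1.
Proof. exact: hop_site. Qed.

Lemma hop_retarget a b b' f : hop a b f -> b != 0 -> a != b' -> b' != 0 -> Gam (b' - b) ->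
  hop a b' f.
Proof.
move=> [ab Gab fa] /negPf b0 ab' /negPf b0' Gb; split=> //.
  by rewrite -(subrKA b); apply: subgD GG _ _ Gb Gab.
by move: fa; case: (sg); rewrite ?b0 ?b0'.
Qed.

(* Hopping through a target that is itself moved to [b'] by the unit hop. *)
Lemma E_unit_comp a b b' f v : hop a b f -> hop b b' 1 -> a != b' ->
  E b b' 1 (E a b f v) = E a b f (E b b' 1 v) + E a b' f v.
Proof. by move=> hf h1 ab; rewrite E_comp // rmorph1 mul1r. Qed.

(** A long hop is an iterated commutator of neighbouring hops, all of which kill [v]. *)
Lemma E_chain (q : nat -> X) n v : (0 < n)%N -> (forall i, (i <= n)%N -> q i != 0) ->
  (forall i j, (i <= n)%N -> (j <= n)%N -> q i = q j -> i = j) -> (forall i j, Gam (q i - q j)) ->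
  (forall i f, (i < n)%N -> hop (q i) (q i.+1) f -> E (q i) (q i.+1) f v = 0) ->
  forall f, hop (q 0%N) (q n) f -> E (q 0%N) (q n) f v = 0.
Proof.
move=> + + + Gq; case: n => // n _; elim: n => [|n IHn] q0 qI qE f hf; first exact: qE.
have ne i j : (i <= n.+2)%N -> (j <= n.+2)%N -> i <> j -> q i != q j.
  by move=> ? ? ij; apply/eqP => E0; apply: ij; apply: qI.
have t0 : q n.+1 != 0 by apply: q0.
have ta : q n.+1 != q 0%N by apply: ne.
have tb : q n.+1 != q n.+2 by apply: ne => //; lia.
have [f1 [f2 [h1 h2 _ ->]]] := E_split hf t0 ta tb (Gq _ _).
rewrite qE // (lin0 (EL h2)) subr0 [X in E _ _ f1 X]IHn ?(lin0 (EL h1)) //.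
- by move=> i ?; apply: q0; apply: leqW.
- by move=> i j ? ?; apply: qI; apply: leqW.
- by move=> i g ?; apply: qE; apply: leqW.
Qed.

Lemma ray_Gam x c k l : Gam x -> Gam ((c + x *+ k) - (c + x *+ l)).
Proof.
by move=> Gx; rewrite opprD addrACA subrr add0r; apply: (subgB GG); apply: (subgMn GG).
Qed.

Lemma ray_inj x c k l : x != 0 -> c + x *+ k = c + x *+ l -> k = l.
Proof. by move=> x0 /addrI; apply: mulrn_inj tf x0. Qed.

(* From its [N]-th site on, the ray [c + x *+ k] avoids 0 and the hops inside it kill [Vg g]. *)
Definition clean x c g N := forall k, (N <= k)%N -> c + x *+ k != 0 /\
  forall l f v, (N <= l)%N -> Vg g v ->
    hop (c + x *+ k) (c + x *+ l) f -> E (c + x *+ k) (c + x *+ l) f v = 0.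

(** Beyond the finitely many sites where a hop by [x] or [- x] acts on [Vg g], [E_chain] extends the
    vanishing to all displacements along the ray. *)
Lemma clean_ray x c g : Gam x -> x != 0 -> exists N, clean x c g N.
Proof.
move=> Gx x0; have [s sP] := E_fin HS g Gx x0.
have [s' s'P] : exists s : seq X, forall a f v, hop a (a + - x) f -> Vg g v -> a \notin s ->
    E a (a + - x) f v = 0.
  by apply: (E_fin HS); [apply: (subgN GG Gx)|rewrite oppr_eq0].
have [N NP] := ray_avoid c (0 :: s ++ s') tf x0.
have {}NP k : (N <= k)%N -> [/\ c + x *+ k != 0, c + x *+ k \notin s & c + x *+ k \notin s'].
  by move/NP; rewrite inE mem_cat !negb_or => /and3P.
exists N => k Nk; split=> [|l f v Nl vg hf]; first by case: (NP k Nk).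
have kl : k != l by apply: contraTneq (hop_neq0 hf) => ->; rewrite subrr eqxx.
have {}kl : (k < l)%N \/ (l < k)%N by lia.
have nz i : (N <= i)%N -> c + x *+ i != 0 by case/NP.
case: kl => kl.
  pose p i := c + x *+ (k + i).
  have [pk pl] : c + x *+ k = p 0%N /\ c + x *+ l = p (l - k)%N by rewrite /p addn0 subnKC // ltnW.
  rewrite pk pl in hf *; apply: E_chain hf; rewrite ?subn_gt0 //.
  - by move=> i _; apply: nz; lia.
  - by move=> i j _ _ /(ray_inj x0); lia.
  - by move=> i j; apply: ray_Gam.
  - move=> i h _; rewrite /p addnS mulrSr addrA => hh; apply: sP hh vg _.
    by have [] // := NP (k + i)%N; lia.
pose p i := c + x *+ (k - i).
have [pk pl] : c + x *+ k = p 0%N /\ c + x *+ l = p (k - l)%N by rewrite /p subn0 subKn // ltnW.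
rewrite pk pl in hf *; apply: E_chain hf; rewrite ?subn_gt0 //.
- by move=> i ?; apply: nz; lia.
- by move=> i j ? ? /(ray_inj x0); lia.
- by move=> i j; apply: ray_Gam.
- move=> i h ?; have -> : p i.+1 = p i + - x.
    by rewrite /p [(k - i)%N](_ : _ = (k - i.+1).+1) ?mulrSr; [rewrite addrA addrK|lia].
  by move=> hh; apply: s'P hh vg _; have [] // := NP (k - i)%N; lia.
Qed.

Definition ray_out x v := forall a c, exists N, forall k f, (N <= k)%N ->
  hop a (c + x *+ k) f -> E a (c + x *+ k) f v = 0.

Definition ray_in x v := forall b c, exists N, forall k f, (N <= k)%N ->
  hop (c + x *+ k) b f -> E (c + x *+ k) b f v = 0.

Lemma subspace_ray_out x : subspace (ray_out x).
Proof.
split=> [a c|l u v uP vP a c]; first by exists 0%N => k f _ hf; rewrite (lin0 (EL hf)).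
have [N NP] := uP a c; have [M MP] := vP a c; exists (maxn N M) => k f.
by rewrite geq_max => /andP[Nk Mk] hf; rewrite (EL hf) NP // MP // scaler0 addr0.
Qed.

Lemma subspace_ray_in x : subspace (ray_in x).
Proof.
split=> [a c|l u v uP vP a c]; first by exists 0%N => k f _ hf; rewrite (lin0 (EL hf)).
have [N NP] := uP a c; have [M MP] := vP a c; exists (maxn N M) => k f.
by rewrite geq_max => /andP[Nk Mk] hf; rewrite (EL hf) NP // MP // scaler0 addr0.
Qed.

(** Only when [b] is the source of the far hop do the two fail to commute, and the correction is
    again a far hop, now off [a]. *)
Lemma ray_out_E x a b f v : x != 0 -> hop a b f -> ray_out x v -> ray_out x (E a b f v).
Proof.
move=> x0 hf vP a' c; have [N NP] := vP a' c; have [M MP] := vP a c.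
have [K KP] := ray_avoid c [:: a] tf x0.
exists (maxn N (maxn M K)) => k h; rewrite !geq_max => /and3P[Nk Mk Kk] hh.
have ka : c + x *+ k != a by have := KP k Kk; rewrite inE.
have [ba|ba] := eqVneq b a'; last by rewrite E_comm0 // NP // (lin0 (EL hf)).
move: hh NP; rewrite -ba => hh NP; have ak : a != c + x *+ k by rewrite eq_sym.
by rewrite E_comp // NP // MP ?(lin0 (EL hf)) ?addr0 //; apply: (hop_comp GG hf hh).
Qed.

Lemma ray_in_E x a b f v : x != 0 -> hop a b f -> ray_in x v -> ray_in x (E a b f v).
Proof.
move=> x0 hf vP b' c; have [N NP] := vP b' c; have [M MP] := vP b c.
have [K KP] := ray_avoid c [:: b] tf x0.
exists (maxn N (maxn M K)) => k h; rewrite !geq_max => /and3P[Nk Mk Kk] hh.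
have kb : c + x *+ k != b by have := KP k Kk; rewrite inE.
have bk : b != c + x *+ k by rewrite eq_sym.
have [ba|ba] := eqVneq b' a; last by rewrite E_comm0 // NP // (lin0 (EL hf)).
move: hh NP; rewrite ba => hh NP.
have := E_comp v hh hf kb; rewrite NP // (lin0 (EL hf)) => /esym.
by rewrite MP ?addr0 //; apply: (hop_comp GG hh hf).
Qed.

Lemma ray_out_all x v : x != 0 -> v != 0 -> ray_out x v -> forall u, ray_out x u.
Proof.
move=> x0 v0 vP; apply: (E_irr HS (subspace_ray_out x)); last by exists v.
by move=> a b f u; apply: ray_out_E.
Qed.

Lemma ray_in_all x v : x != 0 -> v != 0 -> ray_in x v -> forall u, ray_in x u.
Proof.
move=> x0 v0 vP; apply: (E_irr HS (subspace_ray_in x)); last by exists v.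
by move=> a b f u; apply: ray_in_E.
Qed.

Lemma ray_outN x v : ~ ray_out x v -> exists a c, forall N, exists k f,
  [/\ (N <= k)%N, hop a (c + x *+ k) f & E a (c + x *+ k) f v != 0].
Proof.
move=> nv; apply: NNPP => no; apply: nv => a c; apply: NNPP => nN; apply: no.
exists a, c => N; apply: NNPP => nk; apply: nN; exists N => k f Nk hf.
by apply/eqP; apply: contra_notT nk => ek; exists k, f.
Qed.

Lemma ray_inN x v : ~ ray_in x v -> exists b c, forall N, exists k f,
  [/\ (N <= k)%N, hop (c + x *+ k) b f & E (c + x *+ k) b f v != 0].
Proof.
move=> nv; apply: NNPP => no; apply: nv => a c; apply: NNPP => nN; apply: no.
exists a, c => N; apply: NNPP => nk; apply: nN; exists N => k f Nk hf.
by apply/eqP; apply: contra_notT nk => ek; exists k, f.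
Qed.

Lemma homogeneous_nonzero : exists g v, Vg g v /\ v != 0.
Proof.
have [v v0] := hs_nonzero HS; have [s [sP vE]] := hs_span HS v.
apply: NNPP => no; case/eqP: v0; rewrite vE big_seq big1 // => x /sP xV.
by apply/eqP; apply: contra_notT no => x0; exists x.1, x.2.
Qed.

(* A hop [a -> q k] combined with a second hop [Y k] bringing the degree back to a fixed
   value produces linearly independent vectors: the hop [q k -> q1] detects the [k]-th one. *)
Lemma two_hop g g' v a f q1 (q : nat -> X) (Y : nat -> V -> V) (B : nat -> Prop) :
  hop a q1 f -> unbounded B ->
  (forall k, B k -> [/\ hop a (q k) f, hop (q k) q1 1, E (q k) q1 1 v = 0 & lin (Y k)]) ->
  (forall i j, q i = q j -> i = j) ->
  (forall k, B k -> Vg g' (Y k (E a (q k) f v))) ->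
  (forall i j u, B i -> B j -> E (q j) q1 1 (Y i u) = Y i (E (q j) q1 1 u)) ->
  (forall k, B k -> Y k (E a q1 f v) != 0) -> Vg g v -> False.
Proof.
move=> h1 uB BP qI Yg YC Y0 vg; have [d dg] := hs_dim HS g'.
have aq1 : a != q1 by case: h1.
apply: (dim_le_bound_sub (O := fun k => E (q k) q1 1) dg uB Yg) => [i /BP[_ hi _ _]|i j Bi Bj ij|i Bi].
- exact: EL hi.
- have [[hj _ _ YL] [hi hi1 z _]] := (BP j Bj, BP i Bi); rewrite YC // E_comm0 //.
  + by rewrite z (lin0 (EL hj)) (lin0 YL).
  + by apply/eqP => /qI e; rewrite e ltnn in ij.
  + by rewrite eq_sym.
- have [hi hi1 z YL] := BP i Bi; rewrite YC // E_unit_comp // z (lin0 (EL hi)) add0r.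
  exact: Y0.
Qed.

(** * Pairs of far hops *)

Section Transport.
Context (x : X) (Gx : Gam x) (x0 : x != 0).

(* On a clean ray, a target [q1] may be replaced by any other one. *)
Lemma clean_target g v a c N k1 k f : Vg g v -> (N <= k1)%N -> (N <= k)%N -> k1 != k ->
  clean x c g N -> a != c + x *+ k -> hop a (c + x *+ k1) f ->
  [/\ hop a (c + x *+ k) f, hop (c + x *+ k) (c + x *+ k1) 1 &
      E (c + x *+ k) (c + x *+ k1) 1 v = 0].
Proof.
move=> vg Nk1 Nk kk1 NP ak hf; have [z1 _] := NP k1 Nk1; have [z zP] := NP k Nk.
have hq : hop (c + x *+ k) (c + x *+ k1) 1.
  apply: hop_site1 => //; last exact: ray_Gam.
  by apply: contra_neq kk1 => /(ray_inj x0).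
split=> //; last exact: zP vg hq.
by apply: hop_retarget hf _ _ _ _ => //; apply: ray_Gam.
Qed.

(** Hop from [a] onto the site [k1 + k] of one ray, then from the site [k] of another ray into [b]:
    the total displacement does not depend on [k]. *)
Lemma no_out_in : (forall u, u != 0 -> ~ ray_out x u) ->
  (forall u, u != 0 -> ~ ray_in x u) -> False.
Proof.
move=> nout nin; have [g [v [vg v0]]] := homogeneous_nonzero.
have [a [c acP]] := ray_outN (nout v v0).
have [N NP] := clean_ray c g Gx x0.
have [k1 [f [Nk1 hf fv0]]] := acP N.
set q1 := c + x *+ k1 in hf fv0.
have [b [c' bcP]] := ray_inN (nin _ fv0).
have [M MP] := ray_avoid c [:: a; b] tf x0; have [M' MP'] := ray_avoid c' [:: q1] tf x0.
pose K := maxn M (maxn M' 1).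
pose B k := (K <= k)%N /\ exists2 h, hop (c' + x *+ k) b h & E (c' + x *+ k) b h (E a q1 f v) != 0.
pose h k := epsilon (inhabits 0)
  (fun h => hop (c' + x *+ k) b h /\ E (c' + x *+ k) b h (E a q1 f v) != 0).
have BP k : B k -> [/\ hop (c' + x *+ k) b (h k), E (c' + x *+ k) b (h k) (E a q1 f v) != 0,
    [/\ a != c + x *+ (k1 + k), b != c + x *+ (k1 + k) & q1 != c' + x *+ k] & (0 < k)%N].
  move=> [Kk [e e1 e2]]; have [hh1 hh2] : hop (c' + x *+ k) b (h k) /\
      E (c' + x *+ k) b (h k) (E a q1 f v) != 0.
    by apply: (epsilon_spec (inhabits 0) (fun h => hop (c' + x *+ k) b h /\
      E (c' + x *+ k) b h (E a q1 f v) != 0)); exists e.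
  have := MP (k1 + k)%N; have := MP' k; rewrite !inE !negb_or.
  move: Kk; rewrite /K !geq_max => /and3P[Mk Mk' k0] /(_ Mk') n1 /(_ _)/andP[|n2 n3].
    by apply: leq_trans Mk _; apply: leq_addl.
  by split=> //; split; rewrite eq_sym.
apply: (@two_hop g (b - c' + (c - a + x *+ k1) + g) v a f q1 (fun k => c + x *+ (k1 + k))
  (fun k => E (c' + x *+ k) b (h k)) B hf) => //.
- move=> n; have [k [e [nk e1 e2]]] := bcP (maxn n K).
  by exists k; [apply: leq_trans nk; apply: leq_maxl|split; [apply: leq_trans nk; apply: leq_maxr|exists e]].
- move=> k /BP[hk _ [ak _ _] k0].
  have [||n1 n2 n3] := clean_target (k := (k1 + k)%N) vg Nk1 _ _ NP ak hf; try lia.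
  by split=> //; apply: EL.
- by move=> i j /(ray_inj x0)/addnI.
- move=> k /BP[hk _ [ak _ _] k0].
  have [||n1 _ _] := clean_target (k := (k1 + k)%N) vg Nk1 _ _ NP ak hf; try lia.
  have := E_deg HS hk (E_deg HS n1 vg); congr (Vg _ _).
  by rewrite mulrnDr opprD !addrA (ACl (1*2*4*7*5*(6*3)*8)) /= subrr addr0.
- move=> i j u /BP[hi _ [_ _ qi] _] /BP[_ _ [aj bj _] j0].
  have [||_ n2 _] := clean_target (k := (k1 + j)%N) vg Nk1 _ _ NP aj hf; try lia.
  by rewrite E_comm0 //; rewrite eq_sym.
- by move=> k /BP[].
Qed.

(** Once a particle has landed on a clean ray, no other site [b] emits far along [- x]: moving the
    landing site by [x *+ k] would compensate the displacement of the second hop and give infinitely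
    many independent vectors of one degree. *)
Lemma return_zero g v a c N k1 f b c' : Vg g v -> clean x c g N -> (N <= k1)%N ->
  hop a (c + x *+ k1) f -> b != c + x *+ k1 ->
  exists M, forall k h, (M <= k)%N -> hop b (c' + (- x) *+ k) h ->
    E b (c' + (- x) *+ k) h (E a (c + x *+ k1) f v) = 0.
Proof.
move=> vg NP Nk1; set q1 := c + x *+ k1 => hf bq1; apply: NNPP => nM.
have bcP M : exists k h, [/\ (M <= k)%N, hop b (c' + (- x) *+ k) h &
    E b (c' + (- x) *+ k) h (E a q1 f v) != 0].
  apply: NNPP => no; apply: nM; exists M => k h Mk hh.
  by apply/eqP; apply: contra_notT no => ek; exists k, h.
have [M MP] := ray_avoid c [:: a; c'] tf x0.
pose K := maxn M 1.
pose good k h := hop b (c' + (- x) *+ k) h /\ E b (c' + (- x) *+ k) h (E a q1 f v) != 0.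
pose B k := (K <= k)%N /\ exists h, good k h.
pose h k := epsilon (inhabits 0) (good k).
have BP k : B k -> [/\ hop b (c' + (- x) *+ k) (h k), E b (c' + (- x) *+ k) (h k) (E a q1 f v) != 0,
    a != c + x *+ (k1 + k), forall j, c' + (- x) *+ k != c + x *+ (k1 + j) & (0 < k)%N].
  move=> [Kk ex]; have [hh1 hh2] : good k (h k) by apply: (epsilon_spec (inhabits 0) (good k)).
  move: Kk; rewrite /K geq_max => /andP[Mk k0]; split=> // [|j].
    have := MP (k1 + k)%N; rewrite !inE !negb_or eq_sym => /(_ _)/andP[|//].
    by apply: leq_trans Mk _; apply: leq_addl.
  have := MP (k1 + j + k)%N; rewrite !inE !negb_or => /(_ _)/andP[|_].
    by apply: leq_trans Mk _; apply: leq_addl.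
  by apply: contraNneq => E0; apply/eqP; rewrite (mulrnDr x (k1 + j) k) addrA -E0 mulNrn subrK.
apply: (@two_hop g (c' - b + (c - a + x *+ k1) + g) v a f q1 (fun k => c + x *+ (k1 + k))
  (fun k => E b (c' + (- x) *+ k) (h k)) B hf) => //.
- move=> n; have [k [e [nk e1 e2]]] := bcP (maxn n K).
  by exists k; [apply: leq_trans nk; apply: leq_maxl|
    split; [apply: leq_trans nk; apply: leq_maxr|exists e]].
- move=> k /BP[hk _ ak _ k0].
  have [||n1 n2 n3] := clean_target (k := (k1 + k)%N) vg Nk1 _ _ NP ak hf; try lia.
  by split=> //; apply: EL.
- by move=> i j /(ray_inj x0)/addnI.
- move=> k /BP[hk _ ak _ k0].
  have [||n1 _ _] := clean_target (k := (k1 + k)%N) vg Nk1 _ _ NP ak hf; try lia.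
  have := E_deg HS hk (E_deg HS n1 vg); congr (Vg _ _).
  by rewrite mulrnDr mulNrn !addrA (ACl (1*3*4*7*5*(6*2)*8)) /= subrr addr0.
- move=> i j u /BP[hi _ _ qi _] /BP[_ _ aj _ j0].
  have [||_ n2 _] := clean_target (k := (k1 + j)%N) vg Nk1 _ _ NP aj hf; try lia.
  by rewrite E_comm0 //; rewrite eq_sym.
- by move=> k /BP[].
Qed.

(** Any hop splits at a far site, and each half alone kills [v]. *)
Lemma no_rays_trivial : (forall v, ray_out x v) -> (forall v, ray_in x v) ->
  forall a b f v, hop a b f -> E a b f v = 0.
Proof.
move=> Rout Rin a b f v hf.
have [N NP] := Rout v a a; have [M MP] := Rin v b a.
have [K KP] := ray_avoid a [:: 0; a; b] tf x0.
pose k := maxn N (maxn M K); have [Nk Mk Kk] : [/\ (N <= k)%N, (M <= k)%N & (K <= k)%N].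
  by rewrite /k !leq_max !leqnn !orbT.
have := KP k Kk; rewrite !inE !negb_or => /and3P[t0 ta tb].
have Gt : Gam (a + x *+ k - a) by rewrite addrC addKr; apply: (subgMn GG).
have [f1 [f2 [h1 h2 _ ->]]] := E_split hf t0 ta tb Gt.
by rewrite NP // MP // (lin0 (EL h1)) (lin0 (EL h2)) subrr.
Qed.

End Transport.

End HopTheory.

(** * The one-particle case *)

Section OneParticle.
Context (F : closedFieldType) (X : zmodType) (A : polyfun F X) (V : lmodType F).
Context (sg : bool) (Gam : X -> Prop) (Vg : X -> V -> Prop) (E : X -> X -> A -> V -> V).
Context (HS : hop_system sg Gam Vg E).
Context (x : X) (Gx : Gam x) (x0 : x != 0).
Context (Hout : forall u, u != 0 -> ~ ray_out sg Gam E x u).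
Context (Hin : forall u, ray_in sg Gam E (- x) u).
Implicit Types (a b c d e s t q y g : X) (f h : A) (u v w : V).

Notation hop := (@hop F X A sg Gam).
Notation tauA := (tau A).
Notation evA := (ev A).

Let GG := hs_grp HS.
Let tf := hs_tors_free HS.
Let EL a b f (hf : hop a b f) := E_lin HS hf.

Lemma no_invariants v : (forall a b f, hop a b f -> E a b f v = 0) -> v = 0.
Proof.
move=> vE; have [//|v0] := eqVneq v 0.
by case: (Hout v0) => a c; exists 0%N => k f _; apply: vE.
Qed.

Lemma fresh_site q (s : seq X) : exists t, t \notin s /\ Gam (t - q).
Proof.
have [N NP] := ray_avoid q s tf x0; exists (q + x *+ N); split; first exact: NP.
by rewrite addrC addKr; apply: (subgMn GG).
Qed.

(* [w] behaves like a single particle sitting at the site [q]. *)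
Definition localized q w :=
  (forall b d h, b != q -> hop b d h -> E b d h w = 0) /\
  (forall d e f h, hop q d f -> hop q e h -> E q e h (E q d f w) = 0).

Lemma localized_exists : exists q w, [/\ q != 0, w != 0, localized q w & exists g, Vg g w].
Proof.
have [g [v [vg v0]]] := homogeneous_nonzero HS.
have [a [c acP]] := ray_outN (Hout v0).
have [N NP] := clean_ray HS c g Gx x0.
have [k1 [f [Nk1 hf fv0]]] := acP N.
set q := c + x *+ k1 in hf fv0; set w := E a q f v in fv0.
have q0 : q != 0 by case: (NP k1 Nk1).
have wg : Vg (q - a + g) w by apply: (E_deg HS hf vg).
have loc1 b d h : b != q -> hop b d h -> E b d h w = 0.
  move=> bq hh; have [M MP] := return_zero HS Gx x0 b vg NP Nk1 hf bq.
  have [K KP] := Hin w d b.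
  have x0' : - x != 0 by rewrite oppr_eq0.
  have [L LP] := ray_avoid b [:: 0; b; d] tf x0'.
  pose k := maxn M (maxn K L); have [Mk Kk Lk] : [/\ (M <= k)%N, (K <= k)%N & (L <= k)%N].
    by rewrite /k !leq_max !leqnn !orbT.
  have := LP k Lk; rewrite !inE !negb_or => /and3P[t0 tb td].
  have Gt : Gam (b + (- x) *+ k - b) by rewrite addrC addKr; apply/(subgMn GG)/(subgN GG).
  have [h1 [h2 [hh1 hh2 _ ->]]] := E_split HS hh t0 tb td Gt.
  by rewrite MP // KP // (lin0 (EL hh1)) (lin0 (EL hh2)) subrr.
exists q, w; split=> //; last by exists (q - a + g).
(* To exclude a second hop off [q], the first is rerouted through a site of a ray that is clean for
   [w], so that [return_zero] applies to [w]. *)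
split=> // d e f' h hd he.
have [N' NP'] := clean_ray HS q (q - a + g) Gx x0.
have [L LP] := ray_avoid q [:: q; d; e] tf x0.
pose k := maxn N' L; have [Nk Lk] : (N' <= k)%N /\ (L <= k)%N.
  by rewrite /k !leq_max !leqnn !orbT.
have := LP k Lk; rewrite !inE !negb_or; set q' := q + x *+ k => /and3P[q'q q'd q'e].
have q'0 : q' != 0 by case: (NP' k Nk).
have Gq' : Gam (q' - q) by rewrite /q' addrC addKr; apply: (subgMn GG).
have [f1 [f2 [hf1 hf2 _ fE]]] := E_split HS hd q'0 q'q q'd Gq'.
have eq0 : E q e h (E q q' f2 w) = 0.
  have qq' : q != q' by rewrite eq_sym.
  have [M MP] := return_zero HS Gx x0 q wg NP' Nk hf2 qq'.
  have x0' : - x != 0 by rewrite oppr_eq0.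
  have [K KP] := ray_avoid q [:: 0; q; e; q'] tf x0'.
  pose j := maxn M K; have [Mj Kj] : (M <= j)%N /\ (K <= j)%N.
    by rewrite /j !leq_max !leqnn !orbT.
  have := KP j Kj; rewrite !inE !negb_or; set t := q + (- x) *+ j => /and4P[t0 tq te tq'].
  have Gt : Gam (t - q) by rewrite /t addrC addKr; apply/(subgMn GG)/(subgN GG).
  have [h1 [h2 [hh1 hh2 _ ->]]] := E_split HS he t0 tq te Gt.
  rewrite MP // (lin0 (EL hh1)) sub0r.
  have eq : e != q by case: he; rewrite eq_sym.
  have q't : q' != t by rewrite eq_sym.
  rewrite (E_comm0 HS _ hh1 hf2) // loc1 // (lin0 (EL hf2)) (lin0 (EL hh2)).
  by rewrite oppr0.
rewrite fE (loc1 q' d) // (lin0 (EL hf2)) subr0.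
have dq : d != q by case: hd; rewrite eq_sym.
have eq' : e != q' by rewrite eq_sym.
by rewrite (E_comm0 HS _ he hf1) // eq0 (lin0 (EL hf1)).
Qed.

Section Localized.
Context (q : X) (w : V) (q0 : q != 0) (w0 : w != 0) (Lw : localized q w).
Context (g : X) (wg : Vg g w).

Lemma far_zero b d e f h : b != d -> hop q d f -> hop b e h -> E b e h (E q d f w) = 0.
Proof.
move=> bd hd hh; have [b_q|bq] := eqVneq b q; first by move: hh; rewrite b_q => hh; apply: (proj2 Lw).
have [eq|eq] := eqVneq e q; last first.
  rewrite (E_comm0 HS) //; last by rewrite eq_sym.
  by rewrite (proj1 Lw) // (lin0 (EL hd)).
move: hh; rewrite eq => hh.
have := E_comp HS w hh hd bd; rewrite (proj1 Lw b q) // (lin0 (EL hd)) => /esym.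
by rewrite (proj1 Lw b d) ?addr0 //; apply: (hop_comp GG hh hd).
Qed.

(** There is no hop from [q] to itself, so a germ is applied to the particle at [q] by sending it to
    [t0] and back. *)
Let t0 : X := epsilon (inhabits 0) (fun t => t \notin [:: 0; q] /\ Gam (t - q)).

Lemma t0P : [/\ t0 != 0, t0 != q & Gam (t0 - q)].
Proof.
have [nt Gt] : t0 \notin [:: 0; q] /\ Gam (t0 - q).
  by apply: (epsilon_spec (inhabits 0) (fun t => t \notin [:: 0; q] /\ Gam (t - q)));
     apply: fresh_site.
by move: nt; rewrite !inE negb_or => /andP[].
Qed.

(* The particle moved to [d], with the germ [f] at the starting point [q]. *)
Definition vec d f := if d == q then E t0 q 1 (E q t0 f w) else E q d f w.
Definition valid d f := d != q -> hop q d f.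

Lemma subg_sym a b : Gam (a - b) -> Gam (b - a).
Proof. by move=> Gab; rewrite -opprB; apply: (subgN GG). Qed.

Lemma subg_trans c a b : Gam (a - c) -> Gam (c - b) -> Gam (a - b).
Proof. by move=> Gac Gcb; rewrite -(subrKA c); apply: (subgD GG). Qed.

(** The detour is redirected by the unit hop [t0 -> t]; the terms in which a hop leaves a vacant
    site vanish. *)
Lemma return_indep t f : t != 0 -> t != q -> Gam (t - q) ->
  E t q 1 (E q t f w) = vec q f.
Proof.
move=> tn0 tq Gt; rewrite /vec eqxx; have [t00 t0q Gt0] := t0P.
have [->//|tt0] := eqVneq t t0.
have h1 : hop q t0 f by apply: hop_site => //; rewrite eq_sym.
have h2 : hop q t f by apply: hop_site => //; rewrite eq_sym.
have G1 : Gam (t - t0) by apply: (subg_trans Gt); apply: subg_sym.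
have h3 : hop t0 t 1 by apply: hop_site => //; rewrite eq_sym.
have h4 : hop t q 1 by apply: hop_site => //; apply: subg_sym.
have h5 : hop t0 q 1 by apply: hop_site => //; apply: subg_sym.
have -> : E q t f w = E t0 t 1 (E q t0 f w).
  by rewrite (E_unit_comp HS) // 1?eq_sym // (proj1 Lw t0 t) // (lin0 (EL h1)) add0r.
by rewrite (E_unit_comp HS) // (far_zero _ h1 h4) // (lin0 (EL h3)) add0r.
Qed.

(** The matrix unit relation, still with germs. If the particle starts or ends at [q], its detour is
    taken through a fresh site [t], so that no hop is composed with its own reverse. *)
Lemma E_vec b e h d f : hop b e h -> valid d f -> Gam (d - q) ->
  E b e h (vec d f) = if b == d then vec e (tauA (d - q) h * f) else 0.
Proof.
move=> hh vd Gd; have be : b != e by case: (hh).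
have [dq|dq] := eqVneq d q.
  rewrite dq; have [t [nt Gt]] := fresh_site q [:: b; e; q; 0].
  move: nt; rewrite !inE !negb_or => /and4P[tb te tq tn0].
  have h1 : hop q t f by apply: hop_site => //; rewrite eq_sym.
  have h4 : hop t q 1 by apply: hop_site => //; apply: subg_sym.
  rewrite -(return_indep f tn0 tq Gt); have [bq|bq] := eqVneq b q; last first.
    rewrite (E_comm0 HS) // 1?eq_sym //.
    by rewrite (far_zero _ h1 hh) ?(lin0 (EL h4)) // eq_sym.
  move: hh be; rewrite bq => hh qe.
  rewrite (E_comp HS _ h4 hh) // (proj2 Lw) // (lin0 (EL h4)) add0r mulr1.
  have ht : hop t e (tauA (q - t) h) by rewrite -[tauA _ h]mulr1; apply: (hop_comp GG h4 hh).
  rewrite (E_comp HS _ h1 ht) // (proj1 Lw t e) // (lin0 (EL h1)) add0r.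
  by rewrite tauD addrA subrK !subrr /vec [e == q]eq_sym (negPf qe).
rewrite {1}/vec (negPf dq); have hd := vd dq.
have [bd|bd] := eqVneq b d; last exact: far_zero.
move: hh be; rewrite bd => hh de.
have [eq|eq] := eqVneq e q; last first.
  rewrite (E_comp HS) // 1?eq_sym // (proj1 Lw d e) // (lin0 (EL hd)) add0r.
  by rewrite /vec (negPf eq).
move: hh; rewrite eq => hh.
have [t [nt Gt]] := fresh_site q [:: d; q; 0].
move: nt; rewrite !inE !negb_or => /and3P[td tq tn0].
have Gtq := subg_sym Gt; have Gtd : Gam (t - d) by apply: (subg_trans Gt); apply: subg_sym.
have dt : d != t by rewrite eq_sym.
have h1 : hop d t h by apply: (hop_retarget HS hh).
have h2 : hop t q 1 by apply: hop_site.
have -> : E d q h (E q d f w) = E t q 1 (E d t h (E q d f w)).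
  by rewrite (E_unit_comp HS) // (far_zero _ hd h2) // (lin0 (EL h1)) add0r.
rewrite (E_comp HS _ hd h1) 1?eq_sym // (proj1 Lw d t) // (lin0 (EL hd)) add0r.
exact: return_indep.
Qed.

Lemma hop_from_q d f : d != q -> d != 0 -> Gam (d - q) -> hop q d f.
Proof. by move=> dq d0 Gd; apply: hop_site => //; rewrite eq_sym. Qed.

Lemma valid_site d f : d != 0 -> Gam (d - q) -> valid d f.
Proof. by move=> d0 Gd dq; apply: hop_from_q. Qed.

Lemma vec_lin d (c : F) f f' : valid d f -> valid d f' ->
  vec d (c *: f + f') = c *: vec d f + vec d f'.
Proof.
have [t00 t0q Gt0] := t0P; rewrite /valid /vec; case: eqVneq => [_ _ _|dq vf vf'].
  rewrite (E_linp HS); [|exact: hop_from_q..].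
  by rewrite EL //; apply: hop_site => //; apply: subg_sym.
by rewrite (E_linp HS) //; [apply: vf|apply: vf'].
Qed.

Lemma vec0 d : valid d 0 -> vec d 0 = 0.
Proof.
move=> v0; have := vec_lin 1 v0 v0; rewrite !scale1r addr0 => /eqP.
by rewrite -subr_eq0 opprD addrA subrr sub0r oppr_eq0 => /eqP.
Qed.

Lemma validq f : valid q f. Proof. by rewrite /valid eqxx. Qed.

(** A hop off [q] has the same effect on [w] as on the returned particle, so otherwise all hops
    would kill [w]. *)
Lemma vec_q1 : vec q 1 != 0.
Proof.
apply: contraNneq w0 => vq; apply/eqP/no_invariants => a b f hf.
have [aq|aq] := eqVneq a q; last exact: (proj1 Lw).
move: hf; rewrite aq => hf; have qb : b != q by case: (hf); rewrite eq_sym.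
have := E_vec hf (validq 1) _; rewrite subrr eqxx tau0 mulr1 /vec (negPf qb) -/(vec q 1).
by rewrite -[X in E q b f X]/(vec q 1) vq (lin0 (EL hf)) => <- //; apply: (subg0 GG).
Qed.

Let Gqq : Gam (q - q). Proof. by rewrite subrr; apply: (subg0 GG). Qed.

Lemma E_return d f : valid d f -> Gam (d - q) ->
  E t0 q 1 (E q t0 1 (vec d f)) = if q == d then vec q f else 0.
Proof.
move=> vd Gd; have [t00 t0q Gt0] := t0P.
have h1 : hop q t0 1 by apply: hop_from_q.
have h2 : hop t0 q 1 by apply: hop_site => //; apply: subg_sym.
rewrite E_vec //; case: eqVneq => [qd|_]; last by rewrite (lin0 (EL h2)).
rewrite E_vec //; last by apply: valid_site.
by rewrite eqxx !rmorph1 !mul1r.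
Qed.

Lemma vec_qM r h : vec q h = 0 -> vec q (r * h) = 0.
Proof.
move=> h0; have [t00 t0q Gt0] := t0P.
have h1 : hop q t0 r by apply: hop_from_q.
have h2 : hop t0 q 1 by apply: hop_site => //; apply: subg_sym.
have := E_vec h2 (@valid_site t0 (r * h) t00 Gt0) Gt0; rewrite eqxx rmorph1 mul1r => <-.
have := E_vec h1 (validq h) Gqq; rewrite eqxx subrr tau0 h0 (lin0 (EL h1)) => <-.
exact: (lin0 (EL h2)).
Qed.

(* The vectors [vec d f] with [f] vanishing at [q] span a submodule; if it were everything,
   then [vec q 1 = vec q f] with [f] nilpotent, and [1 - f] would be invertible. *)
Lemma vec_vanish d f : valid d f -> Gam (d - q) -> evA q f = 0 -> vec d f = 0.
Proof.
move=> vd Gd f0; have [t00 t0q Gt0] := t0P.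
pose S v := forall U : V -> Prop, subspace U ->
  (forall d f, valid d f -> Gam (d - q) -> evA q f = 0 -> U (vec d f)) -> U v.
have SS : subspace S.
  split=> [U [] //|c u v Su Sv U SU UP]; apply: (proj2 SU); [exact: Su|exact: Sv].
have SE a b h v : hop a b h -> S v -> S (E a b h v).
  move=> hh Sv U SU UP; apply: (Sv (fun v => U (E a b h v))).
    exact: (lin_preim (EL hh) SU).
  move=> d' f' vd' Gd' f'0; rewrite E_vec //; case: eqVneq => [ad|_]; last by case: SU.
  move: (hh); rewrite ad => hh'; have Gb : Gam (b - q) by apply: (subg_trans (hop_Gam hh')).
  apply: UP => // [bq|]; last by rewrite rmorphM /= f'0 mulr0.
  have [d'q|d'q] := eqVneq d' q.
    by move: hh'; rewrite d'q subrr tau0 => -[qb Gqb Eb]; split=> // sb; rewrite rmorphM /= f'0 mulr0.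
  by apply: (hop_comp GG (vd' d'q) hh'); rewrite eq_sym.
apply: NNPP => vdf.
have Sall : forall v, S v.
  apply: (E_irr HS SS SE); exists (vec d f); split; last exact/eqP.
  by move=> U SU UP; apply: UP.
have [f1 [f10 f1E]] : exists f1, evA q f1 = 0 /\ vec q 1 = vec q f1.
  have h1 : hop q t0 1 by apply: hop_from_q.
  have h2 : hop t0 q 1 by apply: hop_site => //; apply: subg_sym.
  have OL : lin (fun v => E t0 q 1 (E q t0 1 v)) by apply: (lin_comp (EL h2) (EL h1)).
  have [f1 [f10 f1E]] : exists f1, evA q f1 = 0 /\ E t0 q 1 (E q t0 1 (vec q 1)) = vec q f1.
    apply: (Sall (vec q 1) (fun v => exists f1, evA q f1 = 0 /\ E t0 q 1 (E q t0 1 v) = vec q f1)).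
      split=> [|c u v [fu [fu0 uE]] [fv [fv0 vE]]].
        by exists 0; rewrite rmorph0 (lin0 OL) vec0 //; apply: validq.
      exists (c *: fu + fv); rewrite rmorphD /= evZ fu0 fv0 mulr0 addr0 OL uE vE.
      by rewrite vec_lin //; apply: validq.
    move=> d' f' vd' Gd' f'0; rewrite E_return //; case: eqVneq => _; first by exists f'.
    by exists 0; rewrite rmorph0 vec0 //; apply: validq.
  by exists f1; split=> //; rewrite -f1E E_return ?eqxx //; apply: validq.
have [] := E_nilp HS (a := q) (b := t0) (f := f1) g => //; first by rewrite eq_sym.
move=> m m0 /(_ w wg) fm; case/eqP: vec_q1.
have h1 h : hop q t0 h by apply: hop_from_q.
have vfm : vec q (f1 ^+ m) = 0.
  rewrite /vec eqxx fm (lin0 (EL _)) //; apply: hop_site => //; exact: subg_sym.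
have v1f : vec q (1 - f1) = 0.
  have := vec_lin (-1) (validq f1) (validq 1); rewrite !scaleN1r addrC => ->.
  by rewrite f1E addNr.
(* The geometric series writes 1 as a multiple of [1 - f1] plus the power of [f1] that kills [w];
   [vec q] vanishes on both. *)
have -> : 1 = (\sum_(i < m) f1 ^+ i) * (1 - f1) + f1 ^+ m.
  by rewrite -[LHS](subrK (f1 ^+ m)) -opprB subrX1 -mulNr opprB mulrC.
have := vec_lin 1 (validq ((\sum_(i < m) f1 ^+ i) * (1 - f1))) (validq (f1 ^+ m)).
by rewrite !scale1r vfm addr0 vec_qM.
Qed.

(** At the site 0 the germ condition, on the hop onto it or off it, makes every hop kill [vec 0 f];
    by [no_invariants] that vector is 0. *)
Definition site_vec d := if d == 0 then 0 else vec d 1.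

Lemma vec_site d f : valid d f -> Gam (d - q) -> vec d f = evA q f *: site_vec d.
Proof.
move=> vd Gd; rewrite /site_vec; case: eqVneq => [d0|dn0]; last first.
  have v1 := @valid_site d 1 dn0 Gd; apply/eqP; rewrite -subr_eq0.
  have -> : vec d f - evA q f *: vec d 1 = vec d (- evA q f *: 1 + f).
    by rewrite vec_lin // scaleNr addrC.
  rewrite vec_vanish //; last by rewrite scaleNr rmorphD rmorphN /= evC addNr.
  by apply: valid_site.
rewrite scaler0; apply: no_invariants => a b h hh.
rewrite E_vec //; case: eqVneq => // ad; move: vd Gd hh; rewrite ad d0 => vd Gd hh.
have q0' : 0 != q by rewrite eq_sym.
have hf := vd q0'; have [_ _ hb] := hh; have [_ _ fb] := hf.
have Gb : Gam (b - q) by apply: (subg_trans (hop_Gam hh)).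
have key : evA q (tauA (0 - q) h * f) = 0.
  rewrite rmorphM /= ev_tau addrC subrK; move: hb fb; case: (sg) => hb fb.
    by rewrite fb ?mulr0.
  by rewrite hb ?mul0r.
apply: vec_vanish => // bq.
by apply: (hop_comp GG hf hh); rewrite eq_sym.
Qed.

Lemma E_site b e h d : hop b e h -> d != 0 -> Gam (d - q) ->
  E b e h (site_vec d) = if b == d then evA d h *: site_vec e else 0.
Proof.
move=> hh d0 Gd; rewrite {1}/site_vec (negPf d0).
have v1 := @valid_site d 1 d0 Gd.
rewrite E_vec //; case: eqVneq => // bd; move: hh; rewrite bd => hh.
have Ge : Gam (e - q) by apply: (subg_trans (hop_Gam hh)).
rewrite mulr1 vec_site //; first by rewrite ev_tau addrC subrK.
move=> eq; have [dq|dq] := eqVneq d q; first by move: hh; rewrite dq subrr tau0.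
by rewrite -[tauA _ h]mulr1; apply: (hop_comp GG (v1 dq) hh); rewrite eq_sym.
Qed.

(** The span of the site vectors is stable under hops and contains [vec q 1]. *)
Lemma site_span v (U : V -> Prop) : subspace U ->
  (forall d, Gam (d - q) -> U (site_vec d)) -> U v.
Proof.
move=> SU UP; pose S v := forall U : V -> Prop, subspace U ->
  (forall d, Gam (d - q) -> U (site_vec d)) -> U v.
suff : S v by apply.
move: v; apply: (E_irr HS (S := S)).
- split=> [W [] //|c u v Su Sv W SW WP]; apply: (proj2 SW); [exact: Su|exact: Sv].
- move=> a b h v hh Sv W SW WP; apply: (Sv (fun v => W (E a b h v))).
    exact: (lin_preim (EL hh) SW).
  move=> d Gd; have [d0|d0] := eqVneq d 0.
    by rewrite /site_vec d0 eqxx (lin0 (EL hh)); case: SW.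
  rewrite E_site //; case: eqVneq => [ad|_]; last by case: SW.
  by apply: subspaceZ => //; apply: WP; apply: (subg_trans (hop_Gam hh)); rewrite ad.
- exists (vec q 1); split; last exact: vec_q1.
  by move=> W _ /(_ q Gqq); rewrite /site_vec (negPf q0).
Qed.

End Localized.

Theorem one_particle_basis : exists q (Y : X -> V), [/\ q != 0, Y 0 = 0, Y q != 0,
  forall b e h d, hop b e h -> d != 0 -> Gam (d - q) ->
    E b e h (Y d) = if b == d then evA d h *: Y e else 0 &
  forall v (U : V -> Prop), subspace U -> (forall d, Gam (d - q) -> U (Y d)) -> U v].
Proof.
have [q [w [q0 w0 Lw [g wg]]]] := localized_exists.
exists q, (site_vec q w); split=> //.
- by rewrite /site_vec eqxx.
- by rewrite /site_vec (negPf q0); apply: vec_q1.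
- by move=> *; apply: E_site wg _ _ _ _ _ _ _.
- by move=> v; apply: site_span wg v.
Qed.

End OneParticle.

(** * Rays behaving differently at the two ends *)

Section HeisenbergTriple.
Context (F : fieldType) (V : lmodType F) (char0 : forall k, k.+1%:R != 0 :> F).
Context (f y z : V -> V) (fL : lin f) (yL : lin y) (zL : lin z).
Context (fy : forall u, f (y u) = y (f u)) (fz : forall u, f (z u) = z (f u)).
Context (yz : forall u, y (z u) = z (y u) + f u).

Lemma iter_swap (p r : V -> V) i j u : (forall u, p (r u) = r (p u)) ->
  iter i p (iter j r u) = iter j r (iter i p u).
Proof.
move=> pr; have pri k w : p (iter k r w) = iter k r (p w) by elim: k => //= k <-; rewrite pr.
by elim: i => //= i ->; rewrite pri.
Qed.

Lemma heis_one j u : z u = 0 -> z (iter j y u) = - (j%:R *: f (iter j.-1 y u)).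
Proof.
move=> zu; elim: j => [|j IHj] /=; first by rewrite scale0r oppr0.
have -> : z (y (iter j y u)) = y (z (iter j y u)) - f (iter j y u) by rewrite yz addrK.
rewrite IHj (linN yL) (linZ yL) -fy; case: j {IHj} => [|j] /=.
  by rewrite scale0r oppr0 scale1r sub0r.
by rewrite -opprD [j.+2%:R]mulrSr scalerDl scale1r.
Qed.

(** The constant is plus or minus the factorial of [j], nonzero in characteristic 0. *)
Lemma heis_pow j u : z u = 0 ->
  exists2 c : F, c != 0 & iter j z (iter j y u) = c *: iter j f u.
Proof.
move=> zu; elim: j => [|j [c c0 IHj]]; first by exists 1; rewrite ?oner_eq0 ?scale1r.
exists (- j.+1%:R * c); first by rewrite mulf_neq0 ?oppr_eq0.
rewrite [iter j.+1 z _]iterSr heis_one //= (linN (lin_iter zL j)) (linZ (lin_iter zL j)).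
have -> : iter j z (f (iter j y u)) = f (iter j z (iter j y u)).
  by rewrite -[f (iter j z _)]/(iter 1 f (iter j z _)) -iter_swap.
by rewrite IHj (linZ fL) scalerA mulNr scaleNr.
Qed.

Lemma heis_vanish i j u : (j < i)%N -> z u = 0 -> iter i z (iter j y u) = 0.
Proof.
move=> ji zu; have -> : i = ((i - j.+1) + j.+1)%N by rewrite subnK.
have [c _ cE] := heis_pow j zu; rewrite iterD iterS cE (linZ zL).
have -> : z (iter j f u) = iter j f (z u).
  by rewrite -[z _]/(iter 1 z (iter j f u)) iter_swap.
by rewrite zu (lin0 (lin_iter fL j)) scaler0 (lin0 (lin_iter zL _)).
Qed.

(** If no power of [f] killed [u], the powers [iter (l * i) z] would detect these vectors of [S] one
    after the other. *)
Lemma heis_nilpotent (S : V -> Prop) d u m l : dim_le d S -> z u = 0 -> (0 < l)%N ->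
  (forall i, S (iter (m * i) f (iter (l * i) y u))) -> exists k, iter k f u = 0.
Proof.
move=> dS zu l0 Sx; apply: NNPP => nk.
have fk k : iter k f u != 0 by apply: contra_notN nk => /eqP; exists k.
apply: (dim_le_bound dS Sx (O := fun i => iter (l * i) z)) => [i|i j ij|i].
- exact: lin_iter.
- rewrite -iter_swap // heis_vanish ?(lin0 (lin_iter fL _)) //.
  by rewrite ltn_pmul2l.
- rewrite -iter_swap //; have [c c0 ->] := heis_pow (l * i) zu.
  by rewrite (linZ (lin_iter fL _)) -iterD scaler_eq0 negb_or c0 fk.
Qed.

End HeisenbergTriple.

(** * Arrival from one end and departure towards the other *)

Section Mixed.
Context (F : closedFieldType) (char0 : forall k, k.+1%:R != 0 :> F).
Context (X : zmodType) (A : polyfun F X) (V : lmodType F).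
Context (sg : bool) (Gam : X -> Prop) (Vg : X -> V -> Prop) (E : X -> X -> A -> V -> V).
Context (HS : hop_system sg Gam Vg E).
Context (x : X) (Gx : Gam x) (x0 : x != 0).
Implicit Types (a b c d s t q y g : X) (f h e : A) (u v w : V).

Notation hop := (@hop F X A sg Gam).
Notation tauA := (tau A).

Let GG := hs_grp HS.
Let tf := hs_tors_free HS.
Let EL a b f (hf : hop a b f) := E_lin HS hf.

Section OneEnd.
Context (fresh_line : forall (s : seq X) c, exists m, Gam (m - c) /\
  forall y k l, y \in s -> y + x *+ k != m + x *+ l).

(* A particle that can escape along [x] can, after a sideways hop to a line on which
   nothing happens, also escape along [- x]. *)
Lemma mixed_impossible : (forall u, u != 0 -> ~ ray_out sg Gam E x u) ->
  (forall u, ray_out sg Gam E (- x) u) -> False.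
Proof.
move=> Hout Hnout; have [g [v [vg v0]]] := homogeneous_nonzero HS.
have [a [c acP]] := ray_outN (Hout v v0).
have [s sP] := E_fin HS g Gx x0.
(* The new line avoids 0, the source [a], the old ray and all sites where a hop by [x] acts on
   [Vg g]. *)
have [m [Gmc mP]] := fresh_line ([:: 0; a; c] ++ s) c.
have mc : m - c != 0.
  by rewrite subr_eq0 eq_sym; have := mP c 0%N 0%N; rewrite !mulr0n !addr0; apply; rewrite !inE eqxx !orbT.
have Gcm : Gam (c - m) by rewrite -opprB; apply: (subgN GG).
have cm : c - m != 0 by rewrite -opprB oppr_eq0.
have [s' s'P] := E_fin HS g Gcm cm.
have [N NP] := ray_avoid m s' tf x0; have [N' N'P] := ray_avoid c [:: 0] tf x0.
have [k [f [Nk hf fv0]]] := acP (maxn N N').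
move: Nk; rewrite geq_max => /andP[Nk N'k].
set q := c + x *+ k in hf fv0; set t := m + x *+ k.
pose r j := t + (- x) *+ j.
have rP y j : y \in [:: 0; a; c] ++ s -> y != r j.
  move=> /(mP y j k); apply: contraNneq => ->.
  by rewrite /r mulNrn subrK.
have r0 j : r j != 0 by rewrite eq_sym; apply: rP; rewrite mem_head.
have ra j : a != r j by apply: rP; rewrite !inE eqxx !orbT.
have rs j : r j \notin s.
  by apply/negP => rjs; have := rP (r j) j; rewrite mem_cat rjs orbT eqxx => /(_ isT).
have q0 : q != 0 by have := N'P k N'k; rewrite inE.
have Gr i j : Gam (r i - r j) by apply: (ray_Gam HS); apply: (subgN GG).
have rt : r 0%N = t by rewrite /r mulr0n addr0.
have tq : q = t + (c - m) by rewrite /q /t [RHS]addrAC [m + _]addrC subrK.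
have Gtq : Gam (t - q) by rewrite tq opprD addrA subrr sub0r; apply: (subgN GG).
have Gqt : Gam (q - t) by rewrite -opprB; apply: (subgN GG).
have tqn : t != q by rewrite -subr_eq0 tq opprD addrA subrr sub0r oppr_eq0.
have ht : hop a t f.
  by rewrite -rt; apply: (hop_retarget HS hf) => //; rewrite rt.
have htq : hop t q 1 by apply: hop_site => //; rewrite -rt.
(* The sideways hop [t -> q] kills [v], so the nonzero hop onto [q] factors through the hop onto
   [t]. *)
have ftv : E a t f v != 0.
  apply: contraNneq fv0 => ft0; have aq : a != q by case: hf.
  have := E_unit_comp HS v ht htq aq; rewrite ft0 (lin0 (EL htq)).
  have -> : E t q 1 v = 0.
    by move: htq; rewrite tq => htq; apply: s'P htq vg _; apply: NP.
  by rewrite (lin0 (EL ht)) add0r => <-.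
(* Going down the line by unit hops that kill [v], the hop off [a] remains nonzero arbitrarily far
   along [- x]. *)
have fr j : hop a (r j) f /\ E a (r j) f v != 0.
  elim: j => [|j [hj fj]]; first by rewrite rt.
  have hj1 : hop a (r j.+1) f by apply: (hop_retarget HS hj).
  split=> //; have rr : r j = r j.+1 + x by rewrite /r mulrSr addrA subrK.
  have hr : hop (r j.+1) (r j) 1.
    by apply: hop_site => //; rewrite eq_sym -subr_eq0 {1}rr addrAC subrr add0r.
  apply: contraNneq fj => f0; have := E_unit_comp HS v hj1 hr (ra j).
  rewrite f0 (lin0 (EL hr)); have -> : E (r j.+1) (r j) 1 v = 0.
    by move: hr; rewrite rr => hr; apply: sP hr vg (rs _).
  by rewrite (lin0 (EL hj1)) add0r => <-.
have [M MP] := Hnout v a t.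
by have [hM fM] := fr M; rewrite MP ?eqxx in fM.
Qed.

End OneEnd.

Section TwoEnds.
Context (Hout : forall u, ray_out sg Gam E x u) (Hin : forall u, ray_in sg Gam E (- x) u).

Lemma iter_deg a b f n g u : hop a b f -> Vg g u ->
  Vg ((b - a) *+ n + g) (iter n (E a b f) u).
Proof.
move=> hf ug; elim: n => [|n IHn]; first by rewrite mulr0n add0r.
by rewrite mulrS -addrA; apply: (E_deg HS hf).
Qed.

(* With [c] far away, [E a b f] is the bracket of the hops [a -> c] and [c -> b], the first
   of which kills [v]; the powers of the second bring the powers of [E a b f] back to [Vg g]. *)
Lemma right_hop_nilpotent a l f g v : hop a (a + x *+ l) f -> Vg g v ->
  exists k, iter k (E a (a + x *+ l) f) v = 0.
Proof.
set b := a + x *+ l => hf vg.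
have l0 : (0 < l)%N.
  by rewrite lt0n; apply: contraTneq (hop_neq0 hf) => l0; rewrite /b l0 mulr0n addr0 subrr eqxx.
have [N NP] := Hout v a b; have [M MP] := ray_avoid b [:: 0; a; b] tf x0.
pose m := maxn N M; have [Nm Mm] : (N <= m)%N /\ (M <= m)%N by rewrite /m !leq_max !leqnn !orbT.
have := MP m Mm; rewrite !inE !negb_or; set c := b + x *+ m => /and3P[c0 ca cb].
have Gca : Gam (c - a).
  by rewrite /c /b addrAC [a + _]addrC addrK; apply: (subgD GG); apply: (subgMn GG).
have [f1 [f2 [h1 h2 _ fE]]] := E_split HS hf c0 ca cb Gca.
have [d dg] := hs_dim HS g; have ab : a != b by case: hf.
have bc : b != c by rewrite eq_sym.
(* [y] shifts degrees by [- (x *+ m)] and [f] by [x *+ l]; the exponents [l * i] and [m * i] make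
   the shifts cancel. *)
apply: (heis_nilpotent char0 (y := E c b f1) (z := E a c f2) (m := m) (l := l)
  (EL hf) (EL h1) (EL h2) _ _ _ dg) => // [u|u|u||i].
- by rewrite (E_comm0 HS) // 1?eq_sym.
- by rewrite (E_comm0 HS) // 1?eq_sym.
- by rewrite fE addrC subrK.
- exact: NP.
have := iter_deg (m * i) hf (iter_deg (l * i) h1 vg); congr (Vg _ _).
rewrite addrA -[RHS]add0r; congr (_ + _).
rewrite /c opprD addrA subrr sub0r /b [a + _]addrC addrK mulNrn -!mulrnA.
by rewrite mulnCA subrr.
Qed.

Lemma uniform_bound (s : seq X) (P : X -> nat -> Prop) :
  (forall c, exists N, forall k, (N <= k)%N -> P c k) ->
  exists N, forall c k, c \in s -> (N <= k)%N -> P c k.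
Proof.
move=> PN; elim: s => [|c s [N NP]]; first by exists 0%N.
have [M MP] := PN c; exists (maxn N M) => d k; rewrite inE geq_max => /orP[/eqP->|ds] /andP[Nk Mk].
  exact: MP.
exact: NP.
Qed.

Definition right_bounded n v := forall a k f, (n <= k)%N -> hop a (a + x *+ k) f ->
  E a (a + x *+ k) f v = 0.

(** [Hout] and [Hin] give bounds that depend on the site. A hop whose path misses [G] is a chain of
    idle neighbouring hops; otherwise it splits at a site of [G], unless one of its ends is within
    [N] steps of that site, and such ends are finitely many. *)
Lemma right_bounded_exists g v : Vg g v -> exists n, right_bounded n v.
Proof.
move=> vg; have [s sP] := E_fin HS g Gx x0.
(* 0 cannot serve as a splitting site; a path of positive length through 0 meets [x] or [- x]
   instead. *)
pose G := [:: x, - x & [seq c <- s | c != 0]].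
pose P c k := (forall f, hop c (c + x *+ k) f -> E c (c + x *+ k) f v = 0) /\
  (forall f, hop (c + (- x) *+ k) c f -> E (c + (- x) *+ k) c f v = 0).
have PN c : exists N, forall k, (N <= k)%N -> P c k.
  have [N NP] := Hout v c c; have [M MP] := Hin v c c; exists (maxn N M) => k.
  by rewrite geq_max => /andP[Nk Mk]; split=> f; [apply: NP|apply: MP].
have [N NP] := uniform_bound G PN.
pose G' := [seq c + (- x) *+ j | c <- G, j <- iota 0 N.+1] ++
           [seq c + x *+ j | c <- G, j <- iota 0 N.+1].
have [N' N'P] := uniform_bound G' PN.
have shift c a j : c = a + x *+ j -> a = c + (- x) *+ j by move=> ->; rewrite mulNrn addrK.
exists (maxn 1 N') => a k f; rewrite geq_max => /andP[k0 N'k] hf.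
have [[j [jk cG]]|nj] := classic (exists j, (j <= k)%N /\ a + x *+ j \in G); last first.
  have nz i : (i <= k)%N -> a + x *+ i != 0.
    move=> ik; apply/negP => /eqP z; apply: nj; case: (ltnP i k) => [ik'|ki].
      by exists i.+1; rewrite mulrSr addrA z add0r mem_head.
    exists i.-1; split; first by lia.
    have i0 : i = i.-1.+1 by lia.
    have -> : a + x *+ i.-1 = - x; last by rewrite !inE eqxx orbT.
    by apply/eqP; rewrite -addr_eq0 -addrA -mulrSr -i0 z.
  suff : forall f, hop (a + x *+ 0) (a + x *+ k) f -> E (a + x *+ 0) (a + x *+ k) f v = 0.
    by rewrite mulr0n addr0; apply.
  apply: (E_chain HS (q := fun i => a + x *+ i) (n := k)) => //.
  - by move=> i j _ _ /(ray_inj HS x0).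
  - by move=> i j; apply: (ray_Gam HS).
  move=> i h ik; rewrite mulrSr addrA => hh; apply: (sP _ _ _ hh vg).
  apply/negP => is_s; apply: nj; exists i; split; first exact: ltnW.
  by rewrite !inE mem_filter is_s nz ?orbT // ltnW.
set c := a + x *+ j in cG; have aE : a = c + (- x) *+ j by apply: shift.
have bE : a + x *+ k = c + x *+ (k - j) by rewrite /c -addrA -mulrnDr subnKC.
have abE : a = a + x *+ k + (- x) *+ k by apply: shift.
have [jN|Nj] := leqP j N.
  have aG : a \in G'.
    rewrite mem_cat; apply/orP; left; rewrite aE; apply/allpairsP; exists (c, j).
    by rewrite mem_iota; split.
  exact: (proj1 (N'P a k aG N'k)).
have [kjN|Nkj] := leqP (k - j) N.
  have bG : a + x *+ k \in G'.
    rewrite mem_cat; apply/orP; right; rewrite bE; apply/allpairsP; exists (c, (k - j)%N).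
    by rewrite mem_iota; split.
  by move: hf; rewrite {1 3}abE; apply: (proj2 (N'P _ k bG N'k)).
have c0 : c != 0.
  move: cG; rewrite !inE mem_filter => /or3P[/eqP->|/eqP->|/andP[]//] //.
  by rewrite oppr_eq0.
have ca : c != a.
  by apply/eqP; rewrite /c -[RHS]addr0 -(mulr0n x) => /(ray_inj HS x0); lia.
have cb : c != a + x *+ k by apply/eqP => /(ray_inj HS x0); lia.
have Gca : Gam (c - a) by rewrite /c addrC addKr; apply: (subgMn GG).
have [f1 [f2 [h1 h2 _ ->]]] := E_split HS hf c0 ca cb Gca.
have -> : E a c f2 v = 0.
  by move: h2; rewrite aE; apply: (proj2 (NP c j cG (ltnW Nj))).
have -> : E c (a + x *+ k) f1 v = 0.
  by move: h1; rewrite bE; apply: (proj1 (NP c (k - j)%N cG (ltnW Nkj))).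
by rewrite (lin0 (EL h1)) (lin0 (EL h2)) subrr.
Qed.

Lemma shift_inj a k : a + x *+ k = a -> k = 0%N.
Proof. by rewrite -[RHS]addr0 -(mulr0n x) => /(ray_inj HS x0). Qed.

(** Their commutator consists of hops by [k + l] steps, which kill [v]. *)
Lemma right_hops_comm n a k f b l h v : right_bounded n v -> (n <= k + l)%N ->
  hop a (a + x *+ k) f -> hop b (b + x *+ l) h ->
  E a (a + x *+ k) f (E b (b + x *+ l) h v) = E b (b + x *+ l) h (E a (a + x *+ k) f v).
Proof.
move=> vn nkl hf hh; have [ak _ _] := hf; have [bl _ _] := hh.
have k0 : k != 0%N by apply: contraNneq ak => ->; rewrite mulr0n addr0.
have l0 : l != 0%N by apply: contraNneq bl => ->; rewrite mulr0n addr0.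
apply/eqP; rewrite -subr_eq0 (E_comm HS) //; last first.
  apply/eqP => -[bE]; rewrite bE -addrA -mulrnDr => /shift_inj; lia.
have -> : (if b + x *+ l == a then
    E b (a + x *+ k) (tauA (b + x *+ l - b) f * h) v else 0) = 0.
  case: eqP => // ba; move: hf; rewrite -ba => hf.
  have bk : b != b + x *+ l + x *+ k.
    by apply/eqP; rewrite -addrA -mulrnDr => /esym/shift_inj; lia.
  have := hop_comp GG hh hf bk; rewrite -addrA -mulrnDr => hc.
  by apply: vn hc; rewrite addnC.
have [ab|_] := eqVneq (a + x *+ k) b; last by rewrite subrr.
move: hh; rewrite -ab => hh.
have bk : a != a + x *+ k + x *+ l.
  by apply/eqP; rewrite -addrA -mulrnDr => /esym/shift_inj; lia.
have := hop_comp GG hf hh bk; rewrite -[in X in hop _ X]addrA -mulrnDr => hc.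
by rewrite sub0r oppr_eq0 -addrA -mulrnDr; apply/eqP; apply: vn hc.
Qed.

Lemma right_bounded_hop n b l h v : right_bounded n v -> hop b (b + x *+ l) h ->
  right_bounded n (E b (b + x *+ l) h v).
Proof.
move=> vn hh a k f nk hf; rewrite (right_hops_comm vn) ?(leq_trans nk) ?leq_addr //.
by rewrite vn // (lin0 (EL hh)).
Qed.

(** [M] is a product of maximal nonvanishing powers of the given operators. All hops of [n] steps
    commute here, since [n + n] exceeds [n]. *)
Lemma kill_hops n (N : nat) (ops : nat -> X * A) g v : (0 < n)%N -> Vg g v -> v != 0 ->
  right_bounded n.+1 v ->
  (forall i, (i < N)%N -> hop (ops i).1 ((ops i).1 + x *+ n) (ops i).2) ->
  exists M g', [/\ lin M, Vg g' (M v), M v != 0 & right_bounded n.+1 (M v)] /\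
    (forall a f, hop a (a + x *+ n) f ->
       E a (a + x *+ n) f (M v) = M (E a (a + x *+ n) f v)) /\
    (forall i, (i < N)%N -> E (ops i).1 ((ops i).1 + x *+ n) (ops i).2 (M v) = 0).
Proof.
move=> n0 vg v0 vn; elim: N => [|N IHN] opsP; first by exists id, g.
have [i iN|M [g' [[ML Mg M0 Mn] [MC MZ]]]] := IHN; first by apply/opsP/leqW.
have hN := opsP N (leqnn _); set a := (ops N).1 in hN; set f := (ops N).2 in hN.
set Y := E a (a + x *+ n) f.
have [k Yk] : exists k, iter k Y (M v) = 0 by apply: right_hop_nilpotent hN Mg.
have [m [Ym Ym1]] : exists m, iter m Y (M v) != 0 /\ iter m.+1 Y (M v) = 0.
  elim: k Yk => [|k IHk] Yk; first by rewrite /= in Yk; rewrite Yk eqxx in M0.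
  by have [/IHk//|Yk0] := eqVneq (iter k Y (M v)) 0; exists k.
have iter_n i : right_bounded n.+1 (iter i Y (M v)).
  by elim: i => //= i IHi; apply: right_bounded_hop.
have iter_C i b h : hop b (b + x *+ n) h ->
    E b (b + x *+ n) h (iter i Y (M v)) = iter i Y (E b (b + x *+ n) h (M v)).
  move=> hb; elim: i => //= i <-; rewrite (right_hops_comm (iter_n i)) //; lia.
exists (fun u => iter m Y (M u)), ((a + x *+ n - a) *+ m + g').
have YL : lin (iter m Y) by apply: (lin_iter (EL hN)).
split; first by split=> //; [apply: lin_comp|apply: iter_deg].
split=> [b h hb|i]; first by rewrite iter_C // MC.
rewrite ltnS leq_eqVlt => /orP[/eqP->|iN]; first exact: Ym1.
by rewrite iter_C ?MZ ?(lin0 YL) //; apply/opsP/leqW.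
Qed.

(** The images of [v] under hops of [n] steps lie in one graded piece, so finitely many of them
    span. When the corresponding hops kill [M v], all do, because [M] commutes with them. *)
Lemma right_bounded_pred n g v : (0 < n)%N -> Vg g v -> v != 0 -> right_bounded n.+1 v ->
  exists g' v', [/\ Vg g' v', v' != 0 & right_bounded n v'].
Proof.
move=> n0 vg v0 vn.
pose S u := exists a f, hop a (a + x *+ n) f /\ u = E a (a + x *+ n) f v.
have [d dS] := hs_dim HS (x *+ n + g).
have SV u : S u -> Vg (x *+ n + g) u.
  move=> [a [f [hf ->]]]; have := E_deg HS hf vg.
  by rewrite [a + _]addrC addrK.
have [N [y [yS ySp]]] := dim_le_spanning (dim_le_sub SV dS).
have opX i : exists op : X * A, (i < N)%N -> hop op.1 (op.1 + x *+ n) op.2 /\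
    y i = E op.1 (op.1 + x *+ n) op.2 v.
  have [iN|iN] := ltnP i N; last by exists (0, 0).
  by have [a [f [hf yE]]] := yS i iN; exists (a, f).
pose ops i := sval (constructive_indefinite_description _ (opX i)).
have opsP i : (i < N)%N -> hop (ops i).1 ((ops i).1 + x *+ n) (ops i).2 /\
    y i = E (ops i).1 ((ops i).1 + x *+ n) (ops i).2 v.
  by rewrite /ops; case: constructive_indefinite_description.
have [i /opsP[]//|M [g' [[ML Mg M0 Mn] [MC MZ]]]] := @kill_hops n N ops g v n0 vg v0 vn.
exists g', (M v); split=> // a k f; rewrite leq_eqVlt => /orP[/eqP<-|]; last exact: Mn.
move=> hf; rewrite MC //; have [|c ->] := ySp (E a (a + x *+ n) f v); first by exists a, f.
rewrite (lin_sum ML) big1 // => i _; rewrite (linZ ML).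
have [hi ->] := opsP i (ltn_ord i).
by rewrite -MC // MZ // scaler0.
Qed.

Lemma highest_vector : exists g v, [/\ Vg g v, v != 0 & right_bounded 1 v].
Proof.
have [g [v [vg v0]]] := homogeneous_nonzero HS.
have [n vn] := right_bounded_exists vg.
have {}vn : right_bounded n.+1 v by move=> a k f nk; apply: vn; apply: ltnW.
elim: n g v vg v0 vn => [|n IHn] g v vg v0 vn; first by exists g, v.
have [//|g' [v' [vg' v0' vn']]] := right_bounded_pred _ vg v0 vn.
exact: IHn vg' v0' vn'.
Qed.

End TwoEnds.

End Mixed.

(** * Duality and classification *)

Section Duality.
Context (F : closedFieldType) (X : zmodType) (A : polyfun F X) (V : lmodType F).

(* The negative of the anti-automorphism t^b p(D) |-> t^b p(- D - b). *)
Definition dual_op (T : X -> A -> V -> V) b p v := - T b (tau A b (rho A p)) v.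

Definition flip (b : X) (p : A) : A := tau A b (rho A p).

Lemma flipK b p : flip b (flip b p) = p.
Proof. by rewrite /flip rho_tau tauD addrN tau0 rhoK. Qed.

Lemma flip_lin b (c : F) p q : flip b (c *: p + q) = c *: flip b p + flip b q.
Proof. by rewrite /flip rmorphD /= rhoZ rmorphD /= tauZ. Qed.

Lemma flipM b p q : flip b (p * q) = flip b p * flip b q.
Proof. by rewrite /flip !rmorphM. Qed.

Lemma ev_flip a b p : ev A a (flip b p) = ev A (- (a + b)) p.
Proof. by rewrite ev_tau ev_rho. Qed.

Lemma allowed_flip sg b p : allowed (~~ sg) b p -> allowed sg b (flip b p).
Proof. by rewrite /allowed ev_flip; case: sg => /=; rewrite ?addNr ?oppr0 ?add0r. Qed.

Lemma allowed_tau sg a b p q : allowed sg a p -> allowed sg b q ->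
  allowed sg (a + b) (tau A b p * q).
Proof.
rewrite /allowed rmorphM /= ev_tau; case: sg => [okp _|_ ->]; last by rewrite mulr0.
by rewrite opprD addrNK okp mul0r.
Qed.

Lemma flip_bracket a b p q :
  tau A b (flip a p) * flip b q - tau A a (flip b q) * flip a p
  = - flip (a + b) (tau A b p * q - tau A a q * p).
Proof.
rewrite /flip rmorphB !rmorphM rmorphB !rmorphM /= !rho_tau !tauD opprB.
rewrite addrK [b + a]addrC; have -> : a + b - a = b by rewrite addrAC subrr add0r.
by congr (_ - _); apply: mulrC.
Qed.

Context (sg : bool) (Gam : X -> Prop) (Vg : X -> V -> Prop) (T : X -> A -> V -> V).
Context (WM : weyl_module sg Gam Vg T).

Let GG := Gam_grp WM.

Lemma dual_weyl_module : weyl_module (~~ sg) Gam Vg (dual_op T).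
Proof.
have allowed_br s a b p q : allowed s a p -> allowed s b q ->
    allowed s (a + b) (tau A b p * q - tau A a q * p).
  move=> okp okq; apply: okB; first exact: allowed_tau.
  by rewrite addrC; apply: allowed_tau.
have T_N b p v : Gam b -> allowed sg b p -> T b (- p) v = - T b p v by move=> *; apply: (T_oppp WM).
split; [exact: (tors_free WM)|exact: (Gam_grp WM)| | | | |exact: (Vg_sub WM)|
  exact: (Vg_dim WM)|exact: (Vg_span WM)| | |exact: (V_nonzero WM)].
- by move=> b p; apply: (lin_opp (T_lin WM _ _)).
- move=> b c p q v Gb okp okq; rewrite /dual_op -!/(flip _ _) flip_lin (T_linp WM) //;
    try exact: allowed_flip.
  by rewrite opprD scalerN.
- move=> a b p q v Ga Gb okp okq ab; rewrite /dual_op -!/(flip _ _).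
  rewrite !(linN (T_lin WM _ _)) !opprK (T_br WM) //; try exact: allowed_flip.
  rewrite flip_bracket T_N //; first exact: (subgD GG).
  by apply: allowed_flip; apply: allowed_br.
- move=> a p q Ga a0 okp okq.
  have [l lP] := T_br0 WM Ga a0 (allowed_flip okp) (allowed_flip okq).
  exists l => v; rewrite /dual_op -!/(flip _ _) !(linN (T_lin WM _ _)) !opprK lP.
  congr (_ + _); rewrite flip_bracket addrN T_N //; first exact: (subg0 GG).
  by apply: allowed_flip; rewrite -(addrN a); apply: allowed_br.
- move=> b p g v Gb okp vg; apply: (subspaceN (Vg_sub WM _)).
  by apply: (T_deg WM) => //; apply: allowed_flip.
- move=> S SS ST; apply: (T_irr WM SS) => b p v Gb okp Sv.
  have -> : T b p v = - dual_op T b (flip b p) v.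
    by rewrite /dual_op -/(flip _ _) flipK opprK.
  apply: (subspaceN SS); apply: ST => //; apply: allowed_flip.
  by rewrite negbK.
Qed.

(** Transposition: the arrow from [a] to [b] becomes one from [- b] to [- a]. Hops onto and off far
    sites are exchanged, as are the directions [x] and [- x]. *)
Lemma dual_hop a b f : hop (~~ sg) Gam a b f -> hop sg Gam (- b) (- a) (flip (b - a) f).
Proof.
move=> [ab Gab fa]; split.
- by rewrite eqr_opp eq_sym.
- by rewrite opprK addrC.
- rewrite ev_flip addrA addNr add0r opprK; move: fa; rewrite !oppr_eq0.
  by case: (sg).
Qed.

Lemma dual_bump b a L e : bump (killer (~~ sg) Vg (dual_op T) b L) a e ->
  bump (killer sg Vg T b L) (- (a + b)) (flip b e).
Proof.
have locP s r : loc (killer (~~ sg) Vg (dual_op T) b L) (- (s + b)) r ->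
    loc (killer sg Vg T b L) s (flip b r).
  move=> [u u0 [oku Ku]]; exists (flip b u); first by rewrite ev_flip.
  rewrite -flipM; split=> [|g gL v vg]; first exact: allowed_flip.
  by have /eqP := Ku g gL v vg; rewrite oppr_eq0 => /eqP.
move=> [e1 e0]; split=> [|s sa].
  have -> : 1 - flip b e = flip b (1 - e) by rewrite /flip rmorphB rmorphB !rmorph1.
  by apply: locP; rewrite opprD opprK addrK.
apply/locP/e0; apply: contraNneq sa => <-.
by rewrite opprD opprK addrK.
Qed.

Lemma dual_hop_op a b f v : hop (~~ sg) Gam a b f ->
  hop_op (~~ sg) Vg (dual_op T) a b f v = - hop_op sg Vg T (- b) (- a) (flip (b - a) f) v.
Proof.
move=> hf; have DM := dual_weyl_module; have [L vL] := hsum_exists WM v.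
have b0 := hop_neq0 hf; have Gab := hop_Gam hf.
have [e eP /(_ v vL)[-> _]] :=
  bump_for DM L hf (killer_ideal DM L Gab b0) (killer_algebraic DM L Gab b0).
have hg := dual_hop hf.
have disp : - a - - b = b - a by rewrite opprK addrC.
rewrite (E_bump WM (e := flip (b - a) e) hg); last first.
  by exists L; rewrite ?disp //; have := dual_bump eP; rewrite [a + _]addrC subrK.
by rewrite disp /dual_op -/(flip _ _) flipM.
Qed.

Lemma hop_dual a b f : hop sg Gam a b f -> hop (~~ sg) Gam (- b) (- a) (flip (b - a) f).
Proof.
move=> [ab Gab fa]; split.
- by rewrite eqr_opp eq_sym.
- by rewrite opprK addrC.
- by rewrite ev_flip addrA addNr add0r opprK; move: fa; rewrite !oppr_eq0; case: (sg).
Qed.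

Lemma hop_op_dual a b f v : hop sg Gam a b f ->
  hop_op sg Vg T a b f v = - hop_op (~~ sg) Vg (dual_op T) (- b) (- a) (flip (b - a) f) v.
Proof.
move=> hf; have disp : - a - - b = b - a by rewrite opprK addrC.
by rewrite (dual_hop_op _ (hop_dual hf)) disp flipK !opprK.
Qed.

Lemma ray_in_dual y v : ray_in sg Gam (hop_op sg Vg T) y v <->
  ray_out (~~ sg) Gam (hop_op (~~ sg) Vg (dual_op T)) (- y) v.
Proof.
split=> R a c.
  have [N NP] := R (- a) (- c); exists N => k f Nk hf; rewrite dual_hop_op //.
  have := dual_hop hf; rewrite mulNrn opprD opprK => hg.
  by rewrite (NP k) ?oppr0.
have [N NP] := R (- a) (- c); exists N => k f Nk hf; rewrite hop_op_dual //.
have := hop_dual hf; rewrite opprD -mulNrn => hg.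
by rewrite (NP k) ?oppr0.
Qed.

Lemma ray_out_dual y v : ray_out sg Gam (hop_op sg Vg T) y v <->
  ray_in (~~ sg) Gam (hop_op (~~ sg) Vg (dual_op T)) (- y) v.
Proof.
split=> R a c.
  have [N NP] := R (- a) (- c); exists N => k f Nk hf; rewrite dual_hop_op //.
  have := dual_hop hf; rewrite mulNrn opprD opprK => hg.
  by rewrite (NP k) ?oppr0.
have [N NP] := R (- a) (- c); exists N => k f Nk hf; rewrite hop_op_dual //.
have := hop_dual hf; rewrite opprD -mulNrn => hg.
by rewrite (NP k) ?oppr0.
Qed.

End Duality.

(** * Case distinction on two opposite directions *)

Section Classification.
Context (F : closedFieldType) (char0 : forall k, k.+1%:R != 0 :> F).
Context (X : zmodType) (A : polyfun F X) (V : lmodType F).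

(** Degree 0 is left aside because of the possible scalar; [particle_all] adds it when the brackets
    are exact. *)
Definition particle (sg : bool) (Gam : X -> Prop) (T : X -> A -> V -> V) (q : X) (Y : X -> V) :=
  [/\ q != 0, Y 0 = 0, Y q != 0,
    forall b p d, Gam b -> b != 0 -> allowed sg b p -> d != 0 -> Gam (d - q) ->
      T b p (Y d) = ev A d p *: Y (d + b)
  & forall v (U : V -> Prop), subspace U -> (forall d, Gam (d - q) -> U (Y d)) -> U v].

Definition no_action (sg : bool) (Gam : X -> Prop) (T : X -> A -> V -> V) :=
  forall b p v, Gam b -> b != 0 -> allowed sg b p -> T b p v = 0.

Section Fixed.
Context (sg : bool) (Gam : X -> Prop) (Vg : X -> V -> Prop) (T : X -> A -> V -> V).
Context (WM : weyl_module sg Gam Vg T).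

Let GG := Gam_grp WM.

Section Direction.
Context (x : X) (Gx : Gam x) (x0 : x != 0).

Let HS := weyl_hop_system WM Gx x0.
Notation hop_op := (hop_op sg Vg T).

Lemma particle_exists :
  (forall u, u != 0 -> ~ ray_out sg Gam hop_op x u) ->
  (forall u, ray_in sg Gam hop_op (- x) u) -> exists q Y, particle sg Gam T q Y.
Proof.
move=> Hout Hin; have [q [Y [q0 Y0 Yq YE Ysp]]] := one_particle_basis HS Gx x0 Hout Hin.
exists q, Y; split=> // b p d Gb b0 okp d0 Gd.
have [s [sU sZ ->]] := T_sumE WM (Y d) Gb b0 okp.
have EE a : hop_op a (a + b) p (Y d) = if a == d then ev A d p *: Y (d + b) else 0.
  by rewrite YE //; [case: eqP => // ->|apply: hop_allowed okp].
have [ds|nds] := boolP (d \in s).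
  rewrite (bigD1_seq d) //= EE eqxx big1 ?addr0 // => a ad.
  by rewrite EE (negPf ad).
rewrite big_seq big1 => [|a as_]; last first.
  by rewrite EE; case: eqP => // ad; rewrite -ad as_ in nds.
by have := sZ d nds; rewrite EE eqxx.
Qed.

Lemma no_hops_no_action : (forall a b f v, hop sg Gam a b f -> hop_op a b f v = 0) ->
  no_action sg Gam T.
Proof.
move=> E0 b p v Gb b0 okp; have [s [_ _ ->]] := T_sumE WM v Gb b0 okp.
by rewrite big1 // => a _; apply: E0; apply: hop_allowed okp.
Qed.

Lemma highest_T : (forall u, ray_out sg Gam hop_op x u) ->
  (forall u, ray_in sg Gam hop_op (- x) u) ->
  exists g w, [/\ Vg g w, w != 0 & forall k p, allowed sg (x *+ k.+1) p -> T (x *+ k.+1) p w = 0].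
Proof.
move=> Hout Hin; have [g [w [wg w0 wP]]] := highest_vector char0 HS Gx x0 Hout Hin.
exists g, w; split=> // k p okp.
have Gk : Gam (x *+ k.+1) by apply: (subgMn GG).
have k0 : x *+ k.+1 != 0 by apply: contraNneq x0 => /(tors_free WM) ->.
have [s [_ _ ->]] := T_sumE WM w Gk k0 okp.
by rewrite big1 // => a _; apply: wP => //; apply: hop_allowed.
Qed.

End Direction.
End Fixed.

Section Cases.
Context (sg : bool) (Gam : X -> Prop) (Vg : X -> V -> Prop) (T : X -> A -> V -> V).
Context (WM : weyl_module sg Gam Vg T).

Let GG := Gam_grp WM.

Definition mixed (x : X) := [/\ forall u, ray_out sg Gam (hop_op sg Vg T) x u,
  forall u, ray_in sg Gam (hop_op sg Vg T) (- x) u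
  & forall u, u != 0 -> ~ ray_out sg Gam (hop_op sg Vg T) (- x) u].

(* In each of the directions [x] and [- x], exactly one of "particles escape" and
   "particles enter" holds unless the action is trivial. *)
Lemma direction_cases x : Gam x -> x != 0 ->
  no_action sg Gam T \/ (exists q Y, particle sg Gam T q Y) \/
  (exists q Y, particle (~~ sg) Gam (dual_op T) q Y) \/ mixed x \/ mixed (- x).
Proof.
move=> Gx x0; have HS := weyl_hop_system WM Gx x0.
have GN : Gam (- x) by apply: (subgN GG).
have N0 : - x != 0 by rewrite oppr_eq0.
have out_dich y : y != 0 -> (forall u, ray_out sg Gam (hop_op sg Vg T) y u) \/
    (forall u, u != 0 -> ~ ray_out sg Gam (hop_op sg Vg T) y u).
  move=> y0; have [[u [u0 uP]]|nu] := classic (exists u, u != 0 /\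
      ray_out sg Gam (hop_op sg Vg T) y u).
    by left; apply: (ray_out_all HS y0 u0 uP).
  by right=> u u0 uP; apply: nu; exists u.
have in_dich y : y != 0 -> (forall u, ray_in sg Gam (hop_op sg Vg T) y u) \/
    (forall u, u != 0 -> ~ ray_in sg Gam (hop_op sg Vg T) y u).
  move=> y0; have [[u [u0 uP]]|nu] := classic (exists u, u != 0 /\
      ray_in sg Gam (hop_op sg Vg T) y u).
    by left; apply: (ray_in_all HS y0 u0 uP).
  by right=> u u0 uP; apply: nu; exists u.
have [ox|ox] := out_dich _ x0; have [ix|ix] := in_dich _ x0.
- by left; apply: (no_hops_no_action WM); apply: (no_rays_trivial HS Gx x0).
- have [oN|oN] := out_dich _ N0; have [iN|iN] := in_dich _ N0.
  + by left; apply: (no_hops_no_action WM); apply: (no_rays_trivial HS GN N0).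
  (* Far hops only leave their sites, in both directions; duality turns them into hops onto far
     sites. *)
  + right; right; left; apply: (particle_exists (x := - x) (dual_weyl_module WM) GN N0).
      by move=> u u0 /(ray_in_dual WM x)/ix; apply.
    by move=> u; rewrite -ray_out_dual.
  + by right; right; right; left; split.
  + by case: (no_out_in HS GN N0 oN iN).
- have [oN|oN] := out_dich _ N0; have [iN|iN] := in_dich _ N0.
  + by left; apply: (no_hops_no_action WM); apply: (no_rays_trivial HS GN N0).
  + by right; right; right; right; split; rewrite ?opprK.
  + by right; left; apply: (particle_exists WM Gx x0).
  + by case: (no_out_in HS GN N0 oN iN).
- by case: (no_out_in HS Gx x0 ox ix).
Qed.

Lemma classification x : Gam x -> x != 0 ->
  no_action sg Gam T \/ (exists q Y, particle sg Gam T q Y) \/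
  (exists q Y, particle (~~ sg) Gam (dual_op T) q Y) \/
  exists y g w, [/\ y = x \/ y = - x, Vg g w, w != 0
    & forall k p, allowed sg (y *+ k.+1) p -> T (y *+ k.+1) p w = 0].
Proof.
move=> Gx x0; have GN : Gam (- x) by apply: (subgN GG).
have N0 : - x != 0 by rewrite oppr_eq0.
have [|[|[|[[o i _]|[o i _]]]]] := direction_cases Gx x0; [by left|by right; left|by right; right; left| |].
  have [g [w [wg w0 wP]]] := highest_T WM Gx x0 o i.
  by right; right; right; exists x, g, w; split=> //; left.
have [g [w [wg w0 wP]]] := highest_T WM GN N0 o i.
by right; right; right; exists (- x), g, w; split=> //; right.
Qed.

Lemma classification_one_end x : Gam x -> x != 0 ->
  (forall (s : seq X) c, exists m, Gam (m - c) /\ forall y (z : int), y \in s -> y - m != x *~ z) ->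
  no_action sg Gam T \/ (exists q Y, particle sg Gam T q Y) \/
  (exists q Y, particle (~~ sg) Gam (dual_op T) q Y).
Proof.
move=> Gx x0 fresh; have GN : Gam (- x) by apply: (subgN GG).
have N0 : - x != 0 by rewrite oppr_eq0.
have HS := weyl_hop_system WM Gx x0.
have line (s : seq X) c : exists m, Gam (m - c) /\
    forall y k l, y \in s -> y + x *+ k != m + x *+ l.
  have [m [Gm mP]] := fresh s c; exists m; split=> // y k l ys.
  apply: contraNneq (mP y (Posz l - Posz k) ys) => E0; apply/eqP.
  have -> : y = m + x *+ l - x *+ k by rewrite -E0 addrK.
  by rewrite addrAC [m + _]addrC addrK mulrzBr -!pmulrn.
have lineN (s : seq X) c : exists m, Gam (m - c) /\
    forall y k l, y \in s -> y + (- x) *+ k != m + (- x) *+ l.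
  have [m [Gm mP]] := line s c; exists m; split=> // y k l ys.
  apply: contraNneq (mP y l k ys) => E0; apply/eqP.
  have := congr1 (fun z => z + x *+ k + x *+ l) E0.
  by rewrite !mulNrn addrNK addrAC addrNK => ->.
have [|[|[|[[o i n]|[o i n]]]]] := direction_cases Gx x0; [by left|by right; left|by right; right| |].
  by case: (mixed_impossible HS GN N0 lineN n) => u; rewrite opprK.
by case: (mixed_impossible HS Gx x0 line) => // u u0; have := n u u0; rewrite opprK.
Qed.

End Cases.
End Classification.

(** * Operators of degree zero *)

Section DegreeZero.
Context (F : closedFieldType) (X : zmodType) (A : polyfun F X) (V : lmodType F).

Definition bracket (T : X -> A -> V -> V) a p r v := T a p (T (- a) r v) - T (- a) r (T a p v).

Definition bracket_symbol a (p r : A) := tau A (- a) p * r - tau A a r * p.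

Definition exact_brackets (sg : bool) (Gam : X -> Prop) (T : X -> A -> V -> V) :=
  forall a p r v, Gam a -> a != 0 -> allowed sg a p -> allowed sg (- a) r ->
    bracket T a p r v = T 0 (bracket_symbol a p r) v.

Lemma allowed_symbol sg a p r : allowed sg a p -> allowed sg (- a) r ->
  allowed sg 0 (bracket_symbol a p r).
Proof.
move=> okp okr; apply: okB; first by rewrite -(addrN a); apply: allowed_tau.
by rewrite -(addNr a); apply: allowed_tau.
Qed.

Lemma dual_bracket (T : X -> A -> V -> V) (TL : forall b p, lin (T b p)) a p r v :
  bracket (dual_op T) a p r v = bracket T a (flip a p) (flip (- a) r) v.
Proof. by rewrite /bracket /dual_op -!/(flip _ _) !(linN (TL _ _)) !opprK. Qed.

Lemma flip_symbol a (p r : A) :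
  bracket_symbol a (flip a p) (flip (- a) r) = - flip 0 (bracket_symbol a p r).
Proof. by rewrite /bracket_symbol flip_bracket addrN. Qed.

Section OneModule.
Context (sg : bool) (Gam : X -> Prop) (Vg : X -> V -> Prop) (T : X -> A -> V -> V).
Context (WM : weyl_module sg Gam Vg T).

Let GG := Gam_grp WM.

Lemma particle_bracket q Y a p r d : particle sg Gam T q Y -> Gam a -> a != 0 ->
  allowed sg a p -> allowed sg (- a) r -> d != 0 -> Gam (d - q) ->
  bracket T a p r (Y d) = ev A d (bracket_symbol a p r) *: Y d.
Proof.
move=> [q0 Y0 Yq YE _] Ga a0 okp okr d0 Gd; rewrite /bracket.
have GN : Gam (- a) by apply: (subgN GG).
have N0 : - a != 0 by rewrite oppr_eq0.
rewrite !YE // !(linZ (T_lin WM _ _)) /bracket_symbol rmorphB /= !rmorphM /= !ev_tau scalerBl.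
congr (_ - _).
(* A path through the site 0 contributes nothing since [Y 0 = 0]; the matching term of the symbol
   vanishes by the condition [allowed]. *)
- have [da|da] := eqVneq (d - a) 0.
    rewrite da Y0 (lin0 (T_lin WM _ _)) scaler0.
    have ad : a = d by apply/eqP; rewrite eq_sym -subr_eq0 da.
    move: okp okr; rewrite /allowed ad opprK; case: (sg) => h1 h2.
      by rewrite h2 mulr0 scale0r.
    by rewrite h1 mul0r scale0r.
  have Gda : Gam (d - a - q) by rewrite addrAC; apply: (subgB GG).
  by rewrite YE // subrK scalerA mulrC.
- have [da|da] := eqVneq (d + a) 0.
    rewrite da Y0 (lin0 (T_lin WM _ _)) scaler0.
    have ad : d = - a by apply/eqP; rewrite -addr_eq0 da.
    move: okp okr; rewrite /allowed ad; case: (sg) => h1 h2.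
      by rewrite h1 mulr0 scale0r.
    by rewrite h2 mul0r scale0r.
  have Gda : Gam (d + a - q) by rewrite addrAC; apply: (subgD GG).
  by rewrite YE // addrK scalerA mulrC.
Qed.

Lemma T0_exact x p v : Gam x -> x != 0 -> exact_brackets sg Gam T -> allowed sg 0 p ->
  exists p1 r1 p2 r2, [/\ [/\ allowed sg x p1, allowed sg (- x) r1, allowed sg x p2 &
    allowed sg (- x) r2], p = bracket_symbol x p1 r1 + bracket_symbol x p2 r2 &
    T 0 p v = bracket T x p1 r1 v + bracket T x p2 r2 v].
Proof.
move=> Gx x0 ex okp; have [p1 [r1 [p2 [r2 [l [[o1 o2 o3 o4] pE _]]]]]] := T0_brackets WM Gx x0 okp.
exists p1, r1, p2, r2; split=> //.
rewrite [in LHS]pE (T_addp WM) ?ex //; first exact: (subg0 GG).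
  exact: allowed_symbol o1 o2.
exact: allowed_symbol o3 o4.
Qed.

Lemma particle_all x q Y : Gam x -> x != 0 -> exact_brackets sg Gam T ->
  particle sg Gam T q Y ->
  forall b p d, Gam b -> allowed sg b p -> d != 0 -> Gam (d - q) ->
    T b p (Y d) = ev A d p *: Y (d + b).
Proof.
move=> Gx x0 ex YP b p d Gb okp d0 Gd; have [b0|b0] := eqVneq b 0; last by case: YP => _ _ _ + _; apply.
move: okp; rewrite b0 addr0 => okp.
have [p1 [r1 [p2 [r2 [[o1 o2 o3 o4] pE ->]]]]] := T0_exact (Y d) Gx x0 ex okp.
by rewrite !(particle_bracket YP) // -scalerDl -rmorphD -pE.
Qed.

Lemma no_action_all x : Gam x -> x != 0 -> exact_brackets sg Gam T ->
  no_action sg Gam T -> forall b p v, Gam b -> allowed sg b p -> T b p v = 0.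
Proof.
move=> Gx x0 ex T0 b p v Gb okp; have [b0|b0] := eqVneq b 0; last exact: T0.
move: okp; rewrite b0 => okp; have GN : Gam (- x) by apply: (subgN GG).
have N0 : - x != 0 by rewrite oppr_eq0.
have [p1 [r1 [p2 [r2 [[o1 o2 o3 o4] _ ->]]]]] := T0_exact v Gx x0 ex okp.
by rewrite /bracket !T0 // !subrr addr0.
Qed.

Lemma dual_exact : exact_brackets sg Gam T -> exact_brackets (~~ sg) Gam (dual_op T).
Proof.
move=> ex a p r v Ga a0 okp okr; rewrite (dual_bracket (T_lin WM)).
have o1 := allowed_flip okp; have o2 := allowed_flip okr.
rewrite ex // flip_symbol (T_oppp WM) //; first exact: (subg0 GG).
by apply/allowed_flip/allowed_symbol.
Qed.

End OneModule.

(** A uniform input for [central_zero]: [s] is 0 for the trivial action, 1 for a particle and -1 for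
    a dual particle, for which [d = - q]. *)
Lemma bracket_eigen Gam Vg T (WM : weyl_module false Gam Vg T) :
  no_action false Gam T \/ (exists q Y, particle false Gam T q Y) \/
  (exists q Y, particle true Gam (dual_op T) q Y) ->
  exists (y : V) (s : F) (d : X), y != 0 /\ forall a p r, Gam a -> a != 0 ->
    allowed false a p -> allowed false (- a) r ->
    bracket T a p r y = (s * ev A d (bracket_symbol a p r)) *: y.
Proof.
have GG := Gam_grp WM.
case=> [T0|[[q [Y YP]]|[q [Y YP]]]].
- have [y y0] := V_nonzero WM; exists y, 0, 0; split=> // a p r Ga a0 okp okr.
  have N0 : - a != 0 by rewrite oppr_eq0.
  have GN : Gam (- a) by apply: (subgN GG).
  by rewrite /bracket !T0 // subrr mul0r scale0r.
- have [q0 _ Yq _ _] := YP; exists (Y q), 1, q; split=> // a p r Ga a0 okp okr.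
  by rewrite (particle_bracket WM YP) // ?mul1r // subrr; apply: (subg0 GG).
have DM := dual_weyl_module WM.
have [q0 _ Yq _ _] := YP; exists (Y q), (-1), (- q); split=> // a p r Ga a0 okp okr.
have o1 : allowed true a (flip a p) by apply: allowed_flip.
have o2 : allowed true (- a) (flip (- a) r) by apply: allowed_flip.
have := particle_bracket DM YP Ga a0 o1 o2 q0; rewrite (dual_bracket (T_lin WM)) !flipK.
rewrite flip_symbol rmorphN /= ev_flip addr0 mulN1r; apply.
by rewrite subrr; apply: (subg0 GG).
Qed.

End DegreeZero.

(** * Intermediate series and weight vectors *)

Lemma big_coef_sub (F : fieldType) (V : lmodType F) (K : eqType) (co : K -> F) (g : K -> V)
    (s s' : seq K) : uniq s -> uniq s' -> {subset s <= s'} ->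
  (forall k, k \notin s -> co k = 0) ->
  \sum_(k <- s) co k *: g k = \sum_(k <- s') co k *: g k.
Proof.
move=> sU s'U ss' co0; rewrite [RHS](bigID (mem s)) /= [X in _ + X]big1 ?addr0.
  rewrite -[RHS]big_filter; apply: perm_big; apply: uniq_perm; rewrite ?filter_uniq // => k.
  by rewrite mem_filter; case: (boolP (k \in s)) => //= /ss' ->.
by move=> k /co0 ->; rewrite scale0r.
Qed.

Section MalgMap.
Context (F : fieldType) (K : zmodType) (V : lmodType F) (Z : K -> V).

Definition malg_map (y : {malg F[K]}) := \sum_(k <- enum_fset (msupp y)) y@_k *: Z k.

Lemma malg_mapE (y : {malg F[K]}) (s : seq K) : uniq s -> {subset enum_fset (msupp y) <= s} ->
  malg_map y = \sum_(k <- s) y@_k *: Z k.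
Proof.
move=> sU ys; apply: (big_coef_sub (co := fun k => y@_k) Z (fset_uniq (msupp y)) sU ys) => k.
exact: mcoeff_outdom.
Qed.

Lemma malg_map_lin (c : F) (y z : {malg F[K]}) :
  malg_map (c *: y + z) = c *: malg_map y + malg_map z.
Proof.
pose s := undup (enum_fset (msupp y) ++ enum_fset (msupp z) ++ enum_fset (msupp (c *: y + z))).
have sU : uniq s by apply: undup_uniq.
rewrite !(malg_mapE sU) => [|k kz|k ky|k kyz]; try by rewrite mem_undup !mem_cat ?ky ?kz ?kyz ?orbT.
rewrite scaler_sumr -big_split /=; apply: eq_bigr => k _.
by rewrite mcoeffD mcoeffZ scalerDl scalerA.
Qed.

Lemma malg_map0 : malg_map 0 = 0.
Proof. by rewrite (malg_mapE (s := [::])) ?big_nil // => k; rewrite msupp0. Qed.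

Lemma malg_mapU k : malg_map << k >> = Z k.
Proof.
rewrite (malg_mapE (s := [:: k])) ?big_seq1 ?mcoeffU ?eqxx ?scale1r // => j.
by rewrite msuppU oner_eq0 inE => /eqP ->; rewrite mem_head.
Qed.

Lemma malg_map_sum I (r : seq I) (c : I -> F) (k : I -> K) :
  malg_map (\sum_(i <- r) c i *: << k i >>) = \sum_(i <- r) c i *: Z (k i).
Proof.
elim: r => [|i r IHr]; first by rewrite !big_nil malg_map0.
by rewrite !big_cons malg_map_lin malg_mapU IHr.
Qed.

End MalgMap.

Section Intermediate.
Context (F : fieldType) (K : zmodType) (Gam : K -> Prop) (GG : add_subgroup Gam).
Context (V : lmodType F) (I : Type) (adm : I -> Prop) (deg : I -> K) (act : I -> V -> V).
Context (w : I -> K -> F) (actY : I -> {malg F[K]} -> {malg F[K]}) (Z : K -> V) (D : K -> Prop).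
Context (actL : forall i, lin (act i))
  (actYE : forall i y, actY i y =
     \sum_(k <- enum_fset (msupp y)) (y@_k * w i k) *: << deg i + k >>)
  (deg_adm : forall i, adm i -> Gam (deg i))
  (actZ : forall i k, adm i -> Gam k -> D k -> act i (Z k) = w i k *: Z (deg i + k))
  (D_closed : forall i k, adm i -> Gam k -> D k -> w i k != 0 -> D (deg i + k))
  (Z_span : forall v (U : V -> Prop), subspace U -> (forall k, Gam k -> D k -> U (Z k)) -> U v).

(** [U] is the kernel of [malg_map] on the elements supported in [D]. The restriction to [D] removes
    basis vectors without counterpart in [V] that are not annihilated, as at the site 0 in the dual
    case. *)
Lemma intermediate_iso :
  subquotient_iso adm act actY (fun y => forall k, y@_k != 0 -> Gam k).
Proof.
pose W (y : {malg F[K]}) := forall k, y@_k != 0 -> Gam k /\ D k.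
have W0 : W 0 by move=> k; rewrite mcoeff0 eqxx.
have WD y z : W y -> W z -> W (y + z).
  move=> Wy Wz k; rewrite mcoeffD; have [y0|/Wy//] := eqVneq (y@_k) 0.
  by rewrite y0 add0r => /Wz.
have WZ (a : F) y : W y -> W (a *: y).
  by move=> Wy k; rewrite mcoeffZ mulf_eq0 negb_or => /andP[_ /Wy].
have WU k : Gam k -> D k -> W << k >>.
  by move=> Gk Dk j; rewrite mcoeffU; have [<-//|_] := eqVneq k j; rewrite eqxx.
have supp (y : {malg F[K]}) k : k \in enum_fset (msupp y) -> y@_k != 0.
  by move=> ky; rewrite -mcoeff_neq0 in ky.
have WA i y : adm i -> W y -> W (actY i y).
  move=> ai Wy; rewrite actYE big_seq.
  apply: (big_ind W W0 WD) => k /supp/Wy[Gk Dk].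
  have [->|wk] := eqVneq (w i k) 0; first by rewrite mulr0 scale0r.
  apply/WZ/WU; [apply: (subgD GG) => //; exact: deg_adm|exact: D_closed].
have fA i y : adm i -> W y -> malg_map Z (actY i y) = act i (malg_map Z y).
  move=> ai Wy; rewrite actYE malg_map_sum (lin_sum (actL i)) !big_seq.
  apply: eq_bigr => k /supp/Wy[Gk Dk].
  by rewrite (linZ (actL i)) actZ // scalerA.
exists (fun y => W y /\ malg_map Z y = 0), W, (malg_map Z).
split; last (split; last (split; last split)).
- split=> //; last by move=> y Wy k /Wy[].
  + split; first by split=> //; apply: malg_map0.
    * move=> y z [Wy y0] [Wz z0]; split; first exact: WD.
      by have := malg_map_lin Z 1 y z; rewrite !scale1r y0 z0 addr0.
    * move=> a y [Wy y0]; split; first exact: WZ.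
      by have := malg_map_lin Z a y 0; rewrite !addr0 malg_map0 y0 scaler0 addr0.
    * by move=> i y ai [Wy y0]; split; [apply: WA|rewrite fA // y0 (lin0 (actL i))].
  + by move=> y [].
- by move=> a y z _ _; apply: malg_map_lin.
- move=> v; apply: (@Z_span v (fun v => exists y, W y /\ malg_map Z y = v)).
    split=> [|a u u' [y [Wy <-]] [y' [Wy' <-]]]; first by exists 0; rewrite malg_map0.
    by exists (a *: y + y'); rewrite malg_map_lin; split=> //; apply: WD => //; apply: WZ.
  by move=> k Gk Dk; exists << k >>; rewrite malg_mapU; split=> //; apply: WU.
- by move=> y Wy; split=> [|[]].
- exact: fA.
Qed.

End Intermediate.

Lemma H_actAE (F : fieldType) (alpha : F) i (y : {malg F[F]}) :
  H_actA alpha i y = \sum_(k <- enum_fset (msupp y))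
    (y@_k * (if i is Some (_, p) then p.[alpha + k] else 0)) *: << Hdeg i + k >>.
Proof. by case: i => [[b p]|] //=; rewrite big1 // => k _; rewrite mulr0 scale0r. Qed.

Lemma H_actBE (F : fieldType) (alpha : F) i (y : {malg F[F]}) :
  H_actB alpha i y = \sum_(k <- enum_fset (msupp y))
    (y@_k * (if i is Some (b, p) then - p.[- (alpha + b + k)] else 0)) *: << Hdeg i + k >>.
Proof. by case: i => [[b p]|] //=; rewrite big1 // => k _; rewrite mulr0 scale0r. Qed.

Section WeightVector.
Context (F : closedFieldType) (X : zmodType) (A : polyfun F X) (V : lmodType F).
Context (sg : bool) (Gam : X -> Prop) (Vg : X -> V -> Prop) (T : X -> A -> V -> V).
Context (WM : weyl_module sg Gam Vg T).
Context (T_comm0 : forall p r v, allowed sg 0 p -> allowed sg 0 r -> T 0 p (T 0 r v) = T 0 r (T 0 p v)).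

(** The commuting degree-0 operators preserve the finite-dimensional space of vectors of degree [g]
    killed in all degrees [y *+ k.+1]. *)
Lemma weight_vector y g w : Gam y -> y != 0 -> Vg g w -> w != 0 ->
  (forall k p, allowed sg (y *+ k.+1) p -> T (y *+ k.+1) p w = 0) ->
  exists w', [/\ Vg g w', w' != 0,
    forall p, allowed sg 0 p -> exists l : F, T 0 p w' = l *: w'
    & forall k p, allowed sg (y *+ k.+1) p -> T (y *+ k.+1) p w' = 0].
Proof.
move=> Gy y0 wg w0 wP; have GG := Gam_grp WM; have TL := T_lin WM.
pose S u := Vg g u /\ forall k p, allowed sg (y *+ k.+1) p -> T (y *+ k.+1) p u = 0.
(* Subtracting the value at 0 makes every [p] an allowed symbol, so the family is indexed by the
   whole ring. *)
pose f (p : A) u := T 0 (p - (ev A 0 p)%:A) u.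
have okf p : allowed sg 0 (p - (ev A 0 p)%:A) by apply: ok0_shift.
have [d dg] := Vg_dim WM g.
have dS : dim_le d S by apply: dim_le_sub dg => u [].
have SS : subspace S.
  split=> [|a u v [ug uP] [vg vP]]; split.
  - by case: (Vg_sub WM g).
  - by move=> k p _; rewrite (lin0 (TL _ _)).
  - by case: (Vg_sub WM g) => _; apply.
  - by move=> k p okp; rewrite (TL _ _) uP // vP // scaler0 addr0.
have Sf p u : S u -> S (f p u).
  move=> [ug uP]; split=> [|k r okr].
    by rewrite -[g]add0r; apply: (T_deg WM) => //; apply: (subg0 GG).
  have Gk : Gam (y *+ k.+1) by apply: (subgMn GG).
  have k0 : y *+ k.+1 != 0 by apply: contraNneq y0 => /(tors_free WM) ->.
  have := T_adjoint WM u Gk k0 okr (okf p); rewrite uP // (lin0 (TL _ _)) sub0r => /eqP.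
  by rewrite uP ?oppr_eq0 => [/eqP//|]; apply: okM.
have fC p r u : S u -> f p (f r u) = f r (f p u) by move=> _; apply: T_comm0.
have [w' [[w'g w'P] w'0 eig]] := common_eigenvector (fun p => TL 0 _) SS Sf fC dS (conj wg wP) w0.
exists w'; split=> // p okp; have [l lE] := eig p; exists l; rewrite -lE /f.
by move: okp; rewrite /allowed oppr0 if_same => ->; rewrite scale0r subr0.
Qed.

End WeightVector.

(** * Groups covered by finitely many parallel lines *)

Section CoverByLines.
Context (X : zmodType) (tf : torsion_free X) (Gam : X -> Prop) (GG : add_subgroup Gam).

Lemma torsion_freez (x : X) (z : int) : x != 0 -> x *~ z = 0 -> z = 0.
Proof.
move=> x0; case: z => [[//|n]|n] /eqP.
  by rewrite -pmulrn => /eqP/tf/eqP; rewrite (negPf x0).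
by rewrite NegzE mulrNz oppr_eq0 -pmulrn => /eqP/tf/eqP; rewrite (negPf x0).
Qed.

Lemma subgMz x (z : int) : Gam x -> Gam (x *~ z).
Proof.
move=> Gx; case: z => n; first by rewrite -pmulrn; apply: (subgMn GG).
by rewrite NegzE mulrNz -pmulrn; apply/(subgN GG)/(subgMn GG).
Qed.

(* If finitely many translates of [Z x] cover [Gam] then a multiple of [Gam] lies in
   [Z x], and a torsion-free group with this property is infinite cyclic. *)
Lemma fresh_line_exists x : Gam x -> x != 0 -> ~ iso_to_Z Gam ->
  forall (s : seq X) c, exists m, Gam (m - c) /\ forall y (z : int), y \in s -> y - m != x *~ z.
Proof.
move=> Gx x0 notZ s c; apply: NNPP => no; apply: notZ.
have cover u : Gam u -> exists i : 'I_(size s), exists z : int, s`_i - (c + u) = x *~ z.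
  move=> Gu; apply: NNPP => nu; apply: no; exists (c + u); split; first by rewrite addrC addKr.
  move=> y z ys; apply/eqP => yz; apply: nu.
  have iy : (index y s < size s)%N by rewrite index_mem.
  by exists (Ordinal iy), z; rewrite nth_index.
(* Pigeonhole produces index differences between 1 and [size s]; all of them divide this
   factorial. *)
pose N := (size s)`!.
have mulN u : Gam u -> exists k : int, u *+ N = x *~ k.
  move=> Gu.
  have /fin_all_exists[i iP] (j : 'I_(size s).+1) :
      exists i : 'I_(size s), exists z : int, s`_i - (c + u *+ j) = x *~ z.
    by apply: cover; apply: (subgMn GG).
  have /injectivePn[j [j' jj' ij]] : ~~ injectiveb i.
    apply/negP => /injectiveP/leq_card; rewrite !card_ord; lia.
  wlog lt : j j' jj' ij / (j < j')%N.
    move=> W; have [|lt|/val_inj E0] := ltngtP j j'; first exact: W.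
      by apply: (W j' j); rewrite 1?eq_sym.
    by rewrite E0 eqxx in jj'.
  have [z zE] := iP j; have [z' z'E] := iP j'.
  have dE : u *+ (j' - j) = x *~ (z - z').
    rewrite mulrzBr -zE -z'E -ij mulrnBr ?(ltnW lt) //.
    by rewrite opprB [RHS]addrC addrA subrK opprD addrACA subrr add0r.
  have /dvdnP[t Nt] : (j' - j %| N)%N.
    apply: dvdn_fact; rewrite subn_gt0 lt /=.
    by apply: leq_trans (leq_subr _ _) _; rewrite -ltnS.
  by exists ((z - z') * t); rewrite Nt mulnC mulrnA dE pmulrn mulrzA.
have N0 : (0 < N)%N by apply: fact_gt0.
(* The multiples [u *+ N] form a subgroup of the line through [x]; its least positive element comes
   from the generator [e]. *)
pose H (k : nat) := (0 < k)%N /\ exists2 u, Gam u & u *+ N = x *~ k%:Z.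
have [d [dpos [e Ge eE]] dmin] : exists2 d, H d & forall k, H k -> (d <= k)%N.
  have HN : H N by split=> //; exists x; rewrite // pmulrn.
  apply: NNPP => nd; suff : forall k, forall l, (l <= k)%N -> ~ H l by move/(_ N N (leqnn _)).
  elim=> [|k IHk] l; first by rewrite leqn0 => /eqP -> [].
  rewrite leq_eqVlt => /orP[/eqP lk|]; last by rewrite ltnS; apply: IHk.
  move=> Hl; apply: nd; exists l => // j Hj; rewrite leqNgt; apply/negP => jl.
  by apply: (IHk j) Hj; rewrite -ltnS -lk.
have e0 : e != 0.
  apply/negP => /eqP e0; move: eE; rewrite e0 mul0rn => /esym/(torsion_freez x0) [d0].
  by rewrite d0 in dpos.
exists (fun k => e *~ k); split=> [a b|a b E0|u].
- exact: mulrzDr.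
- apply/eqP; rewrite -subr_eq0; apply/eqP; apply: (torsion_freez e0).
  by rewrite mulrzBr E0 subrr.
split=> [Gu|[k ->]]; last exact: subgMz.
have [k kE] := mulN u Gu; exists (k %/ d)%Z.
have eN q : (e *~ q) *+ N = x *~ (d%:Z * q).
  by rewrite pmulrn -mulrzA mulrC (mulrzA e) -(pmulrn e N) eE -mulrzA.
have dvd : (k %% d)%Z = 0.
  have md : (0 <= (k %% d)%Z)%R by apply: modz_ge0; lia.
  have mlt : ((k %% d)%Z < d)%R by have := ltz_pmod k (d := d%:Z); apply; lia.
  case E1 : (k %% d)%Z md mlt => [[//|r]|//] _ mlt.
  have Hr : H r.+1.
    split=> //; exists (u - e *~ (k %/ d)%Z); first by apply: (subgB GG) => //; apply: subgMz.
    rewrite mulrnBl kE eN -mulrzBr -[in RHS]E1; congr (_ *~ _); rewrite {1}(divz_eq k d); lia.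
  by have := dmin _ Hr; lia.
apply/eqP; rewrite -subr_eq0; apply/eqP.
have NS : N = N.-1.+1 by lia.
apply: (@tf _ N.-1); rewrite -NS mulrnBl kE eN -mulrzBr.
have -> : (k - d%:Z * (k %/ d)%Z = 0)%R by rewrite {1}(divz_eq k d) dvd; lia.
exact: mulr0z.
Qed.

End CoverByLines.

From mathcomp Require Import mpoly.

(** * Multivariate polynomials *)

Section Adjunction.
Context (F : closedFieldType) (P : comAlgType F).
Implicit Types (J K : P -> Prop) (x p : P).

Definition adjoin J x p := exists c, J (p - c * x).

Lemma adjoin_ideal J x : ideal J -> ideal (adjoin J x).
Proof.
move=> [J0 JD JM]; split=> [|p q [c Jc] [d Jd]|r p [c Jc]].
- by exists 0; rewrite mul0r subrr.
- by exists (c + d); rewrite mulrDl opprD addrACA; apply: JD.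
- by exists (r * c); rewrite -mulrA -mulrBr; apply: JM.
Qed.

Lemma adjoin_sub J x p : J p -> adjoin J x p.
Proof. by exists 0; rewrite mul0r subr0. Qed.

Lemma adjoin_gen J x : ideal J -> adjoin J x x.
Proof. by move=> [J0 _ _]; exists 1; rewrite mul1r subrr. Qed.

(** If every [x - l] were a unit modulo [J], the factors of an annihilating product could be
    cancelled one by one, leaving 1 in [J]. *)
Lemma adjoin_proper J x : ideal J -> algebraic J -> ~ J 1 ->
  exists l : F, ~ adjoin J (x - l%:A) 1.
Proof.
move=> IJ Ja J1; apply: NNPP => no.
have all1 l : adjoin J (x - l%:A) 1 by apply: NNPP => nl; apply: no; exists l.
have [ls Jls] := Ja x; apply: J1; move: Jls.
elim: ls => [|l ls IHls]; first by rewrite /root_prod big_nil.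
rewrite /root_prod big_cons -/(root_prod x ls) => Jl; apply: IHls.
have [c Jc] := all1 l; case: (IJ) => J0 JD JM.
have -> : root_prod x ls = root_prod x ls * (1 - c * (x - l%:A))
    + c * ((x - l%:A) * root_prod x ls).
  by rewrite mulrBr mulr1 [X in _ + X]mulrA [X in _ + X]mulrC subrK.
by apply: JD; apply: JM.
Qed.

Lemma adjoin_all (xs : seq P) K : ideal K -> algebraic K -> ~ K 1 ->
  exists (ls : nat -> F) (J : P -> Prop), [/\ ideal J, forall p, K p -> J p, ~ J 1 &
    forall i, (i < size xs)%N -> J (xs`_i - (ls i)%:A)].
Proof.
elim: xs K => [|x xs IHxs] K IK Ka K1; first by exists (fun=> 0), K; split.
have [l l1] := adjoin_proper x IK Ka K1.
have IK' := adjoin_ideal (x - l%:A) IK.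
have Ka' : algebraic (adjoin K (x - l%:A)).
  by apply: algebraic_sub Ka => p; apply: adjoin_sub.
have [ls [J [IJ KJ J1 Jx]]] := IHxs _ IK' Ka' l1.
exists (fun i => if i is j.+1 then ls j else l), J; split=> // [p Kp|[_|i]] /=.
- by apply: KJ; apply: adjoin_sub.
- by apply: KJ; apply: adjoin_gen.
- by rewrite ltnS; apply: Jx.
Qed.

End Adjunction.

(** * Solving difference equations *)

Section Antidifference.
Context (F : closedFieldType) (char0 : forall k, k.+1%:R != 0 :> F) (P : comAlgType F).
Context (tau : {rmorphism P -> P}) (tauZ : forall c p, tau (c *: p) = c *: tau p).
Context (z : P) (tauz : tau z = z + 1).

Let delta p := tau p - p.
Definition antidiff q := exists p, tau p - p = q.

Lemma antidiffD p q : antidiff p -> antidiff q -> antidiff (p + q).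
Proof. by move=> [a <-] [b <-]; exists (a + b); rewrite rmorphD opprD addrACA. Qed.

Lemma antidiffM c q : tau c = c -> antidiff q -> antidiff (c * q).
Proof. by move=> tc [a <-]; exists (c * a); rewrite rmorphM /= tc mulrBr. Qed.

Lemma antidiffZ (c : F) q : antidiff q -> antidiff (c *: q).
Proof. by move=> [a <-]; exists (c *: a); rewrite tauZ scalerBr. Qed.

Lemma antidiff_sum n (q : nat -> P) :
  (forall i, (i < n)%N -> antidiff (q i)) -> antidiff (\sum_(i < n) q i).
Proof.
elim: n => [|n IHn] qA; first by rewrite big_ord0; exists 0; rewrite rmorph0 subrr.
rewrite big_ord_recr /=; apply: antidiffD; last exact: qA.
by apply: IHn => i ?; apply: qA; apply: leqW.
Qed.

(** The difference of [z ^+ k.+1] is [k.+1%:R *: z ^+ k] plus lower powers, and the coefficient is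
    invertible. *)
Lemma antidiff_pow k : antidiff (z ^+ k).
Proof.
elim/ltn_ind: k => k IHk.
have dE : tau (z ^+ k.+1) - z ^+ k.+1
    = (k.+1%:R : F) *: z ^+ k + \sum_(i < k) (('C(k.+1, i))%:R : F) *: z ^+ i.
  rewrite rmorphXn /= tauz addrC exprD1n !big_ord_recr /= binn mulr1n binSn.
  have scal (m : nat) (w : P) : w *+ m = (m%:R : F) *: w by rewrite scaler_nat.
  under eq_bigr do rewrite scal.
  by rewrite scal addrC addrK addrC.
have -> : z ^+ k = (k.+1%:R^-1 : F) *: ((tau (z ^+ k.+1) - z ^+ k.+1)
    + - (1 : F) *: \sum_(i < k) (('C(k.+1, i))%:R : F) *: z ^+ i).
  by rewrite dE scaleN1r addrK scalerA mulVf // scale1r.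
apply: antidiffZ; apply: antidiffD; first by exists (z ^+ k.+1).
apply: antidiffZ; apply: (antidiff_sum (q := fun i => (('C(k.+1, i))%:R : F) *: z ^+ i)) => i ik.
by apply: antidiffZ; apply: IHk.
Qed.

(** Including all powers of [z] makes the property stable under multiplication by [z], as an
    induction on polynomials requires. *)
Definition antidiff_pows q := forall k, antidiff (q * z ^+ k).

Lemma antidiff_pows1 : antidiff_pows 1.
Proof. by move=> k; rewrite mul1r; apply: antidiff_pow. Qed.

Lemma antidiff_powsD p q : antidiff_pows p -> antidiff_pows q -> antidiff_pows (p + q).
Proof. by move=> pP qP k; rewrite mulrDl; apply: antidiffD. Qed.

Lemma antidiff_powsZ (c : F) p : antidiff_pows p -> antidiff_pows (c *: p).
Proof. by move=> pP k; rewrite -scalerAl; apply: antidiffZ. Qed.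

Lemma antidiff_powsM q c (d : F) : tau c = c -> antidiff_pows q ->
  antidiff_pows (q * (c + d *: z)).
Proof.
move=> tc qP; rewrite mulrDr; apply: antidiff_powsD => [k|].
  by rewrite mulrAC mulrC; apply: antidiffM.
rewrite -scalerAr; apply: antidiff_powsZ => k.
by rewrite -mulrA -exprS.
Qed.

End Antidifference.

Section MultiPoly.
Context (F : closedFieldType) (char0 : forall k, k.+1%:R != 0 :> F) (n : nat).
Notation P := (mpoly n F).

Lemma mpoly_alg_ind (R : P -> Prop) : R 1 -> (forall p q, R p -> R q -> R (p + q)) ->
  (forall p q, R p -> R q -> R (p * q)) -> (forall (c : F) p, R p -> R (c *: p)) ->
  (forall i, R 'X_i) -> forall p, R p.
Proof.
move=> R1 RD RM RZ RX p; have R0 : R 0 by rewrite -(scale0r (1 : P)); apply: RZ.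
rewrite [p]mpolyE; apply: big_ind => // m _; apply: RZ; rewrite mpolyXE_id.
apply: big_ind => // i _; elim: (m i) => [|k IHk]; first by rewrite expr0.
by rewrite exprS; apply: RM.
Qed.

Lemma mpoly_ext (B : comAlgType F) (f g : {rmorphism P -> B}) :
  (forall c p, f (c *: p) = c *: f p) -> (forall c p, g (c *: p) = c *: g p) ->
  (forall i, f 'X_i = g 'X_i) -> forall p, f p = g p.
Proof.
move=> fZ gZ fg; apply: mpoly_alg_ind => //.
- by rewrite !rmorph1.
- by move=> p q fp fq; rewrite !rmorphD /= fp fq.
- by move=> p q fp fq; rewrite !rmorphM /= fp fq.
- by move=> c p fp; rewrite fZ gZ fp.
Qed.

Definition mp_ev (a : 'rV[F]_n) : {rmorphism P -> F} := meval (fun i => a 0 i).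
Definition mp_tau (a : 'rV[F]_n) : {rmorphism P -> P} :=
  comp_mpoly [tuple 'X_i + (a 0 i)%:A | i < n].
Definition mp_rho : {rmorphism P -> P} := comp_mpoly [tuple - 'X_i | i < n].

Lemma mp_evZ a c p : mp_ev a (c *: p) = c * mp_ev a p. Proof. exact: mevalZ. Qed.
Lemma mp_tauZ a c p : mp_tau a (c *: p) = c *: mp_tau a p. Proof. exact: comp_mpolyZ. Qed.
Lemma mp_rhoZ c p : mp_rho (c *: p) = c *: mp_rho p. Proof. exact: comp_mpolyZ. Qed.
Lemma mp_evX a i : mp_ev a 'X_i = a 0 i. Proof. exact: mevalXU. Qed.
Lemma mp_tauX a i : mp_tau a 'X_i = 'X_i + (a 0 i)%:A.
Proof. by rewrite /mp_tau /= comp_mpolyXU -tnth_nth tnth_mktuple. Qed.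
Lemma mp_rhoX i : mp_rho 'X_i = - 'X_i.
Proof. by rewrite /mp_rho /= comp_mpolyXU -tnth_nth tnth_mktuple. Qed.

(* Otherwise unification compares the defining tuples of [mp_tau] and [mp_rho]. *)
Opaque mp_ev mp_tau mp_rho.

Lemma mp_evC a (c : F) : mp_ev a c%:A = c. Proof. by rewrite mp_evZ rmorph1 mulr1. Qed.
Lemma mp_tauC a (c : F) : mp_tau a c%:A = c%:A. Proof. by rewrite mp_tauZ rmorph1. Qed.
Lemma mp_rhoC (c : F) : mp_rho c%:A = c%:A. Proof. by rewrite mp_rhoZ rmorph1. Qed.

Lemma mp_ev_tau a b p : mp_ev a (mp_tau b p) = mp_ev (a + b) p.
Proof.
apply: (@mpoly_ext F^o (mp_ev a \o mp_tau b) (mp_ev (a + b))) => [c q|c q|i] /=.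
- by rewrite mp_tauZ mp_evZ.
- exact: mp_evZ.
- by rewrite mp_tauX rmorphD /= !mp_evX mp_evC mxE.
Qed.

Lemma mp_tau0 p : mp_tau 0 p = p.
Proof.
apply: (@mpoly_ext _ (mp_tau 0) idfun) => [c q|//|i] /=; first exact: mp_tauZ.
by rewrite mp_tauX mxE scale0r addr0.
Qed.

Lemma mp_tauD a b p : mp_tau a (mp_tau b p) = mp_tau (a + b) p.
Proof.
apply: (@mpoly_ext _ (mp_tau a \o mp_tau b) (mp_tau (a + b))) => [c q|c q|i] /=.
- by rewrite !mp_tauZ.
- exact: mp_tauZ.
- by rewrite !mp_tauX rmorphD /= mp_tauX mp_tauC mxE scalerDl addrA.
Qed.

Lemma mp_ev_rho a p : mp_ev a (mp_rho p) = mp_ev (- a) p.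
Proof.
apply: (@mpoly_ext F^o (mp_ev a \o mp_rho) (mp_ev (- a))) => [c q|c q|i] /=.
- by rewrite mp_rhoZ mp_evZ.
- exact: mp_evZ.
- by rewrite mp_rhoX rmorphN /= !mp_evX mxE.
Qed.

Lemma mp_rho_tau a p : mp_rho (mp_tau a p) = mp_tau (- a) (mp_rho p).
Proof.
apply: (@mpoly_ext _ (mp_rho \o mp_tau a) (mp_tau (- a) \o mp_rho)) => [c q|c q|i] /=.
- by rewrite mp_tauZ mp_rhoZ.
- by rewrite mp_rhoZ mp_tauZ.
- by rewrite mp_tauX mp_rhoX rmorphD rmorphN /= mp_rhoX mp_rhoC mp_tauX mxE scaleNr opprB addrC.
Qed.

Lemma mp_rhoK p : mp_rho (mp_rho p) = p.
Proof.
apply: (@mpoly_ext _ (mp_rho \o mp_rho) idfun) => [c q|//|i] /=; first by rewrite !mp_rhoZ.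
by rewrite mp_rhoX rmorphN /= mp_rhoX opprK.
Qed.

Lemma mp_sep (a b : 'rV[F]_n) : a <> b -> exists r, mp_ev a r <> mp_ev b r.
Proof.
move=> ab; apply: NNPP => no; apply: ab; apply/rowP => i.
by apply: NNPP => abi; apply: no; exists 'X_i; rewrite !mp_evX.
Qed.

Lemma mp_ev_root_prod a (r : P) ls : mp_ev a (root_prod r ls) = 0 -> mp_ev a r \in ls.
Proof.
rewrite /root_prod; elim: ls => [|l ls IHls].
  by rewrite big_nil rmorph1 => /eqP; rewrite oner_eq0.
rewrite big_cons rmorphM rmorphB /= mp_evC inE => /eqP; rewrite mulf_eq0 subr_eq0.
by case/orP => [->//|/eqP/IHls ->]; rewrite orbT.
Qed.

(** Each coordinate of a common zero is a root of the product annihilating that variable. *)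
Lemma mp_ideal_zeros (K : P -> Prop) : ideal K -> algebraic K ->
  exists s : seq 'rV[F]_n, forall a, (forall r, K r -> mp_ev a r = 0) -> a \in s.
Proof.
move=> IK Ka; have /fin_all_exists[ls lsP] (i : 'I_n) : exists ls, K (root_prod 'X_i ls) by apply: Ka.
pose L := flatten [seq ls i | i <- enum 'I_n].
exists [seq \row_i L`_(f i) | f : {ffun 'I_n -> 'I_(size L)}] => a aK.
have aL i : a 0 i \in L.
  apply/flattenP; exists (ls i); first by apply: map_f; rewrite mem_enum.
  by rewrite -(mp_evX a i); apply/mp_ev_root_prod/aK/lsP.
pose ai i := a 0 i; have idx i : (index (ai i) L < size L)%N by rewrite index_mem aL.
apply/imageP; exists [ffun i => Ordinal (idx i)] => //.
by apply/rowP => i; rewrite mxE ffunE /= nth_index.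
Qed.

(** A proper ideal enlarges to a proper one that identifies each variable with a constant, hence
    each polynomial with its value at a point [a]; the hypothesis at [a] puts a nonzero constant
    into it. *)
Lemma mp_nullstellensatz (K : P -> Prop) : ideal K -> algebraic K ->
  (forall a, exists2 r, K r & mp_ev a r != 0) -> K 1.
Proof.
move=> IK Ka nz; apply: NNPP => K1.
have [ls [J [IJ KJ J1 Jx]]] := adjoin_all [seq 'X_i | i <- enum 'I_n] IK Ka K1.
pose a : 'rV[F]_n := \row_i ls i; have [r Kr r0] := nz a.
have JX i : J ('X_i - (mp_ev a 'X_i)%:A).
  have := Jx i; rewrite size_map size_enum_ord (nth_map i) ?size_enum_ord //.
  by rewrite nth_ord_enum mp_evX mxE; apply.
have [J0 JD JM] := IJ.
have Jp : forall p, J (p - (mp_ev a p)%:A).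
  apply: mpoly_alg_ind => //.
  - by rewrite rmorph1 scale1r subrr.
  - by move=> p q Jp Jq; rewrite rmorphD /= scalerDl opprD addrACA; apply: JD.
  - move=> p q Jp Jq; rewrite rmorphM /=.
    have -> : p * q - (mp_ev a p * mp_ev a q)%:A =
        q * (p - (mp_ev a p)%:A) + (mp_ev a p)%:A * (q - (mp_ev a q)%:A).
      by rewrite !mulrBr mulrC [q * _%:A]mulrC addrA subrK -scalerAl mul1r scalerA.
    by apply: JD; apply: JM.
  - by move=> c p Jp; rewrite mp_evZ -scalerA -scalerBr -[c *: _]mulr_algl; apply: JM.
apply: J1; have -> : 1 = (mp_ev a r)^-1%:A * (mp_ev a r)%:A :> P.
  by rewrite -scalerAl mul1r scalerA mulVf // scale1r.
apply: (JM); have -> : (mp_ev a r)%:A = r - (r - (mp_ev a r)%:A) by rewrite opprB addrC subrK.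
by apply: idealB => //; apply: KJ.
Qed.

(** Some rescaled coordinate [z] increases by 1 under the translation, and every ['X_j] is an
    invariant plus a multiple of [z]. *)
Lemma mp_tau_surj b : b != 0 -> forall q, exists p, mp_tau b p - p = q.
Proof.
move=> b0; have [i bi] : exists i, b 0 i != 0.
  by apply: NNPP => no; case/eqP: b0; apply/rowP => i; rewrite mxE; apply/eqP;
    apply: contra_notT no => bi; exists i.
pose z : P := (b 0 i)^-1 *: 'X_i.
have tz : mp_tau b z = z + 1.
  by rewrite mp_tauZ mp_tauX scalerDr scalerA mulVf // scale1r.
have tZ := mp_tauZ b.
move=> q; pose R p := forall u, antidiff_pows (mp_tau b) z u -> antidiff_pows (mp_tau b) z (u * p).
suff /(_ q 1 (antidiff_pows1 char0 tZ tz) 0%N) : forall p, R p by rewrite mul1r mulr1.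
apply: mpoly_alg_ind => [u|p p' Rp Rp' u|p p' Rp Rp' u|c p Rp u|j u] uP.
- by rewrite mulr1.
- by rewrite mulrDr; apply: antidiff_powsD; [apply: Rp|apply: Rp'].
- by rewrite mulrA; apply/Rp'/Rp.
- by rewrite -scalerAr; apply: antidiff_powsZ => //; apply: Rp.
have -> : 'X_j = ('X_j - b 0 j *: z) + b 0 j *: z by rewrite subrK.
apply: antidiff_powsM => //.
by rewrite rmorphB /= mp_tauX tZ tz scalerDr opprD addrACA subrr addr0.
Qed.

Definition mp_polyfun : polyfun F 'rV[F]_n :=
  Polyfun mp_evZ mp_tauZ mp_rhoZ mp_ev_tau mp_tau0 mp_tauD mp_ev_rho mp_rho_tau mp_rhoK
    mp_sep mp_ideal_zeros mp_nullstellensatz mp_tau_surj.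

End MultiPoly.

(** * The algebra W(Gamma, n)^(1) *)

Section WOps.
Context (F : closedFieldType) (char0 : forall k, k.+1%:R != 0 :> F) (n : nat).
Context (V : lmodType F) (act : Wind F n -> V -> V).
Notation P := (mpoly n F).
Notation PF := (mp_polyfun char0 n).

Definition ffun_mnm (m : 'X_{1..n}) : {ffun 'I_n -> nat} := [ffun i => m i].
Definition mnm_ffun (mu : {ffun 'I_n -> nat}) : 'X_{1..n} := [multinom mu i | i < n].

Lemma mnm_ffunK mu : ffun_mnm (mnm_ffun mu) = mu.
Proof. by apply/ffunP => i; rewrite ffunE mnmE. Qed.

Lemma ffun_mnmK m : mnm_ffun (ffun_mnm m) = m.
Proof. by apply/mnmP => i; rewrite mnmE ffunE. Qed.

Definition W_op (b : 'rV[F]_n) (p : P) v := \sum_(m <- msupp p) p@_m *: act (b, ffun_mnm m) v.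

Lemma W_opE b p v (s : seq 'X_{1..n}) : uniq s -> {subset msupp p <= s} ->
  W_op b p v = \sum_(m <- s) p@_m *: act (b, ffun_mnm m) v.
Proof.
move=> sU ps; apply: (big_coef_sub (co := fun m => p@_m) (fun m => act (b, ffun_mnm m) v)
  (msupp_uniq p) sU ps) => m.
exact: memN_msupp_eq0.
Qed.

Lemma W_op_lin b (c : F) p q v : W_op b (c *: p + q) v = c *: W_op b p v + W_op b q v.
Proof.
pose s := undup (msupp p ++ msupp q ++ msupp (c *: p + q)).
have sU : uniq s by apply: undup_uniq.
rewrite !(W_opE _ _ sU) => [|m mz|m mz|m mz]; try by rewrite mem_undup !mem_cat ?mz ?orbT.
rewrite scaler_sumr -big_split /=; apply: eq_bigr => m _.
by rewrite mcoeffD mcoeffZ scalerDl scalerA.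
Qed.

Lemma W_opB b p q v : W_op b (p - q) v = W_op b p v - W_op b q v.
Proof. by rewrite addrC -(scaleN1r q) W_op_lin scaleN1r addrC. Qed.

Lemma W_opX b m v : W_op b 'X_[m] v = act (b, ffun_mnm m) v.
Proof. by rewrite /W_op msuppX big_seq1 mcoeffX eqxx scale1r. Qed.

Lemma W_op0 b v : W_op b 0 v = 0.
Proof. by rewrite /W_op msupp0 big_nil. Qed.

Lemma W_op_sum b I (r : seq I) (c : I -> F) (m : I -> 'X_{1..n}) v :
  W_op b (\sum_(i <- r) c i *: 'X_[m i]) v = \sum_(i <- r) c i *: act (b, ffun_mnm (m i)) v.
Proof.
elim: r => [|i r IHr]; first by rewrite !big_nil W_op0.
by rewrite !big_cons W_op_lin W_opX IHr.
Qed.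

Lemma nonconst_ind (Q : P -> Prop) : Q 0 -> (forall (c : F) p q, Q p -> Q q -> Q (c *: p + q)) ->
  (forall m, m != 0%MM -> Q 'X_[m]) -> forall p, p@_0 = 0 -> Q p.
Proof.
move=> Q0 QL QX p p0; rewrite [p]mpolyE big_seq.
apply: (big_rec Q) => // m q mp Qq; apply: (QL) => //; apply: QX.
by apply: contraTneq mp => ->; rewrite mcoeff_msupp p0 eqxx.
Qed.

Lemma mp_ev0_nonconst (p : P) : p@_0%MM = 0 -> mp_ev 0 p = 0.
Proof.
move: p; apply: nonconst_ind => [|c p q p0 q0|m m0].
- exact: rmorph0.
- by rewrite rmorphD /= mp_evZ p0 q0 mulr0 addr0.
have [i mi] : exists i, m i != 0%N.
  by apply: NNPP => no; case/eqP: m0; apply/mnmP => i; rewrite mnm0E; apply/eqP;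
    apply: contra_notT no => mi; exists i.
rewrite mpolyXE_id rmorph_prod (bigD1 i) //= rmorphXn /= mp_evX mxE expr0n.
by rewrite (negPf mi) mul0r.
Qed.

Lemma mp_ev0 (p : P) : mp_ev 0 p = p@_0%MM.
Proof.
have : mp_ev 0 (- (p@_0%MM) *: 1 + p) = 0.
  by apply: mp_ev0_nonconst; rewrite mcoeffD mcoeffZ mcoeff1 eqxx mulr1 addNr.
by rewrite rmorphD /= mp_evC addrC => /eqP; rewrite subr_eq0 => /eqP.
Qed.

Lemma mp_evXm (a : 'rV[F]_n) mu : mp_ev a 'X_[mnm_ffun mu] = mpow a mu.
Proof.
rewrite mpolyXE_id rmorph_prod /mpow; apply: eq_bigr => i _.
by rewrite rmorphXn /= mp_evX mnmE.
Qed.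

(* The right-hand side is the product of t^a D^mu and t^b D^nu in [W_module]. *)
Lemma mp_tau_mulX (b : 'rV[F]_n) (mu nu : {ffun 'I_n -> nat}) N :
  (forall i, (mu i < N)%N) ->
  mp_tau b 'X_[mnm_ffun mu] * 'X_[mnm_ffun nu] =
  \sum_(la : {ffun 'I_n -> 'I_N})
    (mbinom F mu [ffun i => nat_of_ord (la i)] * mpow b [ffun i => nat_of_ord (la i)]) *:
      'X_[mnm_ffun [ffun i => (mu i + nu i - [ffun i => nat_of_ord (la i)] i)%N]] :> P.
Proof.
move=> muN; rewrite !mpolyXE_id rmorph_prod -big_split /=.
have step i : mp_tau b ('X_i ^+ mnm_ffun mu i) * 'X_i ^+ mnm_ffun nu i =
    \sum_(k < N) ((('C(mu i, k))%:R * b 0 i ^+ k) : F) *: 'X_i ^+ (mu i + nu i - k)%N.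
  rewrite rmorphXn /= mp_tauX !mnmE exprDn mulr_suml.
  rewrite (big_ord_widen N (fun k => 'X_i ^+ (mu i - k) * (b 0 i)%:A ^+ k *+ 'C(mu i, k)
     * 'X_i ^+ nu i)) // big_mkcond; apply: eq_bigr => k _.
  case: ltnP => [k_mu|mu_k]; last by rewrite bin_small // mul0r scale0r.
  by rewrite exprZn expr1n -scalerAr mulr1 mulrnAl -scalerAl -exprD addnBAC // -scaler_nat scalerA.
under eq_bigr do rewrite step.
rewrite bigA_distr_bigA; apply: eq_bigr => la _ /=.
rewrite scaler_prod mpolyXE_id; congr (_ *: _).
  rewrite big_split /mbinom /mpow natr_prod; congr (_ * _).
    by apply: eq_bigr => i _; rewrite ffunE.
  by apply: eq_bigr => i _; rewrite ffunE.
by apply: eq_bigr => i _; rewrite mnmE !ffunE.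
Qed.

End WOps.

Lemma cross_lin (F : fieldType) (A : algType F) (c : F) (tp tq p q ts s : A) :
  ts * (c *: p + q) - (c *: tp + tq) * s = c *: (ts * p - tp * s) + (ts * q - tq * s).
Proof. by rewrite mulrDl mulrDr -scalerAl -scalerAr opprD addrACA -scalerBr. Qed.

Lemma one_dim (F : fieldType) (I : Type) (adm : I -> Prop) (V : lmodType F) (act : I -> V -> V) v0 :
  irreducible adm act -> v0 != 0 -> (forall i (v : V), adm i -> act i v = 0) ->
  forall v : V, exists c : F, v = c *: v0.
Proof.
move=> IRR v00 act0; apply: (proj2 IRR); last by exists v0; split=> //; exists 1; rewrite scale1r.
split=> [|u v [a ->] [b ->]|a v [b ->]|i v ai _].
- by exists 0; rewrite scale0r.
- by exists (a + b); rewrite scalerDl.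
- by exists (a * b); rewrite scalerA.
- by exists 0; rewrite act0 // scale0r.
Qed.

Section WClassification.
Context (F : closedFieldType) (char0 : forall k, k.+1%:R != 0 :> F) (n : nat).
Context (V : lmodType F) (act : Wind F n -> V -> V).
Context (Gam : 'rV[F]_n -> Prop) (Vg : 'rV[F]_n -> V -> Prop) (GG : add_subgroup Gam).
Context (WMod : W_module Gam act).
Context (QF : quasifinite (Wadm Gam) (@Wdeg F n) act Gam Vg).
Context (IRR : irreducible (Wadm Gam) act).
Notation P := (mpoly n F).
Notation PF := (mp_polyfun char0 n).
Notation T := (W_op act).

Lemma W_act_lin i : lin (act i).
Proof. by move=> a u v; apply: (proj1 WMod). Qed.

Lemma W_T_lin b p : lin (T b p).
Proof.
move=> c u v; rewrite /W_op scaler_sumr -big_split; apply: eq_bigr => m _ /=.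
by rewrite (W_act_lin _) scalerDr !scalerA mulrC.
Qed.

Lemma ffun_mnm_adm b m : Gam b -> m != 0%MM -> Wadm Gam (b, ffun_mnm m).
Proof.
move=> Gb m0; split=> //=; apply: contraNneq m0 => E0.
by apply/eqP/mnmP => i; have /ffunP/(_ i) := E0; rewrite !ffunE mnm0E.
Qed.

Lemma mp_tau_lin (a : 'rV[F]_n) (c : F) (p q : P) :
  mp_tau a (c *: p + q) = c *: mp_tau a p + mp_tau a q.
Proof. by rewrite rmorphD /= mp_tauZ. Qed.

Lemma W_T_bracket a b (p r : P) v : Gam a -> Gam b -> p@_0%MM = 0 -> r@_0%MM = 0 ->
  T a p (T b r v) - T b r (T a p v) = T (a + b) (mp_tau b p * r - mp_tau a r * p) v.
Proof.
move=> Ga Gb p0; move: p p0 r.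
pose Q2 p r := T a p (T b r v) - T b r (T a p v) = T (a + b) (mp_tau b p * r - mp_tau a r * p) v.
apply: (@nonconst_ind F n (fun p => forall r, r@_0%MM = 0 -> Q2 p r)) => [r _|c p q Hp Hq r r0|m m0]; rewrite /Q2.
- by rewrite !W_op0 (lin0 (W_T_lin _ _)) rmorph0 mul0r mulr0 !subrr W_op0.
- rewrite !W_op_lin (W_T_lin b r) opprD addrACA -scalerBr Hp // Hq // -W_op_lin.
  congr (W_op act _ _ _); rewrite (mp_tau_lin b c p q).
  by rewrite -[RHS]opprB cross_lin opprD -scalerN !opprB.
(* Generalizing ['X_[m]] keeps unification from unfolding it. *)
apply: (@nonconst_ind F n (Q2 'X_[m])) => [|c p q|m' m0']; rewrite /Q2.
- by move: 'X_[m] => s; rewrite !W_op0 (lin0 (W_T_lin _ _)) rmorph0 mul0r mulr0 !subrr W_op0.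
- move: 'X_[m] => s Hp Hq; rewrite (W_op_lin act b) (W_op_lin act b) (W_T_lin a s).
  rewrite opprD addrACA -scalerBr Hp Hq -W_op_lin.
  by congr (W_op act _ _ _); rewrite (mp_tau_lin a c p q) cross_lin.
rewrite !W_opX (proj2 WMod); try exact: ffun_mnm_adm.
set mu := ffun_mnm m; set nu := ffun_mnm m'; set N := (mabs mu + mabs nu).+1.
have le_mabs (ka : {ffun 'I_n -> nat}) i : (ka i <= mabs ka)%N.
  by rewrite /mabs (bigD1 i) //= leq_addr.
have mE : m = mnm_ffun mu by rewrite ffun_mnmK.
have m'E : m' = mnm_ffun nu by rewrite ffun_mnmK.
have e1 := mp_tau_mulX b (mu := mu) nu (N := N).
have e2 := mp_tau_mulX a (mu := nu) mu (N := N).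
rewrite mE m'E e1 => [|i]; last by rewrite ltnS (leq_trans (le_mabs mu i)) ?leq_addr.
rewrite e2 => [|i]; last by rewrite ltnS (leq_trans (le_mabs nu i)) ?leq_addl.
rewrite W_opB !W_op_sum.
by congr (_ - _); apply: eq_bigr => la _; congr (_ *: act (_, _) v); rewrite mnm_ffunK //;
  apply/ffunP => i; rewrite !ffunE addnC.
Qed.

Lemma W_allowed0 b (p : P) : allowed (A := PF) false b p -> p@_0%MM = 0.
Proof. by rewrite /allowed -mp_ev0. Qed.

Lemma W_T_mem (S : V -> Prop) b (p : P) v : subspace S -> p@_0%MM = 0 ->
  (forall mu, mu != [ffun => 0%N] -> S (act (b, mu) v)) -> S (T b p v).
Proof.
move=> SS p0 Sact; rewrite /W_op big_seq; apply: subspace_sum => // m mp.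
apply: subspaceZ => //; apply: Sact; apply: contraTneq mp => E0.
have -> : m = 0%MM by apply/mnmP => i; have /ffunP/(_ i) := E0; rewrite !ffunE mnm0E.
by rewrite mcoeff_msupp p0 eqxx.
Qed.

Lemma row_tors_free : torsion_free 'rV[F]_n.
Proof.
move=> x k /eqP; rewrite -scaler_nat scaler_eq0 (negPf (char0 k)) => /eqP; exact.
Qed.

Lemma W_Vg_sub g : subspace (Vg g).
Proof.
case: QF => QV _; have [V0 [VD VZ]] := QV g; split=> // a u v gu gv.
by apply: VD => //; apply: VZ.
Qed.

Lemma W_weyl : weyl_module (A := PF) false Gam Vg T.
Proof.
have [Q1 [Q2 [Q3 [Q4 [Q5 Q6]]]]] := QF; split.
- exact: row_tors_free.
- exact: GG.
- exact: W_T_lin.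
- by move=> *; apply: W_op_lin.
- move=> a b p r v Ga Gb /W_allowed0 p0 /W_allowed0 r0 _; exact: W_T_bracket.
- move=> a p r Ga _ /W_allowed0 p0 /W_allowed0 r0; exists 0 => v.
  rewrite scale0r addr0 W_T_bracket ?addrN //; exact: (subgN GG).
- exact: W_Vg_sub.
- move=> g; have [b bP] := Q5 g; exists (size b).
  by apply: (dim_le_span (b := fun k => b`_k)) => v /bP[c ->];
    exists (fun k => if insub k is Some j then c j else 0); apply: eq_bigr => k _; rewrite valK.
- exact: Q3.
- move=> b p g v Gb /W_allowed0 p0 vg; apply: W_T_mem => // [|mu mu0]; first exact: W_Vg_sub.
  exact: (Q6 (b, mu)).
- move=> S [S0 SL] ST; apply: (proj2 IRR); split=> //.
  + by move=> u v Su Sv; rewrite -[u]scale1r; apply: SL.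
  + by move=> a v Sv; rewrite -[a *: v]addr0; apply: SL.
  + move=> [b mu] v [/= Gb mu0] Sv; rewrite -(mnm_ffunK mu) -W_opX; apply: ST => //.
    rewrite /allowed /= mp_ev0 mcoeffX; case: eqP => // E0.
    case/eqP: mu0; apply/ffunP => i; rewrite ffunE.
    by have /mnmP/(_ i) := E0; rewrite mnmE mnm0E.
- exact: (proj1 IRR).
Qed.

Lemma W_exact : exact_brackets (A := PF) false Gam T.
Proof.
move=> a p r v Ga _ /W_allowed0 p0 /W_allowed0 r0.
by rewrite /bracket W_T_bracket ?addrN //; apply: (subgN GG).
Qed.

Lemma W_comm0 (p r : P) v : allowed (A := PF) false 0 p -> allowed (A := PF) false 0 r ->
  T 0 p (T 0 r v) = T 0 r (T 0 p v).
Proof.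
move=> /W_allowed0 p0 /W_allowed0 r0; have G0 := subg0 GG.
apply/eqP; rewrite -subr_eq0 W_T_bracket // addr0.
by rewrite !mp_tau0 mulrC subrr W_op0.
Qed.

Lemma W_act_T b mu v : act (b, mu) v = T b 'X_[mnm_ffun mu] v.
Proof. by rewrite W_opX mnm_ffunK. Qed.

Lemma W_allowedX b mu : mu != [ffun => 0%N] -> allowed (A := PF) false b 'X_[mnm_ffun mu].
Proof.
move=> mu0; rewrite /allowed /= mp_ev0 mcoeffX; case: eqP => // E0.
case/eqP: mu0; apply/ffunP => i; rewrite ffunE.
by have /mnmP/(_ i) := E0; rewrite mnmE mnm0E.
Qed.

Lemma mpow0 mu : mu != [ffun => 0%N] -> mpow (0 : 'rV[F]_n) mu = 0.
Proof.
by move=> mu0; rewrite -mp_evXm; have := W_allowedX 0 mu0.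
Qed.

(** The basis vector of index 0 spans a trivial submodule of [A_0], because [mpow 0 mu = 0] for [mu]
    nonzero. *)
Lemma W_trivial_intermediate : (forall i (v : V), Wadm Gam i -> act i v = 0) -> W_intermediate Gam act.
Proof.
move=> act0; have [v0 v00] := proj1 IRR; have vE := one_dim IRR v00 act0.
exists 0; left.
apply: (@intermediate_iso F _ Gam GG V _ _ (@Wdeg F n) act (fun i k => mpow (0 + k) i.2)
  (W_actA 0) (fun=> v0) (fun k => k = 0)) => //.
- exact: W_act_lin.
- by move=> i [].
- by move=> i k ai _ ->; rewrite addr0 act0 // mpow0 ?scale0r //; case: ai.
- by move=> i k [_ mu0] _ ->; rewrite addr0 mpow0 ?eqxx.
- move=> v U SU UP; have [c ->] := vE v; apply: subspaceZ => //.
  by apply: (UP 0) => //; apply: (subg0 GG).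
Qed.

(** The basis vector of index [k] stands for the site [q + k]; if that site is 0, it falls into the
    kernel. *)
Lemma W_particle_intermediate x q Y : Gam x -> x != 0 ->
  particle (A := PF) false Gam T q Y -> W_intermediate Gam act.
Proof.
move=> Gx x0 YP; have YE := particle_all W_weyl Gx x0 W_exact YP.
have [q0 Y0 _ _ Ysp] := YP; exists q; left.
apply: (@intermediate_iso F _ Gam GG V _ _ (@Wdeg F n) act (fun i k => mpow (q + k) i.2)
  (W_actA q) (fun k => Y (q + k)) (fun=> True)) => //.
- exact: W_act_lin.
- by move=> i [].
- move=> [b mu] k [Gb mu0] Gk _; rewrite /= in Gb mu0 *.
  have [qk|qk] := eqVneq (q + k) 0.
    by rewrite qk Y0 (lin0 (W_act_lin _)) mpow0 // scale0r.
  rewrite W_act_T YE //; last by rewrite [q + k]addrC addrK.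
    by rewrite /= mp_evXm /Wdeg /= -addrA [k + b]addrC.
  exact: W_allowedX.
- move=> v U SU UP; apply: (Ysp v U SU) => d Gd.
  by have := UP (d - q) Gd I; rewrite addrC subrK; apply.
Qed.

Lemma mpowN (a : 'rV[F]_n) mu : mpow (- a) mu = (-1) ^+ mabs mu * mpow a mu.
Proof.
rewrite /mpow /mabs -prodrXr -big_split; apply: eq_bigr => i _ /=.
by rewrite mxE [LHS]exprNn.
Qed.

(** Hops onto the site 0 vanish but hops off it need not, so the basis vector at 0 is left out and
    the others still span a submodule of [B_q]. *)
Lemma W_dual_intermediate x q Y : Gam x -> x != 0 ->
  particle (A := PF) true Gam (dual_op (A := PF) T) q Y -> W_intermediate Gam act.
Proof.
move=> Gx x0 YP; have DM := dual_weyl_module W_weyl.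
have YE := particle_all DM Gx x0 (dual_exact W_weyl W_exact) YP.
have [q0 Y0 _ _ Ysp] := YP; exists q; right.
apply: (@intermediate_iso F _ Gam GG V _ _ (@Wdeg F n) act
  (fun i k => (-1) ^+ (mabs i.2).+1 * mpow (q + i.1 + k) i.2)
  (W_actB q) (fun k => Y (q + k)) (fun k => q + k != 0)) => //.
- exact: W_act_lin.
- by move=> i [].
- move=> [b mu] k [Gb mu0] Gk qk; rewrite /= in Gb mu0 *.
  have okX : allowed (A := PF) false b 'X_[mnm_ffun mu] by apply: W_allowedX.
  have := YE b (flip (A := PF) b 'X_[mnm_ffun mu]) (q + k) Gb.
  rewrite /dual_op -/(flip _ _) flipK -W_act_T ev_flip.
  have -> : q + k + b = q + b + k by rewrite addrAC.
  rewrite /= mp_evXm mpowN => H; rewrite -[LHS]opprK H //.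
  + by rewrite exprS mulN1r mulNr scaleNr /Wdeg /= addrA.
  + by apply: (allowed_flip (sg := true)).
  + by rewrite [q + k]addrC addrK.
- move=> [b mu] k [Gb mu0] Gk qk /=; apply: contraNneq => E0.
  by rewrite -addrA E0 mpow0 // mulr0.
- move=> v U SU UP; apply: (Ysp v U SU) => d Gd; have [->|d0] := eqVneq d 0.
    by rewrite Y0; case: SU.
  by have := UP (d - q) Gd; rewrite addrC subrK; apply.
Qed.

Lemma W_zero_action x : Gam x -> x != 0 -> no_action (A := PF) false Gam T ->
  forall i (v : V), Wadm Gam i -> act i v = 0.
Proof.
move=> Gx x0 T0 [b mu] v [Gb mu0]; rewrite W_act_T.
by apply: (no_action_all W_weyl Gx x0 W_exact T0) => //; apply: W_allowedX.
Qed.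

Lemma W_cases x : Gam x -> x != 0 ->
  no_action (A := PF) false Gam T \/ (exists q Y, particle (A := PF) false Gam T q Y) \/
  (exists q Y, particle (A := PF) true Gam (dual_op (A := PF) T) q Y) ->
  W_intermediate Gam act.
Proof.
move=> Gx x0 [T0|[[q [Y YP]]|[q [Y YP]]]].
- exact/W_trivial_intermediate/(W_zero_action Gx x0).
- exact: W_particle_intermediate Gx x0 YP.
- exact: W_dual_intermediate Gx x0 YP.
Qed.

Lemma W_not_Z : ~ iso_to_Z Gam -> nondegenerate_subgroup Gam -> W_intermediate Gam act.
Proof.
move=> notZ [M [MG Mu]].
have [[x [Gx x0]]|no] := classic (exists x, Gam x /\ x != 0).
  apply: (W_cases Gx x0); apply: (classification_one_end W_weyl Gx x0).
  exact: (fresh_line_exists row_tors_free GG Gx x0 notZ).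
(* If [Gam] has no nonzero element, nondegeneracy forces [n = 0], and then no [mu] is nonzero. *)
apply: W_trivial_intermediate => -[b mu] v [_ /=] /negP []; apply/eqP/ffunP => i.
case: no; exists (row i M); split=> //; apply/eqP => ri.
have := row_free_unit M; rewrite Mu => /row_freeP[N MN].
have := congr1 (fun B => row i B) MN; rewrite row_mul ri mul0mx => /rowP/(_ i)/eqP.
by rewrite !mxE eqxx eq_sym oner_eq0.
Qed.

Lemma W_weight x y g w (pos : 'rV[F]_n -> Prop) : Gam x -> x != 0 -> y = x \/ y = - x ->
  (forall a, Gam a -> pos a -> exists k, a = y *+ k.+1) ->
  Vg g w -> w != 0 ->
  (forall k p, allowed (A := PF) false (y *+ k.+1) p -> T (y *+ k.+1) p w = 0) ->
  weight_module_wrt (Wadm Gam) (@Wdeg F n) act Vg pos.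
Proof.
move=> Gx x0 yx posP wg w0 wP.
have Gy : Gam y by case: yx => ->; [|apply: (subgN GG)].
have y0 : y != 0 by case: yx => ->; rewrite ?oppr_eq0.
have [w' [w'g w'0 eig kill]] := weight_vector W_weyl W_comm0 Gy y0 wg w0 wP.
exists g, w'; split=> //.
- move=> [b mu] [_ /= mu0] /= b0; have [l lE] := eig _ (W_allowedX 0 mu0).
  by exists l; rewrite W_act_T -lE -b0.
- move=> [b mu] [/= Gb mu0] /posP-/(_ Gb)[k]; rewrite /Wdeg /= => bE.
  by rewrite W_act_T bE kill //; apply: W_allowedX.
- by move=> S SS Sw'; apply: (proj2 IRR) => //; exists w'.
Qed.

End WClassification.

(** * The central extension *)

Section FallingFactorial.
Context (F : fieldType).

Lemma size_ffact k : size (ffact F k) = k.+1.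
Proof. by rewrite /ffact size_prod_XsubC /index_enum -enumT size_enum_ord. Qed.

Lemma lead_ffact k : (ffact F k)`_k = 1.
Proof.
have /monicP := monic_prod_XsubC (index_enum 'I_k) predT (fun i => i%:R : F).
by rewrite /lead_coef -/(ffact F k) size_ffact.
Qed.

Lemma ffact_root0 k : (0 < k)%N -> (ffact F k).[0] = 0.
Proof. by case: k => // k _; rewrite /ffact big_ord_recl hornerM hornerXsubC subrr mul0r. Qed.

Lemma ffact1 : ffact F 1 = 'X.
Proof. by rewrite /ffact big_ord1 subr0. Qed.

(** [ffact F k] is monic of degree [k], so those with [k] positive form a basis of the polynomials
    vanishing at 0. *)
Lemma ffact_ind (Q : {poly F} -> Prop) : Q 0 ->
  (forall (c : F) p q, p.[0] = 0 -> q.[0] = 0 -> Q p -> Q q -> Q (c *: p + q)) ->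
  (forall k, (0 < k)%N -> Q (ffact F k)) -> forall p, p.[0] = 0 -> Q p.
Proof.
move=> Q0 QL Qf p; move: {2}(size p) (leqnn (size p)) => n; elim: n p => [|n IHn] p.
  by rewrite leqn0 size_poly_eq0 => /eqP ->.
move=> pn p0; case: n => [|n] in IHn pn *.
  by move: p0; rewrite (size1_polyC pn) hornerC => ->.
have -> : p = p`_n.+1 *: ffact F n.+1 + (p - p`_n.+1 *: ffact F n.+1) by rewrite addrC subrK.
have r0 : (p - p`_n.+1 *: ffact F n.+1).[0] = 0.
  by rewrite !hornerE p0 ffact_root0 // mulr0 subrr.
apply: QL => //; [exact: ffact_root0|exact: Qf|apply: IHn => //].
apply/leq_sizeP => j; rewrite leq_eqVlt coefB coefZ => /orP[/eqP <-|nj].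
  by rewrite lead_ffact mulr1 subrr.
have pj : (size p <= j)%N by apply: leq_trans pn nj.
by rewrite [p`_j]nth_default // [_`_j]nth_default ?size_ffact // mulr0 subrr.
Qed.

(** The cocycle vanishes for [alpha = 0], which keeps the degree-0 operators commuting. *)
Lemma gbinom0 mu nu : gbinom (mu%:R : F) (mu + nu).+1 = 0.
Proof.
have lt : (mu < (mu + nu).+1)%N by rewrite ltnS leq_addr.
by rewrite /gbinom (bigD1 (Ordinal lt)) //= subrr !mul0r.
Qed.

Lemma gbinom3 (x : F) : gbinom x 3 = x * (x - 1) * (x - 2%:R) / 6%:R.
Proof. by rewrite /gbinom !big_ord_recr big_ord0 /= mul1r subr0. Qed.

End FallingFactorial.

(** * Comparison of [mpoly 1 F] with [{poly F}] *)

Section OneVariable.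
Context (F : closedFieldType).
Notation P := (mpoly 1 F).

Definition poly1 : {rmorphism P -> {poly F}} := mmap polyC (fun=> 'X).

Lemma poly1Z c p : poly1 (c *: p) = c *: poly1 p.
Proof. by rewrite /poly1 /= mmapZ mul_polyC. Qed.

Lemma poly1X i : poly1 'X_i = 'X.
Proof. by rewrite /poly1 /= mmapX mmap1U. Qed.
Opaque poly1.

Lemma poly1_ev (a : 'rV[F]_1) p : (poly1 p).[a 0 0] = mp_ev a p.
Proof.
pose e : {rmorphism P -> F} := horner_eval (a 0 0) \o poly1.
apply: (@mpoly_ext F 1 F^o e (mp_ev a)) => [c q|c q|i] /=.
- by rewrite /horner_eval poly1Z hornerZ.
- exact: mp_evZ.
- by rewrite /horner_eval poly1X hornerX mp_evX ord1.
Qed.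

Lemma poly1_tau (b : 'rV[F]_1) p : poly1 (mp_tau b p) = poly1 p \Po ('X + (b 0 0)%:P).
Proof.
pose e : {rmorphism P -> {poly F}} := comp_poly ('X + (b 0 0)%:P) \o poly1.
apply: (@mpoly_ext F 1 _ (poly1 \o mp_tau b) e) => [c q|c q|i] /=.
- by rewrite mp_tauZ poly1Z.
- by rewrite poly1Z comp_polyZ.
- by rewrite mp_tauX rmorphD /= poly1Z poly1X rmorph1 comp_polyX ord1 alg_polyC.
Qed.

Lemma poly1_surj q : exists p, poly1 p = q.
Proof.
elim/poly_ind: q => [|q c [p pq]]; first by exists 0; rewrite rmorph0.
exists (p * 'X_0 + c%:A); rewrite rmorphD rmorphM /= pq poly1X poly1Z rmorph1.
by rewrite alg_polyC.
Qed.

Lemma row1E (x : 'rV[F]_1) : x = const_mx (x 0 0).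
Proof. by apply/rowP => i; rewrite mxE ord1. Qed.

End OneVariable.
Arguments poly1 {F}.

Section HatOps.
Context (F : closedFieldType).
Context (V : lmodType F) (act : Hind F -> V -> V).
Context (Gam : F -> Prop) (Vg : F -> V -> Prop) (GG : add_subgroup Gam).
Context (HM : H_module Gam act).
Context (QF : quasifinite (Hadm Gam) (@Hdeg F) act Gam Vg).
Context (IRR : irreducible (Hadm Gam) act).
Local Notation S a p := (act (Some (a, p))).

Lemma H_act_lin i : lin (act i).
Proof. by case: HM => actL _ _ _ a u v; apply: actL. Qed.

(** Bilinearity extends the cocycle from falling factorials to all symbols; only its vanishing
    outside opposite nonzero degrees is retained. *)
Lemma H_bracket a b p q : Gam a -> Gam b -> p.[0] = 0 -> q.[0] = 0 ->
  exists l : F, (a + b != 0 \/ a = 0 -> l = 0) /\ forall v,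
    S a p (S b q v) - S b q (S a p v) =
    S (a + b) ((p \Po ('X + b%:P)) * q - (q \Po ('X + a%:P)) * p) v + l *: act None v.
Proof.
have [_ actp _ ffactB] := HM; move=> Ga Gb p0; move: p p0 q; have Gab := subgD GG Ga Gb.
pose E p q l v := S a p (S b q v) - S b q (S a p v) =
    S (a + b) ((p \Po ('X + b%:P)) * q - (q \Po ('X + a%:P)) * p) v + l *: act None v.
have act0 d v : Gam d -> S d 0 v = 0.
  move=> Gd; have := actp d (-1) 0 0 v Gd (horner0 _) (horner0 _).
  by rewrite scaler0 addr0 scaleN1r addNr.
have sym0 p q : p.[0] = 0 -> q.[0] = 0 ->
    ((p \Po ('X + b%:P)) * q - (q \Po ('X + a%:P)) * p).[0] = 0.
  by move=> p0 q0; rewrite !hornerE p0 q0 !mulr0 subrr.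
have shuffle (c l l' : F) (u w z : V) : 
    c *: (u + l *: z) + (w + l' *: z) = (c *: u + w) + (c * l + l') *: z.
  by rewrite scalerDr scalerA addrACA -scalerDl.
apply: (@ffact_ind _ (fun p => forall q, q.[0] = 0 -> exists l : F,
  (a + b != 0 \/ a = 0 -> l = 0) /\ forall v, E p q l v)).
- move=> q q0; exists 0; split=> // v; rewrite /E !act0 // (lin0 (H_act_lin _)) comp_poly0.
  by rewrite mul0r mulr0 !subrr act0 // add0r scale0r.
- move=> c p p' p0 p'0 Hp Hp' q q0; have [l [l0 lE]] := Hp q q0; have [l' [l'0 l'E]] := Hp' q q0.
  exists (c * l + l'); split=> [h|v]; first by rewrite l0 // l'0 // mulr0 addr0.
  rewrite /E !actp // (H_act_lin _) opprD addrACA -scalerBr lE l'E comp_polyD comp_polyZ.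
  rewrite -[X in _ = act (Some (_, X)) _ + _]opprB cross_lin opprD -scalerN !opprB actp ?sym0 //.
move=> mu mu0; apply: ffact_ind.
- exists 0; split=> // v; rewrite /E !act0 // (lin0 (H_act_lin _)) comp_poly0.
  by rewrite mul0r mulr0 !subrr act0 // add0r scale0r.
- move: (ffact F mu) (ffact_root0 F mu0) => q q0 c p p' p0 p'0 [l [l0 lE]] [l' [l'0 l'E]].
  exists (c * l + l'); split=> [h|v]; first by rewrite l0 // l'0 // mulr0 addr0.
  rewrite /E !actp // (H_act_lin _) opprD addrACA -scalerBr lE l'E comp_polyD comp_polyZ.
  by rewrite cross_lin actp ?sym0 //; apply: shuffle.
move=> nu nu0; eexists; split; last by move=> v; apply: ffactB.
case=> [ab|a0]; first by rewrite -addr_eq0 (negPf ab).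
by case: ifP => // _; rewrite a0 add0r gbinom0 mulr0.
Qed.

(** Schur's lemma: [C] preserves a finite-dimensional graded piece, and an eigenspace of [C] is a
    submodule. *)
Lemma central_scalar : exists c : F, forall v, act None v = c *: v.
Proof.
have [Q1 [_ [Q3 [_ [Q5 Q6]]]]] := QF; have [_ _ comm _] := HM.
have VS g : subspace (Vg g).
  by have [V0 [VD VZ]] := Q1 g; split=> // a u v gu gv; apply: VD => //; apply: VZ.
have [g [v [vg v0]]] : exists g v, Vg g v /\ v != 0.
  have [v v0] := proj1 IRR; have [s [sV vE]] := Q3 v.
  apply: NNPP => no; case/eqP: v0; rewrite vE big_seq big1 // => x xs.
  by apply/eqP; apply: contra_notT no => x0; exists x.1, x.2; split=> //; apply: sV.
have [b bP] := Q5 g.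
have dg : dim_le (size b) (Vg g).
  apply: (dim_le_span (b := fun k => b`_k)) => u /bP[c ->].
  by exists (fun k => if insub k is Some j then c j else 0); apply: eq_bigr => k _; rewrite valK.
have Cg u : Vg g u -> Vg g (act None u).
  by move=> ug; have := Q6 None g u I ug; rewrite add0r.
have [c [w [_ w0 wE]]] := eigenvector_exists (H_act_lin None) (VS g) Cg dg vg v0.
exists c; apply: (proj2 IRR); last by exists w.
have CL := H_act_lin None; split.
- by rewrite (lin0 CL) scaler0.
- by move=> u u' uE u'E; rewrite (linD CL) uE u'E scalerDr.
- by move=> a u uE; rewrite (linZ CL) uE !scalerA mulrC.
- by move=> i u ai uE; rewrite comm // uE (linZ (H_act_lin i)).
Qed.

End HatOps.

Section HatClassification.
Context (F : closedFieldType) (char0 : forall k, k.+1%:R != 0 :> F).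
Context (V : lmodType F) (act : Hind F -> V -> V).
Context (Gam : F -> Prop) (Vg : F -> V -> Prop) (GG : add_subgroup Gam).
Context (HM : H_module Gam act).
Context (QF : quasifinite (Hadm Gam) (@Hdeg F) act Gam Vg).
Context (IRR : irreducible (Hadm Gam) act).
Notation X := 'rV[F]_1.
Notation PF := (mp_polyfun char0 1).
Notation rowG := (fun x : X => Gam (x 0 0)).
Notation rowV := (fun x : X => Vg (x 0 0)).

(** Degrees become rows of length 1 and symbols elements of [mpoly 1 F], so that [mp_polyfun]
    applies. *)
Definition H_op (b : X) (p : mpoly 1 F) := act (Some (b 0 0, poly1 p)).
Notation T := H_op.

Context (c : F) (cE : forall v, act None v = c *: v).

Lemma rowG_grp : add_subgroup rowG.
Proof. by case: GG => G0 GB; split=> [|x y Gx Gy]; rewrite !mxE //; apply: GB. Qed.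

Lemma H_allowed0 b (p : mpoly 1 F) : allowed (A := PF) false b p <-> (poly1 p).[0] = 0.
Proof. by rewrite /allowed /= -poly1_ev mxE. Qed.

Lemma H_op_bracket (a b : X) (p r : mpoly 1 F) : rowG a -> rowG b ->
  allowed (A := PF) false a p -> allowed (A := PF) false b r ->
  exists l : F, (a + b != 0 \/ a = 0 \/ c = 0 -> l = 0) /\ forall v,
  T a p (T b r v) - T b r (T a p v) = T (a + b) (mp_tau b p * r - mp_tau a r * p) v + l *: v.
Proof.
move=> Ga Gb /H_allowed0 p0 /H_allowed0 r0.
have [l [l0 lE]] := H_bracket GG HM Ga Gb p0 r0.
exists (l * c); split=> [|v]; last first.
  by rewrite lE cE scalerA /H_op rmorphB !rmorphM /= !poly1_tau mxE.
case=> [ab|[a0|->]]; last by rewrite mulr0.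
- rewrite l0 ?mul0r //; left; apply: contraNneq ab => E0; apply/eqP/rowP => i.
  by rewrite ord1 !mxE.
- by rewrite l0 ?mul0r //; right; rewrite a0 mxE.
Qed.

Lemma H_op_linp (b : X) (k : F) (p q : mpoly 1 F) v : rowG b ->
  allowed (A := PF) false b p -> allowed (A := PF) false b q ->
  T b (k *: p + q) v = k *: T b p v + T b q v.
Proof.
have [_ actp _ _] := HM; move=> Gb /H_allowed0 p0 /H_allowed0 q0.
by rewrite /H_op rmorphD /= poly1Z actp.
Qed.

Lemma rowGI a : Gam a -> rowG (const_mx a).
Proof. by rewrite /= mxE. Qed.

Lemma row_neq0 (a : F) : a != 0 -> const_mx a != 0 :> X.
Proof. by apply: contraNneq => /rowP/(_ 0); rewrite !mxE => ->. Qed.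

Lemma H_act_T a p v : p.[0] = 0 ->
  exists2 r, allowed (A := PF) false (const_mx a) r & poly1 r = p /\ act (Some (a, p)) v = T (const_mx a) r v.
Proof.
move=> p0; have [r rp] := poly1_surj p; exists r; first by apply/H_allowed0; rewrite rp.
by rewrite /H_op rp mxE.
Qed.

Lemma H_weyl : weyl_module (A := PF) false rowG rowV T.
Proof.
have [Q1 [Q2 [Q3 [Q4 [Q5 Q6]]]]] := QF; split.
- exact: row_tors_free.
- exact: rowG_grp.
- by move=> b p; apply: (H_act_lin HM).
- exact: H_op_linp.
- move=> a b p r v Ga Gb okp okr ab; have [l [l0 ->]] := H_op_bracket Ga Gb okp okr.
  by rewrite l0 ?scale0r ?addr0 //; left.
- move=> a p r Ga _ okp okr.
  have [l [_ lE]] := H_op_bracket Ga (subgN rowG_grp Ga) okp okr.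
  by exists l => v; rewrite lE addrN.
- move=> g; have [V0 [VD VZ]] := Q1 (g 0 0); split=> // a u v gu gv.
  by apply: VD => //; apply: VZ.
- move=> g; have [b bP] := Q5 (g 0 0); exists (size b).
  by apply: (dim_le_span (b := fun k => b`_k)) => v /bP[d ->];
    exists (fun k => if insub k is Some j then d j else 0); apply: eq_bigr => k _; rewrite valK.
- move=> v; have [s [sV ->]] := Q3 v; exists [seq (const_mx x.1, x.2) | x <- s].
  by split=> [y /mapP[x xs ->]|]; rewrite ?big_map //= mxE; apply: sV.
- move=> b p g v Gb /H_allowed0 p0 vg.
  by have := Q6 (Some (b 0 0, poly1 p)) (g 0 0) v (conj Gb p0) vg; rewrite !mxE.
- move=> S SS ST; apply: (proj2 IRR); split=> //.
  + by case: SS.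
  + by move=> u v Su Sv; apply: subspaceD.
  + by move=> a v Sv; apply: subspaceZ.
  + case=> [[a p]|] v; last by move=> _ Sv; rewrite cE; apply: subspaceZ.
    move=> [/= Ga p0] Sv; have [r okr [_ ->]] := H_act_T a v p0.
    by apply: ST => //; apply: rowGI.
- exact: (proj1 IRR).
Qed.

Lemma H_comm0 (p r : mpoly 1 F) v : allowed (A := PF) false 0 p -> allowed (A := PF) false 0 r ->
  T 0 p (T 0 r v) = T 0 r (T 0 p v).
Proof.
move=> p0 r0; have G0 := subg0 rowG_grp.
have [l [l0 lE]] := H_op_bracket G0 G0 p0 r0.
apply/eqP; rewrite -subr_eq0 lE l0; last by right; left.
rewrite scale0r !mp_tau0 mulrC subrr !addr0.
by have := H_op_linp (-1) v G0 p0 p0; rewrite scaleN1r addNr scaleN1r addNr => ->.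
Qed.

Lemma H_exact : c = 0 -> exact_brackets (A := PF) false rowG T.
Proof.
move=> c0 a p r v Ga _ okp okr.
have [l [l0 lE]] := H_op_bracket Ga (subgN rowG_grp Ga) okp okr.
by rewrite /bracket lE l0 ?scale0r ?addr0 ?addrN //; right; right.
Qed.

Notation listed := (no_action (A := PF) false rowG T \/
  (exists q Y, particle (A := PF) false rowG T q Y) \/
  (exists q Y, particle (A := PF) true rowG (dual_op (A := PF) T) q Y)).

(* The brackets of t^a D and t^-a D, evaluated at a common eigenvector, depend linearly on
   [a], up to the central term, which is cubic in [a]. *)
Lemma central_zero a : Gam a -> a != 0 -> listed -> c = 0.
Proof.
move=> Ga a0 cases; have [y [s [d [y0 yE]]]] := bracket_eigen H_weyl cases.
have [_ actp _ ffactB] := HM.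
pose z := act (Some (0, 'X)) y - (s * d 0 0) *: y.
have key b : Gam b -> b != 0 -> (b *+ 2) *: z = - (gbinom (b + 1) 3 * c) *: y.
  move=> Gb b0; have GN : Gam (- b) by apply: (subgN GG).
  have B0 : const_mx b != 0 :> X by apply: row_neq0.
  have okX (e : X) : allowed (A := PF) false e 'X_0 by apply/H_allowed0; rewrite poly1X hornerX.
  have symE : ev PF d (bracket_symbol (A := PF) (const_mx b) 'X_0 'X_0) = - (b *+ 2) * d 0 0.
    rewrite /bracket_symbol rmorphB !rmorphM !ev_tau /= !mp_evX !mxE.
    by rewrite -mulrBl opprD addrACA subrr add0r -mulr2n mulNrn.
  have := yE _ _ _ (rowGI Gb) B0 (okX _) (okX _); rewrite symE.
  have := ffactB b (- b) 1%N 1%N y Gb GN isT isT.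
  rewrite !ffact1 opprK eqxx cE /bracket /H_op !poly1X !mxE => -> /=.
  have G0 : Gam 0 by apply: (subg0 GG).
  have := actp 0 (- (b *+ 2)) 'X 0 y G0; rewrite hornerX horner0 addr0 => /(_ erefl erefl).
  have := actp 0 (- 1) 0 0 y G0; rewrite horner0 scaler0 addr0 scaleN1r addNr => /(_ erefl erefl) ->.
  have symP : ('X + (- b)%:P) * 'X - ('X + b%:P) * 'X = (- (b *+ 2)) *: 'X :> {poly F}.
    by rewrite -mul_polyC !polyCN mulr2n polyCD; ring.
  rewrite !addr0 addrN !comp_polyX symP => ->.
  rewrite expr1 !mulr1 mulN1r scalerA => /(canRL (addKr _)) gE.
  rewrite -mulNr gE /z scalerBr scaleNr opprK scalerA; congr (_ + _).
  by rewrite -scaleNr; congr (_ *: _); ring.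
have Ga2 : Gam (a *+ 2) by rewrite mulr2n; apply: (subgD GG).
have a20 : a *+ 2 != 0 by rewrite -mulr_natl mulf_neq0.
(* Comparing [a *+ 2] with twice [a] removes the linear part: [gbinom (b + 1) 3] is
   [(b ^+ 3 - b) / 6], and the difference that remains is [a ^+ 3]. *)
have := congr1 (fun u => 2%:R *: u) (key _ Ga a0); rewrite /= scalerA mulr_natl (key _ Ga2 a20).
move/eqP; rewrite scalerA -subr_eq0 -scalerBl scaler_eq0 (negPf y0) orbF => /eqP cub.
have six : 6%:R != 0 :> F by [].
have : (a ^+ 3) * c = 0.
  by rewrite -[RHS]oppr0 -cub !gbinom3; field.
by move=> /eqP; rewrite mulf_eq0 expf_eq0 (negPf a0) => /eqP.
Qed.

Lemma H_trivial_intermediate : c = 0 -> (forall a p v, Gam a -> p.[0] = 0 -> act (Some (a, p)) v = 0) ->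
  H_intermediate Gam act.
Proof.
move=> c0 act0.
have act0' i (v : V) : Hadm Gam i -> act i v = 0.
  by case: i => [[a p]|] => [[Ga p0]|_]; [apply: act0|rewrite cE c0 scale0r].
have [v0 v00] := proj1 IRR; have vE := one_dim IRR v00 act0'.
exists 0; left.
apply: (@intermediate_iso F _ Gam GG V _ _ (@Hdeg F) act
  (fun i k => if i is Some (b, p) then p.[0 + k] else 0)
  (H_actA 0) (fun=> v0) (fun k => k = 0)).
- exact: H_act_lin HM.
- exact: H_actAE.
- by case=> [[b p]|] => [[]|_] //=; apply: (subg0 GG).
- move=> i k ai _ ->; rewrite act0' //.
  by case: i ai => [[b p]|] => [[_ p0]|_]; rewrite ?addr0 ?p0 scale0r.
- by case=> [[b p]|] k => [[_ p0] _ ->|_ _ _]; rewrite ?addr0 ?p0 eqxx.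
- move=> v U SU UP; have [e ->] := vE v; apply: subspaceZ => //.
  by apply: (UP 0) => //; apply: (subg0 GG).
Qed.

Lemma H_particle_intermediate x q Y : c = 0 -> rowG x -> x != 0 ->
  particle (A := PF) false rowG T q Y -> H_intermediate Gam act.
Proof.
move=> c0 Gx x0 YP; have YE := particle_all H_weyl Gx x0 (H_exact c0) YP.
have [q0 Y0 _ _ Ysp] := YP; exists (q 0 0); left.
apply: (@intermediate_iso F _ Gam GG V _ _ (@Hdeg F) act
  (fun i k => if i is Some (b, p) then p.[q 0 0 + k] else 0)
  (H_actA (q 0 0)) (fun k => Y (q + const_mx k)) (fun=> True)) => //.
- exact: H_act_lin HM.
- exact: H_actAE.
- by case=> [[b p]|] => [[]|_] //=; apply: (subg0 GG).
- case=> [[b p]|] k; last by rewrite cE c0 !scale0r.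
  move=> [Gb p0] Gk _; have [r okr [rp ->]] := H_act_T b (Y (q + const_mx k)) p0.
  have -> : p.[q 0 0 + k] = ev PF (q + const_mx k) r by rewrite /= -poly1_ev rp !mxE.
  have -> : q + const_mx (b + k) = q + const_mx k + const_mx b.
    by rewrite -addrA; congr (q + _); apply/rowP => i; rewrite !mxE addrC.
  have [qk|qk] := eqVneq (q + const_mx k) 0.
    by rewrite qk Y0 (lin0 (T_lin H_weyl _ _)) (okr : ev PF 0 r = 0) scale0r.
  rewrite YE //; first exact: rowGI.
  by rewrite [q + _]addrC addrK; apply: rowGI.
- move=> v U SU UP; apply: (Ysp v U SU) => d Gd.
  by have := UP ((d - q) 0 0) Gd I; rewrite -row1E addrC subrK; apply.
Qed.

Lemma H_dual_intermediate x q Y : c = 0 -> rowG x -> x != 0 ->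
  particle (A := PF) true rowG (dual_op (A := PF) T) q Y -> H_intermediate Gam act.
Proof.
move=> c0 Gx x0 YP; have DM := dual_weyl_module H_weyl.
have YE := particle_all DM Gx x0 (dual_exact H_weyl (H_exact c0)) YP.
have [q0 Y0 _ _ Ysp] := YP; exists (q 0 0); right.
apply: (@intermediate_iso F _ Gam GG V _ _ (@Hdeg F) act
  (fun i k => if i is Some (b, p) then - p.[- (q 0 0 + b + k)] else 0)
  (H_actB (q 0 0)) (fun k => Y (q + const_mx k)) (fun k => q 0 0 + k != 0)) => //.
- exact: H_act_lin HM.
- exact: H_actBE.
- by case=> [[b p]|] => [[]|_] //=; apply: (subg0 GG).
- case=> [[b p]|] k; last by rewrite cE c0 !scale0r.
  move=> [Gb p0] Gk qk; have [r okr [rp ->]] := H_act_T b (Y (q + const_mx k)) p0.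
  have qk0 : q + const_mx k != 0.
    by apply: contraNneq qk => /rowP/(_ 0); rewrite !mxE => ->.
  have -> : p.[- (q 0 0 + b + k)] = ev PF (- (q + const_mx k + const_mx b)) r.
    by rewrite /= -poly1_ev rp !mxE addrAC.
  have -> : q + const_mx (b + k) = q + const_mx k + const_mx b.
    by rewrite -addrA; congr (q + _); apply/rowP => i; rewrite !mxE addrC.
  have := YE (const_mx b) (flip (A := PF) (const_mx b) r) (q + const_mx k) (rowGI Gb).
  rewrite /dual_op -/(flip _ _) flipK ev_flip => H; rewrite -[LHS]opprK H ?scaleNr //.
    by apply: (allowed_flip (sg := true)).
  by rewrite [q + _]addrC addrK; apply: rowGI.
- case=> [[b p]|] k; last by rewrite eqxx.
  move=> [Gb p0] Gk qk /=; apply: contraNneq => E0.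
  by rewrite -addrA E0 oppr0 p0 oppr0.
- move=> v U SU UP; apply: (Ysp v U SU) => d Gd; have [->|d0] := eqVneq d 0.
    by rewrite Y0; case: SU.
  have := UP ((d - q) 0 0) Gd; rewrite -row1E [q + _]addrC subrK; apply.
  have -> : q 0 0 + (d - q) 0 0 = d 0 0 by rewrite !mxE addrCA subrr addr0.
  apply: contraNneq d0 => E0.
  by apply/eqP/rowP => i; rewrite ord1 E0 mxE.
Qed.

Lemma H_cases a : Gam a -> a != 0 -> listed -> H_intermediate Gam act.
Proof.
move=> Ga a0 cases; have c0 := central_zero Ga a0 cases.
have Gx := rowGI Ga; have x0 := row_neq0 a0.
case: cases => [T0|[[q [Y YP]]|[q [Y YP]]]].
- apply: H_trivial_intermediate => // b p v Gb p0; have [r okr [_ ->]] := H_act_T b v p0.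
  by apply: (no_action_all H_weyl Gx x0 (H_exact c0) T0) => //; apply: rowGI.
- exact: H_particle_intermediate c0 Gx x0 YP.
- exact: H_dual_intermediate c0 Gx x0 YP.
Qed.

Lemma H_not_Z a : Gam a -> a != 0 -> ~ iso_to_Z Gam -> H_intermediate Gam act.
Proof.
move=> Ga a0 notZ; apply: (H_cases Ga a0).
apply: (classification_one_end H_weyl (rowGI Ga) (row_neq0 a0)).
suff notZ' : ~ iso_to_Z rowG.
  exact: (fresh_line_exists (@row_tors_free F char0 1) rowG_grp (rowGI Ga) (row_neq0 a0) notZ').
move=> [f [fD fI fG]]; apply: notZ; exists (fun k => f k 0 0); split=> [k l|k l E0|e].
- by rewrite fD mxE.
- by apply: fI; rewrite [f k]row1E [f l]row1E E0.
- split=> [Ge|[k ->]]; last by apply/(fG (f k)); exists k.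
  by have [k kE] := (fG (const_mx e)).1 (rowGI Ge); exists k; rewrite -kE mxE.
Qed.

Lemma H_weight y g w (pos : F -> Prop) : Gam y -> y != 0 ->
  (forall a, Gam a -> pos a -> exists k, a = y *+ k.+1) ->
  Vg g w -> w != 0 ->
  (forall k p, allowed (A := PF) false (const_mx y *+ k.+1) p -> T (const_mx y *+ k.+1) p w = 0) ->
  weight_module_wrt (Hadm Gam) (@Hdeg F) act Vg pos.
Proof.
move=> Gy y0 posP wg w0 wP.
have wg' : rowV (const_mx g) w by rewrite /= mxE.
have [w' [w'g w'0 eig kill]] := weight_vector H_weyl H_comm0 (rowGI Gy) (row_neq0 y0) wg' w0 wP.
exists g, w'; split=> //.
- by move: w'g; rewrite mxE.
- case=> [[b p]|] /=; last by move=> _ _; exists c.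
  move=> [_ p0] ->; have [r okr [_ ->]] := H_act_T 0 w' p0.
  have z0 : const_mx 0 = 0 :> X by apply/rowP => i; rewrite !mxE.
  by rewrite z0 in okr *; apply: eig.
- case=> [[b p]|] /=.
    move=> [Gb p0] /(posP _ Gb)[k bE]; have [r okr [_ ->]] := H_act_T b w' p0.
    have bE' : const_mx b = const_mx y *+ k.+1 :> X by apply/rowP => i; rewrite mulmxnE !mxE bE.
    by rewrite bE' in okr *; apply: kill.
  move=> _ /(posP _ (subg0 GG))[k /esym/eqP]; rewrite -mulr_natl mulf_eq0.
  by rewrite (negPf (char0 k)) (negPf y0).
- by move=> S SS Sw'; apply: (proj2 IRR) => //; exists w'.
Qed.

End HatClassification.

(** * Integer gradings and one-dimensional nondegeneracy *)

Section IntegerGrading.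
Context (F : closedFieldType) (char0 : forall k, k.+1%:R != 0 :> F).

Lemma ZF_grp : add_subgroup (@ZF F).
Proof. by split=> [|_ _ [k ->] [l ->]]; [exists 0|exists (k - l); rewrite intrB]. Qed.

Lemma ZF_posE (a : F) : ZF_pos a -> exists k, a = 1 *+ k.+1.
Proof. by move=> [[[|k]|k] [// _ ->]]; exists k. Qed.

Lemma ZF_negE (a : F) : ZF_neg a -> exists k, a = (- 1) *+ k.+1.
Proof. by move=> [[k|k] [// _ ->]]; exists k; rewrite NegzE intrN mulNrn. Qed.

Lemma Zrow_ZF (x : 'rV[F]_1) : Zrow x <-> ZF (x 0 0).
Proof.
by split=> [[k ->]|[k kE]]; exists k; rewrite ?mxE // (row1E x) kE.
Qed.

Lemma Zrow_grp : add_subgroup (@Zrow F).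
Proof.
have [Z0 ZB] := ZF_grp.
by split=> [|x y /Zrow_ZF Zx /Zrow_ZF Zy]; apply/Zrow_ZF; rewrite !mxE //; apply: ZB.
Qed.

Lemma const_mxMn (a : F) k : const_mx (a *+ k) = const_mx a *+ k :> 'rV[F]_1.
Proof. by apply/rowP => i; rewrite mulmxnE !mxE. Qed.

Lemma Zrow_posE (a : 'rV[F]_1) : Zrow_pos a -> exists k, a = const_mx 1 *+ k.+1.
Proof.
move=> [k [k0 ->]]; have [|l ->] := @ZF_posE k%:~R; first by exists k.
by exists l; rewrite const_mxMn.
Qed.

Lemma Zrow_negE (a : 'rV[F]_1) : Zrow_neg a -> exists k, a = (- const_mx 1) *+ k.+1.
Proof.
move=> [k [k0 ->]]; have [|l ->] := @ZF_negE k%:~R; first by exists k.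
by exists l; rewrite const_mxMn; congr (_ *+ _); apply/rowP => i; rewrite !mxE.
Qed.

Lemma W_integer (V : lmodType F) (act : Wind F 1 -> V -> V) (Vg : 'rV[F]_1 -> V -> Prop) :
  W_module (@Zrow F) act ->
  quasifinite (Wadm (@Zrow F)) (@Wdeg F 1) act (@Zrow F) Vg ->
  irreducible (Wadm (@Zrow F)) act ->
  [\/ weight_module_wrt (Wadm (@Zrow F)) (@Wdeg F 1) act Vg (@Zrow_pos F),
      weight_module_wrt (Wadm (@Zrow F)) (@Wdeg F 1) act Vg (@Zrow_neg F)
    | W_intermediate (@Zrow F) act].
Proof.
move=> WM QF IRR; have GG := Zrow_grp; pose x : 'rV[F]_1 := const_mx 1.
have Gx : Zrow x by exists 1.
have x0 : x != 0 by apply: row_neq0; apply: oner_neq0.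
have [c1|[c2|[c3|[y [g [w [yx wg w0 wP]]]]]]] := classification char0 (W_weyl char0 GG WM QF IRR) Gx x0.
- by apply: Or33; apply: (W_cases (char0 := char0) GG WM QF IRR Gx x0); left.
- by apply: Or33; apply: (W_cases (char0 := char0) GG WM QF IRR Gx x0); right; left.
- by apply: Or33; apply: (W_cases (char0 := char0) GG WM QF IRR Gx x0); right; right.
case: yx => yE.
- apply: Or31; apply: (W_weight GG WM QF IRR Gx x0 (or_introl yE) _ wg w0 wP) => a _.
  by rewrite yE; apply: Zrow_posE.
- apply: Or32; apply: (W_weight GG WM QF IRR Gx x0 (or_intror yE) _ wg w0 wP) => a _.
  by rewrite yE; apply: Zrow_negE.
Qed.

Lemma H_integer (V : lmodType F) (act : Hind F -> V -> V) (Vg : F -> V -> Prop) :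
  H_module (@ZF F) act ->
  quasifinite (Hadm (@ZF F)) (@Hdeg F) act (@ZF F) Vg ->
  irreducible (Hadm (@ZF F)) act ->
  [\/ weight_module_wrt (Hadm (@ZF F)) (@Hdeg F) act Vg (@ZF_pos F),
      weight_module_wrt (Hadm (@ZF F)) (@Hdeg F) act Vg (@ZF_neg F)
    | H_intermediate (@ZF F) act].
Proof.
move=> HM QF IRR; have GG := ZF_grp; have [c cE] := central_scalar HM QF IRR.
have G1 : @ZF F 1 by exists 1.
have GN1 : @ZF F (- 1) by apply: (subgN GG).
have n1 : 1 != 0 :> F by apply: oner_neq0.
have nN1 : - 1 != 0 :> F by rewrite oppr_eq0.
have WM := H_weyl char0 GG HM QF IRR cE.
have cases := H_cases (char0 := char0) GG HM QF IRR cE G1 n1.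
have [c1|[c2|[c3|[y [g [w [yx wg w0 wP]]]]]]] := classification char0 WM (rowGI G1) (row_neq0 n1).
- by apply: Or33; apply: cases; left.
- by apply: Or33; apply: cases; right; left.
- by apply: Or33; apply: cases; right; right.
have N1E : const_mx (- 1) = - const_mx 1 :> 'rV[F]_1 by apply/rowP => i; rewrite !mxE.
have {}wg : Vg (g 0 0) w := wg.
case: yx => yE; rewrite {}yE in wP.
- apply: Or31; apply: (H_weight GG HM QF IRR cE G1 n1 _ wg w0 wP) => a _; exact: ZF_posE.
- rewrite -N1E in wP.
  apply: Or32; apply: (H_weight GG HM QF IRR cE GN1 nN1 _ wg w0 wP) => a _; exact: ZF_negE.
Qed.


Lemma H_nondegenerate (V : lmodType F) (act : Hind F -> V -> V) (Gam : F -> Prop) (Vg : F -> V -> Prop) :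
  add_subgroup Gam -> nondegenerate_subgroup (fun x : 'rV[F]_1 => Gam (x 0 0)) -> ~ iso_to_Z Gam ->
  H_module Gam act -> quasifinite (Hadm Gam) (@Hdeg F) act Gam Vg -> irreducible (Hadm Gam) act ->
  H_intermediate Gam act.
Proof.
move=> GG [M [MG Mu]] notZ HM QF IRR; have [c cE] := central_scalar HM QF IRR.
have := MG 0; rewrite mxE => GM.
apply: (H_not_Z char0 GG HM QF IRR cE GM _ notZ).
apply: contraTneq Mu => M0; rewrite unitmxE (mx11_scalar M) M0 det_scalar1 unitr0 //.
Qed.

End IntegerGrading.

Theorem theorem1p1 (F : closedFieldType) (charF0 : [pchar F] =i pred0) :
  (* (i) W(Z,1)^(1): highest weight, lowest weight, or intermediate series *)
  (forall (V : lmodType F) (act : Wind F 1 -> V -> V)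
          (Vg : 'rV[F]_1 -> V -> Prop),
     W_module (@Zrow F) act ->
     quasifinite (Wadm (@Zrow F)) (@Wdeg F 1) act (@Zrow F) Vg ->
     irreducible (Wadm (@Zrow F)) act ->
     [\/ weight_module_wrt (Wadm (@Zrow F)) (@Wdeg F 1) act Vg (@Zrow_pos F),
         weight_module_wrt (Wadm (@Zrow F)) (@Wdeg F 1) act Vg (@Zrow_neg F)
       | W_intermediate (@Zrow F) act]) /\
  (* (i) W_infty = hat W(Z,1)^(1) *)
  (forall (V : lmodType F) (act : Hind F -> V -> V) (Vg : F -> V -> Prop),
     H_module (@ZF F) act ->
     quasifinite (Hadm (@ZF F)) (@Hdeg F) act (@ZF F) Vg ->
     irreducible (Hadm (@ZF F)) act ->
     [\/ weight_module_wrt (Hadm (@ZF F)) (@Hdeg F) act Vg (@ZF_pos F),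
         weight_module_wrt (Hadm (@ZF F)) (@Hdeg F) act Vg (@ZF_neg F)
       | H_intermediate (@ZF F) act]) /\
  (* (ii) W(Gamma,n)^(1), Gamma nondegenerate_subgroup and not isomorphic to Z *)
  (forall (n : nat) (Gamma : 'rV[F]_n -> Prop),
     add_subgroup Gamma -> nondegenerate_subgroup Gamma -> ~ iso_to_Z Gamma ->
     forall (V : lmodType F) (act : Wind F n -> V -> V)
            (Vg : 'rV[F]_n -> V -> Prop),
       W_module Gamma act ->
       quasifinite (Wadm Gamma) (@Wdeg F n) act Gamma Vg ->
       irreducible (Wadm Gamma) act ->
       W_intermediate Gamma act) /\
  (* (ii) hat W(Gamma,1)^(1), Gamma <= F nondegenerate_subgroup, not isomorphic to Z *)
  (forall (Gamma : F -> Prop),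
     add_subgroup Gamma ->
     nondegenerate_subgroup (fun x : 'rV[F]_1 => Gamma (x 0 0)) ->
     ~ iso_to_Z Gamma ->
     forall (V : lmodType F) (act : Hind F -> V -> V) (Vg : F -> V -> Prop),
       H_module Gamma act ->
       quasifinite (Hadm Gamma) (@Hdeg F) act Gamma Vg ->
       irreducible (Hadm Gamma) act ->
       H_intermediate Gamma act).
Proof.
have char0 k : k.+1%:R != 0 :> F by have /pcharf0P -> := charF0.
split; [|split; [|split]].
- by move=> V act Vg WM QF IRR; apply: (W_integer char0).
- by move=> V act Vg HM QF IRR; apply: (H_integer char0).
- move=> n Gam GG ND notZ V act Vg WM QF IRR; exact: (W_not_Z char0 GG WM QF IRR notZ ND).
- move=> Gam GG ND notZ V act Vg HM QF IRR; exact: (H_nondegenerate char0 GG ND notZ HM QF IRR).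
Qed.
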